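(* Let $1\le m\le n$, $a\in\mathbb H^n$ and $\kappa_m=\frac{2n}{m}-1$. Then the function $$K_m(q):=\frac{-1}{|q-a|^{2\kappa_m}}$$ (with $K_m(a)=-\infty$) is $QSH_m$ on $\mathbb H^n$ and is the fundamental solution to the quaternionic $m$-Hessian operator $\mathcal H_m$, i.e. $$\mathcal H_m(K_m)=C_{m,n}\,\delta_a,\qquad C_{m,n}=\frac{8^m\,n!\,\pi^{2n}\,\kappa_m^m}{(2n)!\,m!\,(n-m)!}.$$
   Context: Coordinates: $q=(q_0,\dots,q_{n-1})\in\mathbb H^n\cong\mathbb R^{4n}$, $q_l=x_{4l}+x_{4l+1}\mathbf i+x_{4l+2}\mathbf j+x_{4l+3}\mathbf k$; $dV$ is Lebesgue measure; $\delta_a$ is the Dirac measure at $a$ (densities with respect to $dV$). Hessian operator: $\frac{\partial}{\partial\overline{q_l}}=\partial_{x_{4l}}+\mathbf i\partial_{x_{4l+1}}+\mathbf j\partial_{x_{4l+2}}+\mathbf k\partial_{x_{4l+3}}$, and $\frac{\partial}{\partial q_l}$ is its conjugate. For real $u\in C^2$ the matrix $\left(\frac{\partial^2u}{\partial\overline{q_l}\partial q_k}\right)$ is hyperhermitian. For a hyperhermitian $A=U\operatorname{diag}(\lambda_1,\dots,\lambda_n)U^*$ ($U$ quaternionic unitary, $\lambda_j\in\mathbb R$) put $\mathcal H_m(A)=\sum_{j_1<\dots<j_m}\lambda_{j_1}\cdots\lambda_{j_m}$, and $\mathcal H_m(u)=\mathcal H_m\left(\frac{\partial^2u}{\partial\overline{q_l}\partial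 q_k}\right)$. For the unbounded function $K_m$, $\mathcal H_m(K_m)$ is understood as the weak limit (against $\varphi\in C_0^\infty(\mathbb R^{4n})$) as $\epsilon\to0^+$ of $\mathcal H_m(K_{m,\epsilon})$, where $K_{m,\epsilon}(q)=-(|q-a|^2+\epsilon)^{-\kappa_m}$. Class $QSH_m$: fix a basis $\omega^0,\dots,\omega^{2n-1}$ of $\mathbb C^{2n}$. For $l=0,\dots,n-1$ let $\nabla_{l0}=\partial_{x_{4l}}+\mathbf i\partial_{x_{4l+1}}$, $\nabla_{l1}=-\partial_{x_{4l+2}}-\mathbf i\partial_{x_{4l+3}}$, $\nabla_{(n+l)0}=\partial_{x_{4l+2}}-\mathbf i\partial_{x_{4l+3}}$, $\nabla_{(n+l)1}=\partial_{x_{4l}}-\mathbf i\partial_{x_{4l+1}}$ (complex $\mathbf i$); for $F=\sum_If_I\omega^I$ put $d_\alpha F=\sum_I\sum_{A=0}^{2n-1}\nabla_{A\alpha}f_I\,\omega^A\wedge\omega^I$, $\Delta=d_0d_1$, $\beta_n=\sum_{l=0}^{n-1}\omega^l\wedge\omega^{n+l}$, $\Omega_{2n}=\omega^0\wedge\omega^n\wedge\cdots\wedge\omega^{n-1}\wedge\omega^{2n-1}$, $\int f\,\Omega_{2n}=\int f\,dV$. Let $\Gamma_m$ be the set of hyperhermitian $A$ with $\mathcal H_m(sI+A)>0$ for all $s\ge0$. A real $C^2$ function $v$ is quaternionic $m$-subharmonic if its matrix $\left(\frac{\partial^2v}{\partial\overline{q_l}\partial q_k}\right)$ lies in $\overline\Gamma_m$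 at every point. A $[-\infty,\infty)$-valued upper semicontinuous $u\in L^1_{loc}(\Omega)$ is in $QSH_m(\Omega)$ if $\int_\Omega u\,\Delta v_1\wedge\dots\wedge\Delta v_{m-1}\wedge\beta_n^{n-m}\wedge\Delta\omega\ge0$ for all $C^4$ quaternionic $m$-subharmonic $v_1,\dots,v_{m-1}$ on $\Omega$ and all $0\le\omega\in C_0^\infty(\Omega)$. *)

(* Defs.v *)
From HB Require Import structures.
From mathcomp Require Import all_boot all_order all_algebra.
From mathcomp Require Import all_classical all_reals all_analysis.
From mathcomp Require Import complex ring.

Set Implicit Arguments.
Unset Strict Implicit.
Unset Printing Implicit Defensive.

Import Order.TTheory GRing.Theory Num.Theory.
Import numFieldNormedType.Exports.

Local Open Scope classical_set_scope.
Local Open Scope ring_scope.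

Definition rV_display : measure_display.
Proof. exact: default_measure_display. Qed.

Section rV_measurable.
Context {R : realType} {N : nat}.

Let coors : 'I_N -> 'rV[R]_N -> measurableTypeR R := fun i x => x ord0 i.

Let rV_set0 : g_sigma_preimage coors set0.
Proof. exact: sigma_algebra0. Qed.

Let rV_setC A : g_sigma_preimage coors A -> g_sigma_preimage coors (~` A).
Proof. exact: sigma_algebraC. Qed.

Let rV_bigcup (F : _^nat) : (forall i, g_sigma_preimage coors (F i)) ->
  g_sigma_preimage coors (\bigcup_i (F i)).
Proof. exact: sigma_algebra_bigcup. Qed.

(* The product (= Borel) sigma-algebra, generated by the coordinates. *)
HB.instance Definition _ := @isMeasurable.Build rV_display
  'rV[R]_N (g_sigma_preimage coors) rV_set0 rV_setC rV_bigcup.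

Lemma measurable_rV_coord (i : 'I_N) :
  measurable_fun setT (fun x : 'rV[R]_N => x ord0 i : measurableTypeR R).
Proof.
move=> _ Y mY; rewrite setTI; apply: sub_sigma_algebra => /=.
rewrite -bigcup_seq/=; exists i => /=; first by rewrite mem_index_enum.
by exists Y => //; rewrite setTI.
Qed.

Lemma measurable_fun_rVP d (T : measurableType d) (f : T -> 'rV[R]_N) :
  (forall i, measurable_fun setT (fun t => f t ord0 i : measurableTypeR R)) ->
  measurable_fun setT f.
Proof.
move=> mf; have sub : g_sigma_preimage (fun i => coors i \o f) `<=` measurable.
  apply: smallest_sub; first exact: sigma_algebra_measurable.
  rewrite -bigcup_seq /=; apply: bigcup_sub => i _ A [B mB <-].
  exact: mf.
move=> _ A mA; apply: sub; rewrite g_sigma_preimage_comp.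
by exists A.
Qed.

End rV_measurable.

Section rV_cons.
Context {R : realType} {N : nat}.

Definition rV_cons (p : measurableTypeR R * 'rV[R]_N) : 'rV[R]_N.+1 :=
  \row_i (if unlift ord0 i is Some j then p.2 ord0 j else p.1).

Definition rV_behead (x : 'rV[R]_N.+1) : 'rV[R]_N :=
  \row_j x ord0 (lift ord0 j).

Lemma rV_consK p : rV_behead (rV_cons p) = p.2.
Proof. by apply/rowP => j; rewrite !mxE liftK. Qed.

Lemma rV_cons0 p : rV_cons p ord0 ord0 = p.1.
Proof. by rewrite mxE unlift_none. Qed.

Lemma measurable_rV_cons : measurable_fun setT rV_cons.
Proof.
apply: measurable_fun_rVP => i; case: (unliftP ord0 i) => [j ->|->].
  rewrite [X in measurable_fun _ X](_ : _ =
    (fun x : 'rV[R]_N => x ord0 j : measurableTypeR R) \o snd).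
    by apply: measurableT_comp; [exact: measurable_rV_coord|exact: measurable_snd].
  by apply/funext => p; rewrite mxE liftK.
rewrite [X in measurable_fun _ X](_ : _ = fst); first exact: measurable_fst.
by apply/funext => p; rewrite rV_cons0.
Qed.

Lemma measurable_rV_behead : measurable_fun setT rV_behead.
Proof.
apply: measurable_fun_rVP => i.
rewrite [X in measurable_fun _ X](_ : _ =
  (fun x : 'rV[R]_N.+1 => x ord0 (lift ord0 i) : measurableTypeR R)).
  exact: measurable_rV_coord.
by apply/funext => p; rewrite mxE.
Qed.

Context (mu : {sigma_finite_measure set 'rV[R]_N -> \bar R}).

Definition rV_prod : set 'rV[R]_N.+1 -> \bar R :=
  pushforward (lebesgue_measure \x mu)%E rV_cons.

Let rV_prod0 : rV_prod set0 = 0%E.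
Proof. by rewrite /rV_prod /pushforward preimage_set0 measure0. Qed.

Let rV_prod_ge0 A : (0 <= rV_prod A)%E.
Proof. by rewrite /rV_prod /pushforward; exact: measure_ge0. Qed.

Let rV_prod_sigma_additive : semi_sigma_additive rV_prod.
Proof.
move=> F mF tF mUF; rewrite /rV_prod /pushforward preimage_bigcup.
apply: measure_semi_sigma_additive.
- by move=> n; rewrite -[X in measurable X]setTI; exact: measurable_rV_cons.
- apply/trivIsetP => /= i j _ _ ij; rewrite -preimage_setI.
  by move/trivIsetP : tF => /(_ _ _ _ _ ij) ->//; rewrite preimage_set0.
- rewrite -preimage_bigcup -[X in measurable X]setTI.
  exact: measurable_rV_cons.
Qed.

HB.instance Definition _ := isMeasure.Build _ _ _
  rV_prod rV_prod0 rV_prod_ge0 rV_prod_sigma_additive.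

Let rV_prod_sigma_finite : sigma_finite setT rV_prod.
Proof.
have /sigma_finiteP[F [TF ndF Foo]] := sigma_finiteT (@lebesgue_measure R).
have /sigma_finiteP[G [TG ndG Goo]] := sigma_finiteT mu.
pose g (x : 'rV[R]_N.+1) : measurableTypeR R * 'rV[R]_N :=
  (x ord0 ord0, rV_behead x).
have mg : measurable_fun setT g.
  apply/measurable_fun_pairP; split; first exact: measurable_rV_coord.
  exact: measurable_rV_behead.
have gK p : g (rV_cons p) = p by rewrite /g rV_consK rV_cons0; case: p.
exists (fun k => g @^-1` (F k `*` G k)).
  rewrite -preimage_bigcup (_ : \bigcup_k _ = setT) ?preimage_setT//.
  rewrite -setXTT TF TG predeqE => -[x y]; split.
    by move=> [n _ []/= ? ?]; split; exists n.
  move=> [/= [n _ Fnx] [k _ Gky]]; exists (maxn n k) => //; split.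
  - by move: x Fnx; exact/subsetPset/ndF/leq_maxl.
  - by move: y Gky; exact/subsetPset/ndG/leq_maxr.
move=> k; have [mF Fk] := Foo k; have [mG Gk] := Goo k; split.
  by rewrite -[X in measurable X]setTI; apply: mg => //; exact: measurableX.
rewrite /rV_prod /pushforward (_ : _ @^-1` _ = F k `*` G k).
  by rewrite product_measure1E// lte_mul_pinfty// ge0_fin_numE.
by rewrite -comp_preimage (_ : g \o rV_cons = id)//; apply/funext => p; exact: gK.
Qed.

HB.instance Definition _ := Measure_isSigmaFinite.Build _ _ _
  rV_prod rV_prod_sigma_finite.

End rV_cons.

Section rV_0.
Context {R : realType}.

Definition rV_dirac0 : set 'rV[R]_0 -> \bar R := @dirac _ 'rV[R]_0 0 R.

HB.instance Definition _ := Measure.on rV_dirac0.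

Let rV_dirac0_sigma_finite : sigma_finite setT rV_dirac0.
Proof.
exists (fun=> setT); first by rewrite bigcup_const.
by move=> k; split => //; rewrite /rV_dirac0 diracT ltry.
Qed.

HB.instance Definition _ := Measure_isSigmaFinite.Build _ _ _
  rV_dirac0 rV_dirac0_sigma_finite.

End rV_0.

(* Lebesgue measure on R^N, as the N-fold product of Lebesgue measure on R. *)
Fixpoint lebesgue_rV (R : realType) (N : nat) :
    {sigma_finite_measure set 'rV[R]_N -> \bar R} :=
  if N is N'.+1 then rV_prod (lebesgue_rV R N') else rV_dirac0.

Record quat (R : Type) := Quat { qre : R; qi : R; qj : R; qk : R }.

Section quat_ring.
Context {R : realType}.
Implicit Types x y z : quat R.

Definition quat_to_tuple x := (qre x, qi x, qj x, qk x).
Definition quat_of_tuple (t : R * R * R * R) : quat R :=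
  Quat t.1.1.1 t.1.1.2 t.1.2 t.2.

Lemma quat_to_tupleK : cancel quat_to_tuple quat_of_tuple.
Proof. by case. Qed.

HB.instance Definition _ := Choice.copy (quat R) (can_type quat_to_tupleK).
HB.instance Definition _ :=
  Topological.copy (quat R) (initial_topology quat_to_tuple).

Definition addq x y :=
  Quat (qre x + qre y) (qi x + qi y) (qj x + qj y) (qk x + qk y).
Definition oppq x := Quat (- qre x) (- qi x) (- qj x) (- qk x).
Definition mulq x y :=
  Quat (qre x * qre y - qi x * qi y - qj x * qj y - qk x * qk y)
       (qre x * qi y + qi x * qre y + qj x * qk y - qk x * qj y)
       (qre x * qj y - qi x * qk y + qj x * qre y + qk x * qi y)
       (qre x * qk y + qi x * qj y - qj x * qi y + qk x * qre y).

Definition qreal (r : R) : quat R := Quat r 0 0 0.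

Lemma addqA : associative addq.
Proof. by move=> [????] [????] [????]; congr Quat; exact: addrA. Qed.
Lemma addqC : commutative addq.
Proof. by move=> [????] [????]; congr Quat; exact: addrC. Qed.
Lemma add0q : left_id (qreal 0) addq.
Proof. by move=> [????]; congr Quat; exact: add0r. Qed.
Lemma addNq : left_inverse (qreal 0) oppq addq.
Proof. by move=> [????]; congr Quat; exact: addNr. Qed.
Lemma mulqA : associative mulq.
Proof. by move=> [????] [????] [????]; congr Quat => /=; ring. Qed.
Lemma mul1q : left_id (qreal 1) mulq.
Proof. by move=> [????]; congr Quat => /=; ring. Qed.
Lemma mulq1 : right_id (qreal 1) mulq.
Proof. by move=> [????]; congr Quat => /=; ring. Qed.
Lemma mulqDl : left_distributive mulq addq.
Proof. by move=> [????] [????] [????]; congr Quat => /=; ring. Qed.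
Lemma mulqDr : right_distributive mulq addq.
Proof. by move=> [????] [????] [????]; congr Quat => /=; ring. Qed.
Lemma oneq_neq0 : qreal 1 != qreal 0.
Proof. by apply/eqP => -[] /eqP; rewrite oner_eq0. Qed.

HB.instance Definition _ := GRing.isZmodule.Build (quat R)
  addqA addqC add0q addNq.
HB.instance Definition _ := GRing.Zmodule_isNzRing.Build (quat R)
  mulqA mul1q mulq1 mulqDl mulqDr oneq_neq0.

Definition conjq x := Quat (qre x) (- qi x) (- qj x) (- qk x).

Definition iq : quat R := Quat 0 1 0 0.
Definition jq : quat R := Quat 0 0 1 0.
Definition kq : quat R := Quat 0 0 0 1.

End quat_ring.

Section hyperhermitian.
Context {R : realType} {n : nat}.
Implicit Types (A U : 'M[quat R]_n) (d : 'rV[R]_n).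

Definition adjq A : 'M[quat R]_n := \matrix_(i, j) conjq (A j i).

Definition hyperhermitian A := adjq A = A.

Definition unitaryq U := U *m adjq U = 1%:M /\ adjq U *m U = 1%:M.

Definition elem_sym (m : nat) d : R :=
  \sum_(J : {set 'I_n} | #|J| == m) \prod_(j in J) d ord0 j.

(* [hess_op m A] is e_m(lambda_1, ..., lambda_n) for a unitary                *)
(* diagonalization A = U diag(lambda) U^*. One exists when A is               *)
(* hyperhermitian and e_m(lambda) does not depend on it; 0 is a junk value.   *)
Definition hess_op (m : nat) A : R :=
  xget 0 [set h | exists U d,
    [/\ unitaryq U, A = U *m diag_mx (map_mx qreal d) *m adjq U
      & h = elem_sym m d]].

Definition Gamma_cone (m : nat) : set 'M[quat R]_n :=
  [set A | hyperhermitian A /\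
    forall s : R, 0 <= s -> 0 < hess_op m ((qreal s)%:M + A)].

End hyperhermitian.

Section smooth_functions.
Context {R : realType} {N : nat}.
Implicit Types (Omega : set 'rV[R]_N) (f : 'rV[R]_N -> R).

Definition partial (i : 'I_N) f : 'rV[R]_N -> R :=
  fun x => 'D_(delta_mx ord0 i) f x.

(* Only meant for open Omega. *)
Fixpoint Ck (k : nat) Omega f : Prop :=
  (forall x, Omega x -> {for x, continuous f}) /\
  if k is k'.+1 then
    forall i : 'I_N,
      (forall x, Omega x -> derivable f x (delta_mx ord0 i)) /\
      Ck k' Omega (partial i f)
  else True.

Definition supp f : set 'rV[R]_N := closure [set x | f x != 0].

Definition test_function Omega f :=
  [/\ forall k, Ck k setT f, compact (supp f) & supp f `<=` Omega].

Definition enorm (x : 'rV[R]_N) : R := Num.sqrt (\sum_i x ord0 i ^+ 2).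

Definition usc Omega (u : 'rV[R]_N -> \bar R) :=
  forall x, Omega x -> forall r : R, (u x < r%:E)%E ->
    \forall y \near x, (u y < r%:E)%E.

Definition L1loc Omega (u : 'rV[R]_N -> \bar R) :=
  forall K, compact K -> K `<=` Omega -> (lebesgue_rV R N).-integrable K u.

End smooth_functions.

(* x_{4l+c} of H^n = R^{4n} is [x ord0 (coordH l c)]; H^n is 'rV[R]_(4 * n),  *)
(* whose library norm is the sup norm: |q| is [enorm q].                      *)
Lemma coordH_subproof n (l : 'I_n) (c : 'I_4) : (4 * l + c < 4 * n)%N.
Proof.
by rewrite (@leq_trans (4 * l.+1)) ?leq_mul2l ?ltn_ord// mulnS addnC ltn_add2r.
Qed.
Definition coordH n (l : 'I_n) (c : 'I_4) : 'I_(4 * n) :=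
  Ordinal (coordH_subproof l c).

Section quaternionic_hessian.
Context {R : realType} {n : nat}.
Notation point := 'rV[R]_(4 * n).
Implicit Types (F : point -> quat R) (l k : 'I_n).

Definition qpartial (i : 'I_(4 * n)) F : point -> quat R := fun x =>
  Quat (partial i (fun y => qre (F y)) x) (partial i (fun y => qi (F y)) x)
       (partial i (fun y => qj (F y)) x) (partial i (fun y => qk (F y)) x).

Definition dqbar l F : point -> quat R := fun x =>
  qpartial (coordH l 0) F x + iq * qpartial (coordH l 1) F x
  + jq * qpartial (coordH l 2) F x + kq * qpartial (coordH l 3) F x.

Definition dq l F : point -> quat R :=
  fun x => conjq (dqbar l (fun y => conjq (F y)) x).

Definition qhessian (u : point -> R) (x : point) : 'M[quat R]_n :=
  \matrix_(l, k) dqbar l (dq k (fun y => qreal (u y))) x.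

Definition hessian_op (m : nat) (u : point -> R) (x : point) : R :=
  hess_op m (qhessian u x).

Definition m_subharmonic (m : nat) (Omega : set point) (v : point -> R) :=
  Ck 2 Omega v /\
  forall x, Omega x -> closure (Gamma_cone m) (qhessian v x).

End quaternionic_hessian.

Section exterior_algebra.
Context {R : realType} {n : nat}.

(* Elements of the exterior algebra of C^{2n}, by their coefficients on the   *)
(* omega^I = omega^{i_1} /\ ... /\ omega^{i_p}, I = {i_1 < ... < i_p}.        *)
(* The index n + l is [rshift n l].                                           *)
Definition form := {ffun {set 'I_(n + n)} -> R[i]}.
Implicit Types (F G : form) (I J : {set 'I_(n + n)}).

Definition form_basis I : form := [ffun J => (J == I)%:R].

Definition inversions I J : nat :=
  #|[pred p : 'I_(n + n) * 'I_(n + n) |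
      [&& p.1 \in I, p.2 \in J & (p.2 < p.1)%N]]|.

Definition ewedge_basis I J : form :=
  if [disjoint I & J] then
    (-1) ^+ inversions I J *: form_basis (I :|: J)%SET
  else 0.

Definition ewedge F G : form :=
  \sum_I \sum_J (F I * G J) *: ewedge_basis I J.

Definition form1 : form := form_basis finset.set0.

Definition omega_form (A : 'I_(n + n)) : form := form_basis [set A]%SET.

Definition beta_form : form :=
  \sum_(l < n) ewedge (omega_form (lshift n l)) (omega_form (rshift n l)).

Definition Omega2n : form :=
  \big[ewedge/form1]_(l < n)
    ewedge (omega_form (lshift n l)) (omega_form (rshift n l)).

(* f such that the top-degree part of F is f Omega_{2n} *)
Definition top_coef F : R[i] :=
  F [set: 'I_(n + n)]%SET / Omega2n [set: 'I_(n + n)]%SET.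

Notation point := 'rV[R]_(4 * n).

Definition cpartial (i : 'I_(4 * n)) (f : point -> R[i]) : point -> R[i] :=
  fun x => Complex (partial i (fun y => complex.Re (f y)) x)
                   (partial i (fun y => complex.Im (f y)) x).

Let I1 : R[i] := Complex 0 1.

Definition nabla (A : 'I_(n + n)) (alpha : 'I_2) (f : point -> R[i]) :
    point -> R[i] := fun x =>
  match fintype.split A, alpha == 0 with
  | inl l, true  => cpartial (coordH l 0) f x + I1 * cpartial (coordH l 1) f x
  | inl l, false => - cpartial (coordH l 2) f x - I1 * cpartial (coordH l 3) f x
  | inr l, true  => cpartial (coordH l 2) f x - I1 * cpartial (coordH l 3) f x
  | inr l, false => cpartial (coordH l 0) f x - I1 * cpartial (coordH l 1) f x
  end.

Definition dform (alpha : 'I_2) (F : point -> form) : point -> form := fun x =>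
  \sum_I \sum_A nabla A alpha (fun y => F y I) x *:
    ewedge (omega_form A) (form_basis I).

(* Delta = d_0 d_1 *)
Definition baston (u : point -> R) : point -> form :=
  dform 0 (dform 1 (fun x => (Complex (u x) 0) *: form1)).

End exterior_algebra.
Arguments form R n : clear implicits.

Section QSH.
Context {R : realType} {n : nat}.
Notation point := 'rV[R]_(4 * n).

Definition mixed_form (m : nat) (v : 'I_m.-1 -> point -> R) (w : point -> R)
    (x : point) : form R n :=
  ewedge (\big[ewedge/form1]_(i < m.-1) baston (v i) x)
         (ewedge (\big[ewedge/form1]_(i < n - m) beta_form) (baston w x)).
Arguments mixed_form m v w x : clear implicits.

(* The integral of u times a complex density is nonnegative (as a complex     *)
(* number): its real part is nonnegative and its imaginary part vanishes.     *)
Definition nonneg_integral (Omega : set point) (u : point -> \bar R)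
    (h : point -> R[i]) : Prop :=
  (0 <= \int[lebesgue_rV R (4 * n)]_(x in Omega)
         (u x * (complex.Re (h x))%:E))%E /\
  (\int[lebesgue_rV R (4 * n)]_(x in Omega)
         (u x * (complex.Im (h x))%:E) = 0)%E.

Definition QSH (m : nat) (Omega : set point) (u : point -> \bar R) : Prop :=
  [/\ forall x, Omega x -> u x != +oo%E,
      usc Omega u,
      L1loc Omega u
    & forall (v : 'I_m.-1 -> point -> R) (w : point -> R),
        (forall i, Ck 4 Omega (v i) /\ m_subharmonic m Omega (v i)) ->
        test_function Omega w -> (forall x, 0 <= w x) ->
        nonneg_integral Omega u (fun x => top_coef (mixed_form m v w x))].

End QSH.

Section fundamental_solution.
Context {R : realType} {n : nat}.
Notation point := 'rV[R]_(4 * n).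

Definition kappa (m : nat) : R := (2 * n)%:R / m%:R - 1.

Definition Km (m : nat) (a q : point) : \bar R :=
  if q == a then -oo%E
  else (- 1 / enorm (q - a) `^ (2 * kappa m))%:E.

Definition Km_eps (m : nat) (a : point) (e : R) (q : point) : R :=
  - (enorm (q - a) ^+ 2 + e) `^ (- kappa m).

(* H_m(K_m) = c delta_a, H_m(K_m) being the weak limit of the H_m(K_{m,e}) *)
Definition hessian_op_Km_eq_dirac (m : nat) (a : point) (c : R) : Prop :=
  forall phi : point -> R, test_function setT phi ->
    (\int[lebesgue_rV R (4 * n)]_q
        (phi q * hessian_op m (Km_eps m a e) q)%:E)%E @[e --> 0^'+]
      --> (c%:E * \int[\d_a]_q (phi q)%:E)%E.

Definition Cmn (m : nat) : R :=
  (8 ^+ m * n`!%:R * pi ^+ (2 * n) * kappa m ^+ m) /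
  ((2 * n)`!%:R * m`!%:R * (n - m)`!%:R).

End fundamental_solution.

(* Main.v *)
(* A hyperhermitian matrix M has a 2-form tau(M); if M = U diag(d) U^* then   *)
(* tau(M) = \sum_j d_j y_j and beta_n = \sum_j y_j with commuting y_j such    *)
(* that y_j^2 = 0, so that the top coefficient of tau(M)^m beta_n^(n-m) is m! *)
(* (n-m)! H_m(M), and tau of the Hessian of u is Delta u. As the eigenvalues  *)
(* are real, H_m is hyperbolic, and Garding's inequality makes the mixed      *)
(* products tau(M_1) ... tau(M_m) beta_n^(n-m) of elements of Gamma_m         *)
(* positive.                                                                  *)
(*   The Hessian of K_{m,e} is alpha I + b v v^* with v = q - a, so it lies   *)
(* in Gamma_m and H_m(K_{m,e}) = C e (|q-a|^2 + e)^(-2n-1), an approximate    *)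
(* identity whose mass is found by writing negative powers as superpositions  *)
(* of Gaussians.                                                              *)
(*   In real coordinates Delta v = \sum_{p,q} (d_p d_q v) E_pq, where E_pq    *)
(* E_ij is antisymmetric in (p, i) and in (q, j). Hence the coefficients of w *)
(* |-> Delta v_1 ... Delta v_{m-1} beta_n^(n-m) Delta w form a matrix with    *)
(* divergence-free rows and columns, and this operator is symmetric: \int     *)
(* K_{m,e} Delta v_1 ... Delta w = \int w Delta v_1 ... Delta K_{m,e} >= 0.   *)
(* Let e -> 0, |q-a|^(-2 kappa_m) being locally integrable.                   *)
Require Import Defs.
From HB Require Import structures.
From mathcomp Require Import all_boot all_order all_algebra.
From mathcomp Require Import all_classical all_reals all_analysis measurable_realfun.
From mathcomp Require Import complex ring lra zify.

Set Implicit Arguments.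
Unset Strict Implicit.
Unset Printing Implicit Defensive.

Import Order.TTheory GRing.Theory Num.Theory.
Import numFieldNormedType.Exports.

Local Open Scope classical_set_scope.
Local Open Scope ring_scope.
Local Open Scope complex_scope.

(** * Hyperbolic forms and Garding's inequality *)

(** Algebra. Everything is read off the commutative algebra of even forms. [tau_hess_op] identifies
    H_m(M), up to the factor m! (n-m)!, with the top coefficient of tau(M)^m beta_n^(n-m); it rests
    on [hyperhermitian_spectral] and on the expansion of powers of sums of elements of square zero.
    As a polynomial in M this is a hyperbolic form in the direction beta_n: for m = n, tau(M) + z
    beta_n yields the product of the d_j + z with real eigenvalues d_j, and smaller m arise by
    differentiating along beta_n, which keeps the roots real ([hyperbolic_beta]). Gamma_m lies in
    the cone of this form, so that [garding] makes mixed products of elements of Gamma_m positive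
    ([mixed_form_gt0]), and a limit makes them nonnegative when all factors but one are only in the
    closure ([mixed_top_closure_ge0]).

    The Dirac mass. The Hessian of K_{m,e} is a multiple of the identity plus a rank one matrix
    ([qhessian_Km_eps]), on which H_m has two terms only ([hess_op_rank_one]). Because kappa_m + 1 =
    2n/m, these combine into a constant multiple of e rho^(-2n-1), where rho = |q-a|^2 + e
    ([hessian_op_Km_eps]); the same computation with t I added shows that the Hessian lies in
    Gamma_m ([Gamma_cone_Km_eps]). The integral of e rho^(-2n-1) does not depend on e
    ([integral_bubble]) and its mass concentrates at a as e -> 0 ([bubble_approx]), which gives
    C_{m,n} delta_a ([hessian_op_Km_dirac]).

    Subharmonicity. In real coordinates Delta u = \sum_{p,q} (d_p d_q u) E_pq
    ([baston_hessian_form]), and this is the 2-form of the Hessian matrix of u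
    ([hessian_form_qhessian]). The antisymmetry of the products E_pq E_ij against the symmetry of
    third derivatives makes the coefficients of Delta v_1 ... Delta v_{m-1} beta_n^(n-m)
    divergence-free ([divfree_hessian]), so integrating by parts twice moves Delta from w to K_{m,e}
    ([hessian_green]). The integrand becomes w times a mixed product of matrices in the closure of
    Gamma_m and one in Gamma_m, hence is nonnegative ([integral_Km_eps_mixed_ge0]). As K_m <=
    K_{m,e} <= 0 and K_m is locally integrable ([L1loc_Km]), dominated convergence lets e -> 0
    ([integral_Km_mixed_ge0]). *)

Lemma unit_interval_ind (R : realType) (P : R -> Prop) :
  P 0 ->
  (forall s : R, 0 <= s <= 1 ->
    (forall e : R, 0 < e -> exists t : R, [/\ 0 <= t <= 1, `|t - s| < e & P t]) ->
    P s) ->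
  (forall s : R, 0 <= s <= 1 -> P s ->
    exists2 e : R, 0 < e & forall t : R, 0 <= t <= 1 -> `|t - s| < e -> P t) ->
  forall s : R, 0 <= s <= 1 -> P s.
Proof.
move=> P0 Pcl Pop s s01.
have memI (x : R) : `[0, 1]%classic x = (0 <= x <= 1) :> Prop.
  by rewrite /= in_itv.
have E : `[0, 1] `&` P = `[0, 1]%classic; last first.
  by have : (`[0, 1]%classic `&` P) s by [rewrite E memI]; case.
(* Connectedness of [0, 1]: the points satisfying P form a nonempty, relatively open and relatively
   closed subset. *)
apply: (@segment_connected R 0 1).
- by exists 0; split => //; rewrite memI lexx ler01.
- exists (\bigcup_(x in `[0, 1] `&` P)
    \bigcup_(e in [set e : R | 0 < e /\ forall t : R, 0 <= t <= 1 -> `|t - x| < e -> P t])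
       ball x e).
    apply: bigcup_open => x _; apply: bigcup_open => e [e0 _].
    exact: ball_open.
  rewrite eqEsubset; split => [x [xI Px]|x [xI [y [yI Py] [e [e0 eP]]]]].
    split => //; exists x => //.
    rewrite memI in xI; have [e e0 eP] := Pop x xI Px.
    by exists e => //=; exact: ballxx.
  rewrite -ball_normE/= distrC => xye; split => //.
  by apply: eP => //; rewrite memI in xI.
- exists (closure (`[0, 1] `&` P)); first exact: closed_closure.
  rewrite eqEsubset; split => [x [xI Px]|x [xI clx]].
    by split => //; apply: subset_closure.
  split => //; rewrite memI in xI; apply: Pcl => // e e0.
  have [y [[yI Py]]] := clx _ (nbhsx_ballx x e e0).
  rewrite -ball_normE/= distrC => xye.
  by exists y; split => //; rewrite memI in yI.
Qed.

Lemma poly_ext_nat (K : numFieldType) (p q : {poly K}) :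
  (forall k : nat, p.[k%:R] = q.[k%:R]) -> p = q.
Proof.
move=> pq; apply/subr0_eq.
apply: (@roots_geq_poly_eq0 _ _ [seq (i%:R : K) | i <- iota 0 (size (p - q))]).
- by apply/allP => _ /mapP[i _ ->]; rewrite rootE !hornerE pq subrr.
- by rewrite map_inj_uniq ?iota_uniq// => i j /eqP; rewrite eqr_nat => /eqP.
- by rewrite size_map size_iota.
Qed.

(** * Zeros of polynomials in a half-plane *)

Section polynomial_zeros.
Variable R : realType.
Local Notation C := R[i].
Implicit Types (p : {poly C}) (z : C).

Lemma ge0_complexP (x : C) : 0 <= x -> exists k : R, x = k%:C.
Proof. by move/ger0_real/complex_realP. Qed.

Lemma norm_horner_prod (r : seq C) z (B : C) :
  0 <= B -> (forall w, w \in r -> B <= `|z - w|) ->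
  B ^+ size r <= `|(\prod_(w <- r) ('X - w%:P)).[z]|.
Proof.
move=> B0 H; rewrite horner_prod normr_prod.
elim: r H => [|w r IH] H; first by rewrite big_nil expr0.
rewrite big_cons exprS ler_pM ?exprn_ge0//.
  by rewrite !hornerE; apply: H; rewrite mem_head.
by apply: IH => v vr; apply: H; rewrite in_cons vr orbT.
Qed.

Lemma poly_normal_size p (m : nat) : (size p <= m.+1)%N -> p`_m != 0 ->
  exists2 r : seq C, size r = m & p = p`_m *: \prod_(w <- r) ('X - w%:P).
Proof.
move=> sp pm; have [r pE] := closed_field_poly_normal p.
have sE : size p = m.+1.
  apply/eqP; rewrite eqn_leq sp ltnNge; apply: contra_neqN pm => ?.
  by rewrite nth_default.
have lE : lead_coef p = p`_m by rewrite lead_coefE sE.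
exists r; last by rewrite -lE.
have := sE; rewrite pE size_scale ?lE// size_prod_XsubC.
by case.
Qed.

Lemma root_normal (r : seq C) (c : C) w :
  w \in r -> (c *: \prod_(v <- r) ('X - v%:P)).[w] = 0.
Proof.
move=> wr; rewrite hornerZ; apply/eqP; rewrite mulf_eq0; apply/orP; right.
by rewrite -/(root _ w) root_prod_XsubC.
Qed.

Lemma horner_lipschitz p : exists2 K : C, 0 <= K &
  forall s t : C, `|s| <= 1 -> `|t| <= 1 -> `|p.[s] - p.[t]| <= K * `|s - t|.
Proof.
elim/poly_ind: p => [|p c [K K0 IH]].
  by exists 0 => // s t _ _; rewrite !horner0 subrr normr0 mul0r.
exists (K + `|p.[0]| + K) => [|s t s1 t1].
  by rewrite !addr_ge0.
rewrite !hornerE opprD addrACA subrr addr0.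
have -> : p.[s] * s - p.[t] * t = (p.[s] - p.[t]) * s + p.[t] * (s - t) by ring.
rewrite (le_trans (ler_normD _ _))// !normrM -addrA [leRHS]mulrDl lerD//.
  rewrite (le_trans (ler_piMr _ s1)) ?normr_ge0//; exact: IH.
rewrite ler_wpM2r// -[p.[t]](subrK p.[0]) addrC (le_trans (ler_normD _ _))//.
rewrite lerD//.
have := IH t 0 t1; rewrite normr0 ler01 => /(_ isT) /le_trans; apply.
by rewrite subr0 ler_piMr.
Qed.

(* The roots of q_s never cross the imaginary axis, so they cannot enter the  *)
(* closed right half-plane as s runs through [0, 1].                          *)
Lemma half_plane_homotopy (m : nat) (F : nat -> {poly C}) (c : C) :
  let q (s : R) z := \sum_(i < m.+1) (F i).[s%:C] * z ^+ i in
  F m = c%:P -> c != 0 ->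
  (forall (s : R) z, 0 <= s <= 1 -> complex.Re z = 0 -> q s z != 0) ->
  (forall z, 0 <= complex.Re z -> q 0 z != 0) ->
  forall (s : R), 0 <= s <= 1 -> forall z, 0 <= complex.Re z -> q s z != 0.
Proof.
move=> q Fm c0 Hbd H0.
pose pol (s : R) : {poly C} := \poly_(i < m.+1) (F i).[s%:C].
have polE s z : (pol s).[z] = q s z by rewrite horner_poly.
have polm s : (pol s)`_m = c by rewrite coef_poly ltnSn Fm hornerC.
have nf s : exists2 r : seq C, size r = m & pol s = c *: \prod_(w <- r) ('X - w%:P).
  have := @poly_normal_size (pol s) m (size_poly _ _).
  by rewrite polm; exact.
have s1 (s : R) : 0 <= s <= 1 -> `|s%:C| <= 1 :> C.
  by case/andP => s0 s1; rewrite ger0_norm ?lecR// ler0c.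
apply: unit_interval_ind => //.
- move=> s s01 Hs z; rewrite le_eqVlt => /orP[/eqP/esym z0|z0]; first exact: Hbd.
  have B0 : 0 < `|c| * (complex.Re z)%:C ^+ m.
    by rewrite mulr_gt0 ?normr_gt0// exprn_gt0// ltcR.
  (* The roots of q_t have negative real part, so each is at distance at least Re z from z. The
     bound is the same for all such t and survives the limit t -> s. *)
  have low (t : R) : (forall w, 0 <= complex.Re w -> q t w != 0) ->
      `|c| * (complex.Re z)%:C ^+ m <= `|q t z|.
    move=> Ht; have [r rm rE] := nf t.
    rewrite -polE rE hornerZ normrM ler_wpM2l// -rm norm_horner_prod ?lecR ?ltW// => w wr.
    have wneg : complex.Re w < 0.
      rewrite ltNge; apply/negP => /Ht; rewrite -polE rE root_normal ?eqxx//.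
    rewrite (le_trans _ (normc_ge_Re _))// lecR raddfB/= ger0_norm; lra.
  have [K K0 KP] : exists2 K : C, 0 <= K & forall t u : R, 0 <= t <= 1 -> 0 <= u <= 1 ->
      `|q t z - q u z| <= K * `|t - u|%:C.
    pose Q := \sum_(i < m.+1) (F i * (z ^+ i)%:P).
    have QE t : Q.[t%:C] = q t z.
      by rewrite horner_sum; apply: eq_bigr => i _; rewrite !hornerE.
    have [K K0 KP] := horner_lipschitz Q; exists K => // t u t01 u01.
    rewrite -!QE; apply: (le_trans (KP _ _ (s1 _ t01) (s1 _ u01))).
    rewrite ler_wpM2l// -raddfB normc_def/= expr0n/= addr0 sqrtr_sqr//.
  apply/negP => /eqP q0.
  have [k0 k0E] := ge0_complexP (ltW B0).
  have [k1 k1E] := ge0_complexP K0.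
  rewrite k0E ltcR in B0; rewrite k1E ler0c in K0.
  have [t [t01 ts Ht]] := Hs (k0 / (k1 + 1)) ltac:(by rewrite divr_gt0//; lra).
  have := low _ Ht; have := KP _ _ t01 s01; rewrite q0 subr0 k0E k1E => A B.
  have := le_trans B A; rewrite -rmorphM lecR; apply/negP; rewrite -ltNge.
  move: ts; rewrite ltr_pdivlMr; nra.
- move=> s s01 Hs.
  have [r rm rE] := nf s.
  (* The lower bound on |q_s(z)| and the upper bound on |q_t(z) - q_s(z)| both grow like (1 +
     |z|)^m, so one neighbourhood of s serves all z of the unbounded half-plane. *)
  have [k k0 kP] : exists2 k : C, 0 < k & forall z, 0 <= complex.Re z ->
      k * (1 + `|z|) ^+ m <= `|q s z|.
    have [k k0 kP] : exists2 k : C, 0 < k & forall w z, w \in r -> 0 <= complex.Re z ->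
        k * (1 + `|z|) <= `|z - w|.
      have : forall w, w \in r -> complex.Re w < 0.
        move=> w wr; rewrite ltNge; apply/negP => /Hs.
        by rewrite -polE rE root_normal ?eqxx.
      elim: (r) => [|w r' IH] Hr; first by exists 1.
      have [v vr'|k k0 kP] := IH; first by apply: Hr; rewrite in_cons vr' orbT.
      have w0 := Hr w (mem_head _ _).
      (* d is the distance from w to the closed right half-plane; D comes from |z| <= |z - w| +
         |w|. *)
      pose d : C := (- complex.Re w)%:C; have d0 : 0 < d by rewrite ltcR; lra.
      pose D : C := 1 + `|w| + d.
      have D0 : 0 < D by rewrite /D -addrA ltr_pwDl// addr_ge0// ltW.
      have wP z : 0 <= complex.Re z -> d / D * (1 + `|z|) <= `|z - w|.
        move=> z0; rewrite mulrAC ler_pdivrMr//.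
        have dzw : d <= `|z - w|.
          rewrite (le_trans _ (normc_ge_Re _))// lecR raddfB/= ger0_norm; lra.
        have zzw : `|z| <= `|z - w| + `|w| by rewrite -{1}[z](subrK w) ler_normD.
        have -> : `|z - w| * D = `|z - w| * (1 + `|w|) + `|z - w| * d by rewrite /D; ring.
        rewrite (@le_trans _ _ (d * (1 + `|w|) + d * `|z - w|))//.
          by rewrite -mulrDr; apply: ler_wpM2l; [exact: ltW|rewrite -addrA lerD2l addrC].
        by rewrite [d * `|_|]mulrC lerD2r; apply: ler_wpM2r => //; rewrite addr_ge0.
      (* Product over sum: a positive number below both k and d / D. *)
      exists (k * (d / D) / (k + d / D)).
        by rewrite divr_gt0 ?mulr_gt0 ?addr_gt0 ?divr_gt0 ?invr_gt0.
      have dD0 : 0 < d / D by rewrite divr_gt0.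
      move=> v z; rewrite in_cons => /orP[/eqP->|vr] z0.
        apply: le_trans (wP _ z0); apply: ler_wpM2r; first by rewrite addr_ge0.
        rewrite ler_pdivrMr ?addr_gt0// [k * _]mulrC.
        by apply: ler_wpM2l; [exact: ltW|rewrite lerDl ltW].
      apply: le_trans (kP _ _ vr z0); apply: ler_wpM2r; first by rewrite addr_ge0.
      rewrite ler_pdivrMr ?addr_gt0//.
      by apply: ler_wpM2l; [exact: ltW|rewrite lerDr ltW].
    exists (`|c| * k ^+ m) => [|z z0]; first by rewrite mulr_gt0 ?normr_gt0 ?exprn_gt0.
    rewrite -polE rE hornerZ normrM -mulrA; apply: ler_wpM2l => //.
    rewrite -exprMn -rm; apply: norm_horner_prod => [|w wr]; last exact: kP.
    by apply: mulr_ge0; [exact: ltW|exact: addr_ge0].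
  have [K K0 KP] : exists2 K : C, 0 <= K & forall (t u : R) z, 0 <= t <= 1 -> 0 <= u <= 1 ->
      `|q t z - q u z| <= K * `|t - u|%:C * (1 + `|z|) ^+ m.
    have coefK (j : nat) : exists2 K : C, 0 <= K & forall (t u : R), 0 <= t <= 1 -> 0 <= u <= 1 ->
        `|(F j).[t%:C] - (F j).[u%:C]| <= K * `|t - u|%:C.
      have [K K0 KP] := horner_lipschitz (F j); exists K => // t u t01 u01.
      apply: (le_trans (KP _ _ (s1 _ t01) (s1 _ u01))).
      by rewrite ler_wpM2l// -raddfB normc_def/= expr0n/= addr0 sqrtr_sqr.
    have : forall M, (M <= m.+1)%N -> exists2 K : C, 0 <= K &
        forall (t u : R) z, 0 <= t <= 1 -> 0 <= u <= 1 ->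
      `|\sum_(i < M) (F i).[t%:C] * z ^+ i - \sum_(i < M) (F i).[u%:C] * z ^+ i|
        <= K * `|t - u|%:C * (1 + `|z|) ^+ m.
      elim=> [_|M IH Mm].
        by exists 0 => // t u z _ _; rewrite !big_ord0 subrr normr0 !mul0r.
      have [K K0 KP] := IH (ltnW Mm); have [K' K'0 K'P] := coefK M.
      exists (K + K') => [|t u z t01 u01]; first exact: addr_ge0.
      rewrite !big_ord_recr/= opprD addrACA (le_trans (ler_normD _ _))// !mulrDl.
      rewrite lerD ?KP// -mulrBl normrM.
      apply: ler_pM => //; first exact: K'P.
      rewrite normrX (@le_trans _ _ ((1 + `|z|) ^+ M))//.
        by rewrite lerXn2r ?nnegrE ?addr_ge0// lerDr.
      by rewrite ler_weXn2l// lerDl.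
    exact.
  have [k0' k0E] := ge0_complexP (ltW k0).
  have [k1 k1E] := ge0_complexP K0.
  rewrite k0E ltcR in k0; rewrite k1E ler0c in K0.
  exists (k0' / (k1 + 1)); first by rewrite divr_gt0//; lra.
  move=> t t01 ts z z0; apply/negP => /eqP q0.
  have := KP _ _ z s01 t01; rewrite q0 subr0 => A.
  have := le_trans (kP _ z0) A; rewrite ler_pM2r; last first.
    by rewrite exprn_gt0// ltr_pwDl.
  rewrite k0E k1E -rmorphM lecR; apply/negP; rewrite -ltNge distrC.
  move: ts; rewrite ltr_pdivlMr; nra.
Qed.

End polynomial_zeros.

(** * Forms x |-> L (x^m) on a commutative algebra *)

Section hyperbolic.
Variables (R : realType) (A : comAlgType R[i]).
Local Notation C := R[i].
Implicit Types (L : {scalar A}) (a b e x y : A) (z : C).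

(** Polarization: up to the factor m + 1, x |-> L (a x^m) is the derivative along a of the form x
    |-> L (x^(m+1)). *)
Definition mul_scalar L a : A -> C := fun y => L (a * y).

Lemma mul_scalar_is_scalar L a : scalar (mul_scalar L a).
Proof. by move=> z x y; rewrite /mul_scalar mulrDr -scalerAr linearP. Qed.

HB.instance Definition _ L a := GRing.isLinear.Build C A C *%R (mul_scalar L a)
  (mul_scalar_is_scalar L a).

Definition line_poly L m x a : {poly C} :=
  \poly_(i < m.+1) (L (x ^+ (m - i) * a ^+ i) *+ 'C(m, i)).

Lemma horner_line_poly L m x a z :
  (line_poly L m x a).[z] = L ((x + z *: a) ^+ m).
Proof.
rewrite horner_poly exprDn linear_sum/=; apply: eq_bigr => i _.
by rewrite linearMn/= exprZn -scalerAr linearZ/= mulrnAl mulrC.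
Qed.

Lemma line_poly_normal L m x a : L (a ^+ m) != 0 ->
  exists2 r : seq C, size r = m &
    line_poly L m x a = L (a ^+ m) *: \prod_(w <- r) ('X - w%:P).
Proof.
move=> La; have E : (line_poly L m x a)`_m = L (a ^+ m).
  by rewrite coef_poly ltnSn subnn expr0 mul1r binn mulr1n.
have := @poly_normal_size _ (line_poly L m x a) m (size_poly _ _).
by rewrite E; exact.
Qed.

Lemma deriv_line_poly L m x a :
  (line_poly L m.+1 x a)^`() = m.+1%:R *: line_poly (mul_scalar L a) m x a.
Proof.
apply/polyP => i; rewrite coef_deriv coefZ !coef_poly ltnS.
case: ifPn => im; last by rewrite mul0rn mulr0.
rewrite subSS /= /mul_scalar [a * _]mulrCA -exprS -mulrnA -[LHS]mulr_natl.
by rewrite mulnC -(mul_bin_diag m.+1 i) natrM -mulrA; congr (_ * _); rewrite mulr_natl.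
Qed.

Lemma deriv_prod_XsubC (r : seq C) z : z \notin r ->
  (\prod_(w <- r) ('X - w%:P))^`().[z] =
  (\prod_(w <- r) ('X - w%:P)).[z] * \sum_(w <- r) (z - w)^-1.
Proof.
elim: r => [|w r IH]; first by rewrite !big_nil derivC horner0 mulr0.
rewrite in_cons negb_or => /andP[zw /IH {}IH].
rewrite !big_cons derivM hornerD !hornerM IH derivB derivX derivC subr0 !hornerE.
by rewrite /=; field; rewrite subr_eq0.
Qed.

Lemma line_poly_ge L m x a z : 0 < L (a ^+ m) -> 0 < complex.Im z ->
  (forall w, 0 < complex.Im w -> L ((x + w *: a) ^+ m) != 0) ->
  L (a ^+ m) * (complex.Im z)%:C ^+ m <= `|L ((x + z *: a) ^+ m)|.
Proof.
move=> La z0 H; have [r rm E] := line_poly_normal x (lt0r_neq0 La).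
rewrite -horner_line_poly E hornerZ normrM gtr0_norm//.
apply: ler_wpM2l; first exact: ltW.
rewrite -rm; apply: norm_horner_prod => [|w wr]; first by rewrite ler0c ltW.
have w0 : complex.Im w <= 0.
  rewrite leNgt; apply/negP => /H; rewrite -horner_line_poly E.
  by rewrite root_normal ?eqxx.
have := normc_ge_Re ((z - w) * 'i); rewrite ReiNIm normrM.
have -> : `|'i : C| = 1 by rewrite normc_def/= expr0n expr1n add0r sqrtr1.
rewrite mulr1; apply: le_trans; rewrite lecR normrN raddfB/= ger0_norm; lra.
Qed.

(** [half_plane_homotopy] for the polynomials z |-> L ((x + s y + z a)^m). Their leading coefficient
    L (a^m) does not depend on s, so no root escapes to infinity. *)
Lemma line_homotopy L m x y a : L (a ^+ m) != 0 ->
  (forall (s : R) z, 0 <= s <= 1 -> complex.Re z = 0 ->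
    L ((x + s%:C *: y + z *: a) ^+ m) != 0) ->
  (forall z, 0 <= complex.Re z -> L ((x + z *: a) ^+ m) != 0) ->
  forall (s : R) z, 0 <= s <= 1 -> 0 <= complex.Re z ->
    L ((x + s%:C *: y + z *: a) ^+ m) != 0.
Proof.
move=> La Hbd H0.
(* The coefficient of z^i, as a polynomial in s. *)
pose F (i : nat) := 'C(m, i)%:R *: line_poly (mul_scalar L (a ^+ i)) (m - i) x y.
have FE (s : R) z : \sum_(i < m.+1) (F i).[s%:C] * z ^+ i =
    L ((x + s%:C *: y + z *: a) ^+ m).
  rewrite [in RHS]exprDn linear_sum/=; apply: eq_bigr => i _.
  rewrite hornerZ horner_line_poly linearMn exprZn -scalerAr linearZ/=.
  by rewrite /= /mul_scalar -[RHS]mulr_natl [a ^+ i * _]mulrC mulrAC mulrA.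
have Fm : F m = (L (a ^+ m))%:P.
  apply/polyP => i; rewrite /F binn coefZ mul1r coef_poly coefC subnn ltnS leqn0.
  case: eqVneq => // ->.
  by rewrite /= /mul_scalar bin0 !expr0 !mulr1.
move=> s z s01 z0; rewrite -FE.
apply: (@half_plane_homotopy _ m F _ Fm La) => // [t w t01 w0|w w0].
  by rewrite FE; exact: Hbd.
by have := FE 0 w; rewrite /= => ->; rewrite scale0r addr0; exact: H0.
Qed.

(** The real subspace on which the forms are studied; in the application it consists of the 2-forms
    of hyperhermitian matrices. *)
Variable V : A -> Prop.
Hypothesis VD : forall x y, V x -> V y -> V (x + y).
Hypothesis VZ : forall (r : R) x, V x -> V (r%:C *: x).

Definition real_form L m := forall x, V x -> L (x ^+ m) \is Num.real.

(** The last clause says that z |-> L ((x + z e)^m) has only real roots: changing the signs of x and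
    z exchanges the upper and lower half-planes. *)
Definition hyperbolic L m e := [/\ V e, 0 < L (e ^+ m) &
  forall x z, V x -> 0 < complex.Im z -> L ((x + z *: e) ^+ m) != 0].

(** Garding's cone: for a hyperbolic form, all roots of t |-> L ((b + t e)^m) are negative. *)
Definition hyp_cone L m e b :=
  V b /\ forall t : R, 0 <= t -> 0 < L ((b + t%:C *: e) ^+ m).

Lemma hyperbolicP L m e x z : hyperbolic L m e -> V x -> complex.Im z != 0 ->
  L ((x + z *: e) ^+ m) != 0.
Proof.
move=> [Ve Le He] Vx; rewrite neq_lt => /orP[z0|]; last exact: He.
have -> : x + z *: e = (-1 : C) *: ((-1 : R)%:C *: x + (- z) *: e).
  by rewrite rmorphN1 scalerDr !scalerA !mulN1r !opprK scale1r.
rewrite exprZn linearZ/= mulf_eq0 negb_or expf_neq0 ?oppr_eq0 ?oner_eq0//=.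
by apply: He; [exact: VZ|rewrite raddfN oppr_gt0].
Qed.

(** For al > 0 the form does not vanish at x + i al e + w a with Im w >= 0: scale x by s from 0 to
    1. No root w crosses the real axis, since for real w the point is an element of V plus i al e.
    Then al tends to 0. *)
Lemma hyperbolic_cone L m e a :
  hyperbolic L m e -> hyp_cone L m e a -> hyperbolic L m a.
Proof.
move=> He [Va Ca]; have [Ve Le _] := He.
have La : 0 < L (a ^+ m) by have := Ca 0 (lexx _); rewrite scale0r addr0.
split=> // x z Vx z0.
have shifted (al : R) w : 0 < al -> 0 <= complex.Im w ->
    L ((x + (al%:C * 'i) *: e + w *: a) ^+ m) != 0.
  move=> al0 w0.
  (* The direction i a turns the upper half-plane of w into the right half-plane of
     [line_homotopy]. *)
  have := @line_homotopy L m ((al%:C * 'i) *: e) x ('i *: a).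
  have i0 : 'i != 0 :> C by rewrite eq_complex/= oner_eq0 andbF.
  have ii (u : C) : u *: ('i *: a) = (u * 'i) *: a by rewrite scalerA.
  have /[swap]/[apply] : L (('i *: a) ^+ m) != 0.
    by rewrite exprZn linearZ mulf_neq0 ?expf_neq0// lt0r_neq0.
  move=> /(_ _ _ 1 (- 'i * w)); rewrite ler01 lexx scale1r.
  have -> : (- 'i * w) *: ('i *: a) = w *: a.
    by rewrite ii mulrAC mulNr -['i * 'i]/('i ^+ 2) sqr_i opprK mul1r.
  rewrite [x + _]addrC; apply => //.
  - move=> s u s01 u0; rewrite ii.
    have -> : (al%:C * 'i) *: e + s%:C *: x + (u * 'i) *: a =
              (s%:C *: x + (- complex.Im u)%:C *: a) + (al%:C * 'i) *: e.
      rewrite -addrA addrC; congr (_ + _ *: _ + _).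
      by case: u u0 => u1 u2 /= ->; simpc.
    apply: (hyperbolicP He); first by apply: VD; exact: VZ.
    by simpc; rewrite /= gt_eqF.
  (* At s = 0 and u nonzero, dividing by i u leaves a + (al / u) e: if al / u is real it is
     nonnegative and the cone condition applies, otherwise hyperbolicity does. *)
  - move=> u u0; rewrite ii.
    have [->|un0] := eqVneq u 0.
      rewrite mul0r scale0r addr0 exprZn linearZ mulf_neq0 ?expf_neq0//.
        by rewrite mulf_neq0// eq_complex/= gt_eqF.
      by rewrite lt0r_neq0.
    have -> : (al%:C * 'i) *: e + (u * 'i) *: a =
              (u * 'i) *: (a + (al%:C / u) *: e).
      rewrite scalerDr scalerA addrC; congr (_ + _ *: _).
      by field.
    rewrite exprZn linearZ mulf_neq0 ?expf_neq0 ?mulf_neq0//.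
    have [v0|v0] := eqVneq (complex.Im (al%:C / u)) 0; last exact: (hyperbolicP He).
    have -> : al%:C / u = (complex.Re (al%:C / u))%:C.
      by rewrite {1}[al%:C / u]complexE v0 mulr0 addr0.
    apply/lt0r_neq0/Ca; case: (u) u0 => u1 u2 /= u0; simpc.
    by rewrite /= mulr_ge0 ?(ltW al0)// divr_ge0// addr_ge0 ?sqr_ge0.
  - by case: (w) w0 => w1 w2 /= w0; simpc.
have k0 : 0 < L (a ^+ m) * (complex.Im z)%:C ^+ m.
  by rewrite mulr_gt0// exprn_gt0// ltcR.
(* A lower bound independent of al, whereas a zero at al = 0 would make the right-hand side
   O(al). *)
have low (al : R) : 0 < al -> L (a ^+ m) * (complex.Im z)%:C ^+ m <=
    `|L ((x + z *: a + (al%:C * 'i) *: e) ^+ m)|.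
  move=> al0; rewrite addrAC; apply: line_poly_ge => // w w0.
  exact: shifted (ltW w0).
apply/negP => /eqP z1.
have [K K0 KP] := horner_lipschitz (line_poly L m (x + z *: a) e).
have [k kE] := ge0_complexP (ltW k0); have [K' K'E] := ge0_complexP K0.
rewrite kE ltcR in k0; rewrite K'E ler0c in K0.
pose al := k / (k + K' + 1).
have al0 : 0 < al by rewrite divr_gt0//; lra.
have nal : `|al%:C * 'i| = al%:C :> C.
  by rewrite normc_def/=; congr (_%:C); rewrite !mul0r !mulr0 mulr1 subr0 addr0 expr0n add0r sqrtr_sqr gtr0_norm.
have al1 : al <= 1 by rewrite ler_pdivrMr; lra.
have := KP (al%:C * 'i) 0; rewrite nal normr0 lecR al1 ler01 => /(_ isT isT).
rewrite !horner_line_poly subr0 scale0r addr0 z1 subr0 nal K'E => /(le_trans (low _ al0)).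
rewrite kE -rmorphM lecR; apply/negP; rewrite -ltNge.
by rewrite /al mulrA ltr_pdivrMr; nra.
Qed.

(** Along the segment from e to b the form does not vanish at e + s (b - e) + z a with Re z >= 0.
    Hence L ((b + t a)^m) has no zero t >= 0; being real, and positive at t = 0, it stays
    positive. *)
Lemma hyp_cone_cone L m e a b : real_form L m -> hyperbolic L m e ->
  hyp_cone L m e a -> hyp_cone L m e b -> hyp_cone L m a b.
Proof.
move=> Lr He Ca Cb; have Ha := hyperbolic_cone He Ca.
have [Ve Le _] := He; have [Va {}Ca] := Ca; have [Vb {}Cb] := Cb.
have La : 0 < L (a ^+ m) by have := Ca 0 (lexx _); rewrite scale0r addr0.
split=> //.
have nz (t : R) : 0 <= t -> L ((b + t%:C *: a) ^+ m) != 0.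
  move=> t0.
  have VbN (s : R) : V (e + s%:C *: (b - e)).
    apply: VD => //; apply: VZ; apply: VD => //; rewrite -scaleN1r.
    by rewrite -(rmorphN1 (real_complex R)); exact: VZ.
  have := @line_homotopy L m e (b - e) a (lt0r_neq0 La) _ _ 1 t%:C.
  rewrite scale1r [e + (_ - _)]addrC subrK ler01 lexx/=; apply => //.
  - move=> s z s01 z0.
    have [zi|zi] := eqVneq (complex.Im z) 0; last exact: (hyperbolicP Ha).
    have -> : z = 0 by rewrite [z]complexE z0 zi mulr0 addr0.
    rewrite scale0r addr0; have [->|s0] := eqVneq s 0.
      by rewrite scale0r addr0 lt0r_neq0.
    have s0' : s%:C != 0 :> C by rewrite eq_complex/= negb_and s0.
    have -> : e + s%:C *: (b - e) = s%:C *: (b + ((1 - s) / s)%:C *: e).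
      rewrite [RHS]scalerDr scalerA -rmorphM/= mulrCA divff// mulr1 rmorphB rmorph1/=.
      by rewrite scalerBl scale1r scalerBr addrCA.
    rewrite exprZn linearZ mulf_neq0 ?expf_neq0//; apply/lt0r_neq0/Cb.
    by move: s01 => /andP[? ?]; rewrite divr_ge0//; lra.
  - move=> z z0.
    have [zi|zi] := eqVneq (complex.Im z) 0; last exact: (hyperbolicP Ha).
    have zE : z = (complex.Re z)%:C by rewrite {1}[z]complexE zi mulr0 addr0.
    have [zz|zn0] := eqVneq z 0; first by rewrite zz scale0r addr0 lt0r_neq0.
    have -> : e + z *: a = z *: (a + ((complex.Re z)^-1)%:C *: e).
      have -> : ((complex.Re z)^-1)%:C = z^-1 by rewrite fmorphV/= -zE.
      by rewrite scalerDr scalerA divff// scale1r addrC.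
    by rewrite exprZn linearZ mulf_neq0 ?expf_neq0//; apply/lt0r_neq0/Ca; rewrite invr_ge0.
have Vba (u : R) : V (b + u%:C *: a) by apply: VD => //; exact: VZ.
pose q := line_poly L m b a.
have sq : (size q <= m.+1)%N by exact: size_poly.
pose p := \poly_(i < m.+1) complex.Re q`_i.
have LE (u : R) : L ((b + u%:C *: a) ^+ m) = (p.[u])%:C.
  have := RRe_real (Lr _ (Vba u)); rewrite -horner_line_poly => <-; congr (_ %:C).
  rewrite -/q (horner_coef_wide _ sq) [in RHS]horner_poly raddf_sum/=.
  apply: eq_bigr => i _; rewrite -rmorphXn/=.
  by case: (q`_i) => c d /=; simpc.
move=> t t0; rewrite LE ltcR ltNge; apply/negP => pt.
have p0 : 0 < p.[0] by rewrite -ltcR -LE scale0r addr0 -[b]addr0 -(scale0r e); exact: Cb.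
have pN : (- p).[0] <= 0 <= (- p).[t] by rewrite !hornerN; lra.
have [u /andP[u0 ut]] := poly_ivt t0 pN.
by rewrite rootN => /rootP pu; have := nz u u0; rewrite LE pu eqxx.
Qed.

(** As in the Gauss-Lucas theorem: the roots w on a line are real, so for Im z > 0 every term of the
    logarithmic derivative \sum 1 / (z - w) has negative imaginary part. *)
Lemma hyperbolic_deriv L m a :
  hyperbolic L m.+1 a -> hyperbolic (mul_scalar L a) m a.
Proof.
move=> Ha; have [Va La _] := Ha; split => //; first by rewrite /= /mul_scalar -exprS.
move=> x z Vx z0.
have [r rm E] := line_poly_normal x (lt0r_neq0 La).
have rim w : w \in r -> complex.Im w = 0.
  move=> wr; apply: contraTeq isT => w0; have := hyperbolicP Ha Vx w0.
  by rewrite -horner_line_poly E root_normal ?eqxx.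
have zr : z \notin r by apply/negP => /rim zi; rewrite zi ltxx in z0.
have : (line_poly L m.+1 x a)^`().[z] != 0.
  rewrite E derivZ hornerZ deriv_prod_XsubC// mulrA -hornerZ -E horner_line_poly.
  rewrite mulf_neq0//; first by apply: (hyperbolicP Ha) => //; rewrite gt_eqF.
  have neg (s : seq C) : {subset s <= r} -> s != [::] ->
      complex.Im (\sum_(w <- s) (z - w)^-1) < 0.
    have one w : w \in r -> complex.Im (z - w)^-1 < 0.
      move=> wr; have := rim _ wr; case: (z) z0 => z1 z2 /= z0.
      case: w {wr} => w1 w2 /= ->; rewrite subr0 oppr_lt0 divr_gt0//.
      by rewrite ltr_wpDl ?sqr_ge0// exprn_gt0.
    elim: s => // w [|w' s] IH sr _; first by rewrite big_seq1 one ?sr ?mem_head.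
    rewrite big_cons raddfD/= -[ltRHS]addr0 ltrD ?one ?sr ?mem_head// IH// => v vs.
    by rewrite sr// in_cons vs orbT.
  have rn : r != [::] by case: (r) rm.
  by have := neg r (fun _ => id) rn; apply: contraTneq => ->; rewrite ltxx.
by rewrite deriv_line_poly hornerZ horner_line_poly mulf_eq0 negb_or => /andP[].
Qed.

(** The roots of t |-> L ((b + t a)^(m+1)) are negative, so its logarithmic derivative is positive
    at every t >= 0. *)
Lemma hyp_cone_deriv L m a b : hyperbolic L m.+1 a ->
  hyp_cone L m.+1 a b -> hyp_cone (mul_scalar L a) m a b.
Proof.
move=> Ha [Vb Cb]; have [Va La _] := Ha; split => // t t0.
have [r rm E] := line_poly_normal b (lt0r_neq0 La).
have rneg w : w \in r -> exists2 u : R, w = u%:C & u < 0.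
  move=> wr; have w0 : complex.Im w = 0.
    apply: contraTeq isT => w0; have := hyperbolicP Ha Vb w0.
    by rewrite -horner_line_poly E root_normal ?eqxx.
  have wE : w = (complex.Re w)%:C by rewrite {1}[w]complexE w0 mulr0 addr0.
  exists (complex.Re w) => //; rewrite ltNge; apply/negP => /Cb.
  by rewrite -wE -horner_line_poly E root_normal ?ltxx.
have tr : t%:C \notin r.
  by apply/negP => /rneg[u /complexI <-]; rewrite ltNge t0.
have : 0 < (line_poly L m.+1 b a)^`().[t%:C].
  rewrite E derivZ hornerZ deriv_prod_XsubC// mulrA -hornerZ -E horner_line_poly.
  rewrite mulr_gt0 ?Cb//.
  have : all (fun w => w \in r) r by exact/allP.
  have : r != [::] by case: (r) rm.
  elim: {1 3 4}r => // w s IH _ /= /andP[/rneg[u -> u0] sr].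
  have tu : 0 < (t%:C - u%:C)^-1 :> C by rewrite invr_gt0 -rmorphB ltcR; lra.
  case: s IH sr => [|w' s] IH sr; first by rewrite big_seq1.
  by rewrite big_cons addr_gt0// IH.
by rewrite deriv_line_poly hornerZ horner_line_poly pmulr_rgt0 ?ltr0n.
Qed.

(** A polynomial with real values at all natural numbers has real coefficients; L (a x^m) is, up to
    m + 1, the linear coefficient of k |-> L ((x + k a)^(m+1)). *)
Lemma real_form_deriv L m a : V a -> real_form L m.+1 -> real_form (mul_scalar L a) m.
Proof.
move=> Va Lr x Vx; pose q := line_poly L m.+1 x a.
pose p := \poly_(i < m.+2) complex.Im q`_i.
have p0 : p = 0.
  apply: poly_ext_nat => i.
  have Vxi : V (x + (i%:R : R)%:C *: a) by apply: VD => //; exact: VZ.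
  have := Lr _ Vxi; rewrite -horner_line_poly => /complex_realP[k].
  rewrite (horner_coef_wide _ (size_poly _ _)) horner_poly => /(congr1 (@complex.Im R))/= qE.
  rewrite horner0 -[RHS]qE [RHS]raddf_sum/=; apply: eq_bigr => j _; rewrite -/(line_poly _ _ _ _) -/q.
  have -> : (i%:R)%:C ^+ j = (i%:R ^+ j)%:C :> C by rewrite rmorphXn.
  by case: (q`_j) => c d /=; simpc.
have q1 : complex.Im q`_1 = 0.
  by have := congr1 (fun p : {poly R} => p`_1) p0; rewrite coef_poly coef0.
have : q^`().[0] = m.+1%:R * mul_scalar L a (x ^+ m).
  by rewrite deriv_line_poly hornerZ horner_line_poly scale0r addr0.
rewrite horner_coef0 coef_deriv mulr1n => qE.
have LaE : mul_scalar L a (x ^+ m) = m.+1%:R^-1 * q`_1 by rewrite qE mulKf ?pnatr_eq0.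
suff : mul_scalar L a (x ^+ m) \is Num.real by [].
rewrite LaE realM ?realV ?realn//.
by rewrite [q`_1]complexE q1 mulr0 addr0; apply/complex_realP; eexists.
Qed.

(* Garding's inequality: each factor of the product may serve in turn as the  *)
(* direction of hyperbolicity, and differentiating along it keeps all cones.  *)
Lemma garding L m e (s : seq A) : size s = m -> real_form L m ->
  hyperbolic L m e -> (forall b, b \in s -> hyp_cone L m e b) ->
  0 < L (\prod_(b <- s) b).
Proof.
elim: s m L e => [|a s IH] m L e /=.
  by move=> <- _ [_ + _] _; rewrite big_nil expr0.
case: m => [|m] //= [sm] Lr He Hs; rewrite big_cons.
have Ca := Hs a (mem_head _ _); have Ha := hyperbolic_cone He Ca.
have [Va _] := Ca.
apply: (IH m (mul_scalar L a) a sm).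
- exact: real_form_deriv.
- exact: hyperbolic_deriv.
- move=> b bs; apply: hyp_cone_deriv => //.
  by apply: hyp_cone_cone He Ca _ => //; apply: Hs; rewrite in_cons bs orbT.
Qed.

End hyperbolic.

(** * The exterior algebra and the 2-form of a quaternionic matrix *)

Section wedge.
Variables (R : realType) (n : nat).
Local Notation C := R[i].
Local Notation form := (Defs.form R n).
Implicit Types (F G H : form) (I J K : {set 'I_(n + n)}) (z : C).

Lemma form_basisE I J : (form_basis I : form) J = (J == I)%:R.
Proof. by rewrite ffunE. Qed.

Lemma form_sum F : F = \sum_I F I *: form_basis I.
Proof.
apply/ffunP => J; rewrite sum_ffunE (bigD1 J)//= big1 => [|I IJ].
  by rewrite ffunE form_basisE eqxx addr0 /GRing.scale/= mulr1.
by rewrite ffunE form_basisE eq_sym (negPf IJ) /GRing.scale/= mulr0.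
Qed.

Lemma ewedgeDl F G H : ewedge (F + G) H = ewedge F H + ewedge G H.
Proof.
rewrite /ewedge -big_split; apply: eq_bigr => I _ /=.
by rewrite -big_split; apply: eq_bigr => J _ /=; rewrite ffunE mulrDl scalerDl.
Qed.

Lemma ewedgeDr F G H : ewedge F (G + H) = ewedge F G + ewedge F H.
Proof.
rewrite /ewedge -big_split; apply: eq_bigr => I _ /=.
by rewrite -big_split; apply: eq_bigr => J _ /=; rewrite ffunE mulrDr scalerDl.
Qed.

Lemma ewedgeZl z F G : ewedge (z *: F) G = z *: ewedge F G.
Proof.
rewrite /ewedge scaler_sumr; apply: eq_bigr => I _.
rewrite scaler_sumr; apply: eq_bigr => J _.
by rewrite ffunE scalerA mulrA.
Qed.

Lemma ewedgeZr z F G : ewedge F (z *: G) = z *: ewedge F G.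
Proof.
rewrite /ewedge scaler_sumr; apply: eq_bigr => I _.
rewrite scaler_sumr; apply: eq_bigr => J _.
by rewrite ffunE scalerA mulrCA.
Qed.

HB.instance Definition _ F := GRing.isLinear.Build C form form *:%R (ewedge F)
  (fun z G H => etrans (ewedgeDr F (z *: G) H) (congr1 (+%R^~ _) (ewedgeZr z F G))).

Definition ewedger G := ewedge^~ G.

HB.instance Definition _ G := GRing.isLinear.Build C form form *:%R (ewedger G)
  (fun z F H => etrans (ewedgeDl (z *: F) H G) (congr1 (+%R^~ _) (ewedgeZl z F G))).

Lemma ewedge_suml (I : Type) (r : seq I) (P : pred I) (f : I -> form) G :
  ewedge (\sum_(i <- r | P i) f i) G = \sum_(i <- r | P i) ewedge (f i) G.
Proof. exact: (linear_sum (ewedger G)). Qed.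

Lemma ewedge_sumr (I : Type) (r : seq I) (P : pred I) (f : I -> form) G :
  ewedge G (\sum_(i <- r | P i) f i) = \sum_(i <- r | P i) ewedge G (f i).
Proof. exact: linear_sum. Qed.

Lemma ewedge0l F : ewedge 0 F = 0.
Proof. exact: (linear0 (ewedger F)). Qed.

Lemma ewedge0r F : ewedge F 0 = 0.
Proof. exact: linear0. Qed.

Lemma ewedgeNl F G : ewedge (- F) G = - ewedge F G.
Proof. exact: (linearN (ewedger G)). Qed.

Lemma ewedgeNr F G : ewedge F (- G) = - ewedge F G.
Proof. exact: linearN. Qed.

Lemma ewedge_form_basis I J : ewedge (form_basis I) (form_basis J) = ewedge_basis I J :> form.
Proof.
rewrite /ewedge (bigD1 I isT) /= [X in _ + X]big1 => [|I' II']; last first.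
  by rewrite big1// => J' _; rewrite form_basisE (negPf II') mul0r scale0r.
rewrite addr0 (bigD1 J isT) /= [X in _ + X]big1 => [|J' JJ']; last first.
  by rewrite [X in _ * X]form_basisE (negPf JJ') mulr0 scale0r.
by rewrite addr0 !form_basisE !eqxx mulr1 scale1r.
Qed.

Lemma inversionsE I J : inversions I J = (\sum_(i in I) \sum_(j in J) (j < i))%N.
Proof.
rewrite pair_big_dep/= /inversions -sum1_card big_mkcond [RHS]big_mkcond/=.
apply: eq_bigr => -[i j] _ /=; rewrite inE/= andbA.
by case: (i \in I); case: (j \in J); case: (j < i)%N.
Qed.

Lemma sumn_setU I J (f : 'I_(n + n) -> nat) : [disjoint I & J]%B ->
  (\sum_(i in (I :|: J)%SET) f i = \sum_(i in I) f i + \sum_(i in J) f i)%N.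
Proof.
by move=> IJ; rewrite -bigU//; apply: eq_bigl => i; rewrite finset.in_setU.
Qed.

Lemma inversionsUl I J K : [disjoint I & J]%B ->
  inversions (I :|: J)%SET K = (inversions I K + inversions J K)%N.
Proof. by move=> IJ; rewrite !inversionsE sumn_setU. Qed.

Lemma inversionsUr I J K : [disjoint I & J]%B ->
  inversions K (I :|: J)%SET = (inversions K I + inversions K J)%N.
Proof.
move=> IJ; rewrite !inversionsE -big_split; apply: eq_bigr => k _ /=.
by rewrite sumn_setU.
Qed.

(** A pair of distinct indices is inverted in exactly one of the two orders. *)
Lemma inversionsC I J : [disjoint I & J]%B ->
  (inversions I J + inversions J I)%N = (#|I| * #|J|)%N.
Proof.
move=> IJ; rewrite !inversionsE [X in (_ + X)%N]exchange_big -big_split/=.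
rewrite -sum_nat_const; apply: eq_bigr => i iI; rewrite -big_split/= -sum1_card.
apply: eq_bigr => j jJ; case: ltngtP => // /val_inj ij.
by move: IJ => /pred0P/(_ i); rewrite /= iI -ij jJ.
Qed.

Lemma disjoint_setUl I J K :
  [disjoint (I :|: J)%SET & K]%B = [disjoint I & K]%B && [disjoint J & K]%B.
Proof. by rewrite -!setI_eq0 finset.setIUl finset.setU_eq0. Qed.

(** Both sides vanish unless I, J, K are pairwise disjoint; then both signs count the inversions of
    the three pairs, [inversions] being additive in each argument. *)
Lemma ewedgeA_basis I J K : ewedge (ewedge_basis I J) (form_basis K) =
  ewedge (form_basis I) (ewedge_basis J K) :> form.
Proof.
rewrite {1}/ewedge_basis [in RHS]/ewedge_basis.
case: (boolP [disjoint I & J]%B) => IJ; last first.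
  case: ifP => JK; last by rewrite ewedge0l ewedge0r.
  rewrite ewedge0l ewedgeZr ewedge_form_basis /ewedge_basis.
  by rewrite disjoint_sym disjoint_setUl disjoint_sym (negPf IJ) scaler0.
rewrite ewedgeZl ewedge_form_basis /ewedge_basis disjoint_setUl.
case: (boolP [disjoint J & K]%B) => JK; last by rewrite andbF scaler0 ewedge0r.
rewrite andbT ewedgeZr ewedge_form_basis /ewedge_basis.
rewrite [[disjoint I & (J :|: K)%SET]%B]disjoint_sym disjoint_setUl.
rewrite ![[disjoint _ & I]%B]disjoint_sym IJ /=.
case: (boolP [disjoint I & K]%B) => IK; last by rewrite !scaler0.
rewrite !scalerA finset.setUA; congr (_ *: _).
by rewrite -!exprD; congr (_ ^+ _); rewrite inversionsUl// inversionsUr//; lia.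
Qed.

Lemma linear_form_ext (f g : {linear form -> form}) :
  (forall I, f (form_basis I) = g (form_basis I)) -> f =1 g.
Proof.
move=> fg F; rewrite (form_sum F) !linear_sum; apply: eq_bigr => I _.
by rewrite !linearZ fg.
Qed.

Lemma ewedgeA F G H : ewedge F (ewedge G H) = ewedge (ewedge F G) H.
Proof.
apply: (@linear_form_ext (ewedger (ewedge G H)) (ewedger H \o ewedger G)) => I.
apply: (@linear_form_ext (ewedge (form_basis I) \o ewedger H)
                         (ewedger H \o ewedge (form_basis I))) => J.
apply: (@linear_form_ext (ewedge (form_basis I) \o ewedge (form_basis J))
                         (ewedge (ewedge (form_basis I) (form_basis J)))) => K.
by rewrite /= !ewedge_form_basis ewedgeA_basis.
Qed.

Lemma ewedge1l F : ewedge form1 F = F.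
Proof.
rewrite {1}(form_sum F) ewedge_sumr {2}(form_sum F); apply: eq_bigr => I _.
rewrite ewedgeZr ewedge_form_basis /ewedge_basis -setI_eq0 finset.set0I eqxx.
by rewrite inversionsE big_set0 expr0 scale1r finset.set0U.
Qed.

Lemma ewedge1r F : ewedge F form1 = F.
Proof.
rewrite {1}(form_sum F) ewedge_suml {2}(form_sum F); apply: eq_bigr => I _.
rewrite ewedgeZl ewedge_form_basis /ewedge_basis -setI_eq0 finset.setI0 eqxx.
rewrite inversionsE big1 => [|i _]; last by rewrite big_set0.
by rewrite expr0 scale1r finset.setU0.
Qed.

Lemma ewedge_basisC I J :
  ewedge_basis J I = (-1) ^+ (#|I| * #|J|) *: ewedge_basis I J :> form.
Proof.
rewrite /ewedge_basis [[disjoint J & I]%B]disjoint_sym.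
case: (boolP [disjoint I & J]%B) => IJ; last by rewrite (scaler0 form).
rewrite finset.setUC scalerA; congr (_ *: _).
rewrite -inversionsC// exprD mulrAC -exprD.
have -> (k : nat) : (-1 : C) ^+ (k + k) = 1 by rewrite addnn -mul2n exprM sqrrN !expr1n.
by rewrite mul1r.
Qed.

(** Forms all of whose components have even degree commute, which gives access to powers and to the
    binomial formula. *)
Definition even_form : {pred form} := fun F => [forall I : {set 'I_(n + n)}, odd #|I| ==> (F I == 0)].

Lemma even_formP F : reflect (forall I, odd #|I| -> F I = 0) (F \in even_form).
Proof.
apply: (iffP forallP) => H I; first by move=> oI; have := H I; rewrite oI => /eqP.
by apply/implyP => /H ->.
Qed.

Lemma even_form_submod : subsemimod_closed even_form.
Proof.
split; first split.
- by apply/even_formP => I _; rewrite ffunE.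
- move=> F G /even_formP FE /even_formP GE; apply/even_formP => I oI.
  by rewrite ffunE FE// GE// addr0.
- move=> z F /even_formP FE; apply/even_formP => I oI.
  by rewrite ffunE FE// scaler0.
Qed.

HB.instance Definition _ := GRing.isSubmodClosed.Build C form even_form
  even_form_submod.

Lemma form_basis_even I : ~~ odd #|I| -> form_basis I \in even_form.
Proof.
move=> eI; apply/even_formP => J oJ; rewrite form_basisE.
by case: eqP oJ eI => // -> ->.
Qed.

Lemma ewedge_basis_even I J : ~~ odd (#|I| + #|J|) -> ewedge_basis I J \in even_form.
Proof.
move=> eIJ; rewrite /ewedge_basis; case: ifP => IJ; last exact: rpred0.
by rewrite rpredZ// form_basis_even// cardsU disjoint_setI0// cards0 subn0.
Qed.

Lemma ewedge_even F G : F \in even_form -> G \in even_form -> ewedge F G \in even_form.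
Proof.
move=> /even_formP FE /even_formP GE; rewrite /ewedge.
apply: rpred_sum => I _; apply: rpred_sum => J _.
have [oI|eI] := boolP (odd #|I|); first by rewrite FE// mul0r scale0r rpred0.
have [oJ|eJ] := boolP (odd #|J|); first by rewrite GE// mulr0 scale0r rpred0.
by rewrite rpredZ// ewedge_basis_even// oddD (negPf eI) (negPf eJ).
Qed.

Lemma ewedge_evenC F G : F \in even_form -> ewedge F G = ewedge G F.
Proof.
move=> /even_formP FE; rewrite [RHS]/ewedge exchange_big /ewedge.
apply: eq_bigr => I _; apply: eq_bigr => J _; rewrite mulrC.
have [oI|eI] := boolP (odd #|I|); first by rewrite (FE I oI) mulr0 (scale0r (ewedge_basis I J)) (scale0r (ewedge_basis J I)).
by rewrite (ewedge_basisC I) -signr_odd oddM (negPf eI) expr0 scale1r.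
Qed.

Lemma form1_even : form1 \in even_form.
Proof. by apply: form_basis_even; rewrite cards0. Qed.

Lemma omega_formC (a b : 'I_(n + n)) :
  ewedge (omega_form a) (omega_form b) = - ewedge (omega_form b) (omega_form a) :> form.
Proof. by rewrite !ewedge_form_basis ewedge_basisC !cards1 expr1 scaleN1r. Qed.

Lemma omega_form_even (a b : 'I_(n + n)) :
  ewedge (omega_form a) (omega_form b) \in even_form.
Proof. by rewrite ewedge_form_basis ewedge_basis_even// !cards1. Qed.

End wedge.

(** * The commutative algebra of even forms *)

Section even_algebra.
Variables (R : realType) (n : nat).
Local Notation C := R[i].
Local Notation form := (Defs.form R n).

Record eform := EForm { eform_val :> form; _ : eform_val \in even_form (n := n) }.

HB.instance Definition _ := [isSub for eform_val].
HB.instance Definition _ := [Choice of eform by <:].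
HB.instance Definition _ := [SubChoice_isSubLmodule of eform by <:].

Implicit Types x y z : eform.

Definition emul x y : eform := EForm (ewedge_even (valP x) (valP y)).
Definition eone : eform := EForm (form1_even R n).

Lemma emulA : associative emul.
Proof. by move=> x y z; apply: val_inj; exact: ewedgeA. Qed.
Lemma emulC : commutative emul.
Proof. by move=> x y; apply: val_inj; exact/ewedge_evenC/valP. Qed.
Lemma emul1 : left_id eone emul.
Proof. by move=> x; apply: val_inj; exact: ewedge1l. Qed.
Lemma emulDl : left_distributive emul +%R.
Proof. by move=> x y z; apply: val_inj; exact: ewedgeDl. Qed.
Lemma eone_neq0 : eone != 0.
Proof.
apply/eqP => /(congr1 (fun x : eform => val x finset.set0))/eqP.
by rewrite /= /form1 form_basisE eqxx ffunE oner_eq0.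
Qed.

HB.instance Definition _ := GRing.Zmodule_isComNzRing.Build eform
  emulA emulC emul1 emulDl eone_neq0.

Lemma emulZl (c : C) x y : c *: (x * y) = (c *: x) * y.
Proof. by apply: val_inj; rewrite /= ewedgeZl. Qed.

HB.instance Definition _ := GRing.Lmodule_isLalgebra.Build C eform emulZl.
HB.instance Definition _ := GRing.Lalgebra_isComAlgebra.Build C eform.

Lemma eform_valM x y : val (x * y) = ewedge (val x) (val y).
Proof. by []. Qed.

Lemma eform_prod (I : Type) (r : seq I) (P : pred I) (f : I -> eform) :
  val (\prod_(i <- r | P i) f i) = \big[ewedge/form1]_(i <- r | P i) val (f i).
Proof. exact: (big_morph _ eform_valM). Qed.

End even_algebra.

Section square_zero.
Variable A : comNzRingType.
Implicit Types (x y : A) (s : seq A).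

Lemma exprD_sq0 x y (p : nat) : y ^+ 2 = 0 ->
  (x + y) ^+ p.+1 = x ^+ p.+1 + p.+1%:R * (y * x ^+ p).
Proof.
move=> y0; elim: p => [|p IH]; first by rewrite !expr1 expr0 mul1r mulr1.
rewrite exprS IH -[p.+2 in X in _ = _ + X]addn1 natrD mulrDl !mulrDr.
have -> : y * (p.+1%:R * (y * x ^+ p)) = y ^+ 2 * (p.+1%:R * x ^+ p) by ring.
by rewrite y0 mul0r addr0 [x ^+ p.+2]exprS [x ^+ p.+1]exprS; ring.
Qed.

(** Only squarefree monomials survive: the one of degree [size s] occurs (size s)! times, and there
    is none of higher degree. *)
Lemma expr_sum_sq0 s : {in s, forall y, y ^+ 2 = 0} ->
  (\sum_(y <- s) y) ^+ (size s).+1 = 0 /\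
  (\sum_(y <- s) y) ^+ size s = (size s)`!%:R * \prod_(y <- s) y.
Proof.
elim: s => [|y s IH] s0; first by rewrite !big_nil expr0n fact0 mulr1 expr0.
have [|E0 E1] := IH; first by move=> x xs; rewrite s0// in_cons xs orbT.
have y0 : y ^+ 2 = 0 by rewrite s0// mem_head.
rewrite !big_cons /= addrC !exprD_sq0// !E0 [in X in X = 0]exprS E0 E1 !mulr0 add0r.
by split=> //; rewrite add0r factS natrM; ring.
Qed.

Lemma expr_sum_ord_sq0 n (f : 'I_n -> A) : (forall i, f i ^+ 2 = 0) ->
  (\sum_i f i) ^+ n = n`!%:R * \prod_i f i.
Proof.
move=> f0; have [|_] := @expr_sum_sq0 [seq f i | i <- index_enum 'I_n].
  by move=> _ /mapP[i _ ->].
by rewrite !big_map size_map -[index_enum _]enumT size_enum_ord.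
Qed.

End square_zero.

(** Passing from a b c to c b a takes three exchanges of neighbours, each costing a sign. *)
Lemma anticomm_swap13 (V : zmodType) (op : V -> V -> V) (a b c d : V) :
  associative op -> (forall x y, op (- x) y = - op x y) ->
  (forall x y, op x (- y) = - op x y) ->
  op a b = - op b a -> op b c = - op c b -> op a c = - op c a ->
  op (op a b) (op c d) = - op (op c b) (op a d).
Proof.
move=> opA opNl opNr ab bc ac.
rewrite -opA [op b _]opA bc opNl opNr -[op (op c b) d]opA [op a (op c _)]opA ac.
by rewrite opNl opprK -opA [op a _]opA ab opNl opNr -[op (op b a) d]opA [op c (op b _)]opA.
Qed.

(** * The 2-form of a quaternionic matrix *)

Section two_forms.
Variables (R : realType) (n : nat) (A : comAlgType R[i]).
Local Notation C := R[i].
(** [o2 a b] stands for omega^a /\ omega^b. The 1-forms themselves are outside the even algebra, so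
    their products are taken as primitive, with the two sign rules they inherit. *)
Variable o2 : 'I_(n + n) -> 'I_(n + n) -> A.
Hypothesis o2C : forall a b, o2 a b = - o2 b a.
Hypothesis o2M : forall a b c d, o2 a b * o2 c d = - (o2 c b * o2 a d).
Implicit Types (a b c d : 'I_(n + n)) (f g : 'I_(n + n) -> C) (M : 'M[quat R]_n).
#[local] Arguments conjc : simpl never.

Definition wedge1 f g : A := \sum_a \sum_b (f a * g b) *: o2 a b.

Lemma wedge1M f g f' g' : wedge1 f g * wedge1 f' g' = - (wedge1 f' g * wedge1 f g').
Proof.
have E h k h' k' : wedge1 h k * wedge1 h' k' =
    \sum_a \sum_b \sum_c \sum_d (h a * k b * (h' c * k' d)) *: (o2 a b * o2 c d).
  rewrite /wedge1 mulr_suml; apply: eq_bigr => a _.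
  rewrite mulr_suml; apply: eq_bigr => b _.
  rewrite mulr_sumr; apply: eq_bigr => c _.
  rewrite mulr_sumr; apply: eq_bigr => d _.
  by rewrite -scalerAl -scalerAr scalerA.
rewrite !E -sumrN.
rewrite [LHS](eq_bigr (fun a => \sum_c \sum_b \sum_d
    (f a * g b * (f' c * g' d)) *: (o2 a b * o2 c d))); last first.
  by move=> a _; rewrite exchange_big.
rewrite exchange_big; apply: eq_bigr => c _.
rewrite [LHS]exchange_big -sumrN; apply: eq_bigr => b _.
rewrite -sumrN; apply: eq_bigr => a _; rewrite -sumrN; apply: eq_bigr => d _.
by rewrite o2M scalerN; congr (- (_ *: _)); ring.
Qed.

Lemma wedge1_sq0 f g : wedge1 f g ^+ 2 = 0.
Proof.
apply/eqP; have /eqP := wedge1M f g f g; rewrite -addr_eq0 -expr2 -mulr2n.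
by rewrite -scaler_nat scaler_eq0 pnatr_eq0.
Qed.

Lemma conjcD (x y : C) : conjc (x + y) = conjc x + conjc y.
Proof. exact: (rmorphD (@conjc R)). Qed.
Lemma conjcM (x y : C) : conjc (x * y) = conjc x * conjc y.
Proof. exact: (rmorphM (@conjc R)). Qed.
Lemma conjcN (x : C) : conjc (- x) = - conjc x.
Proof. exact: (rmorphN (@conjc R)). Qed.

(** The quaternion q is z + w j with z = [zq q] and w = [wq q], where j z = conj(z) j. *)
Definition zq (q : quat R) : C := qre q +i* qi q.
Definition wq (q : quat R) : C := qj q +i* qk q.

Lemma zqD p q : zq (p + q) = zq p + zq q. Proof. by []. Qed.
Lemma wqD p q : wq (p + q) = wq p + wq q. Proof. by []. Qed.

Lemma zqM p q : zq (p * q) = zq p * zq q - wq p * conjc (wq q).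
Proof.
case: p q => [????] [????]; apply/eqP; rewrite eq_complex /=.
by apply/andP; split; apply/eqP; ring.
Qed.

Lemma wqM p q : wq (p * q) = zq p * wq q + wq p * conjc (zq q).
Proof.
case: p q => [????] [????]; apply/eqP; rewrite eq_complex /=.
by apply/andP; split; apply/eqP; ring.
Qed.

Lemma zq_conj q : zq (conjq q) = conjc (zq q). Proof. by []. Qed.
Lemma wq_conj q : wq (conjq q) = - wq q. Proof. by []. Qed.
Lemma zq_real (r : R) : zq (qreal r) = r%:C. Proof. by []. Qed.
Lemma wq_real (r : R) : wq (qreal r) = 0. Proof. by []. Qed.

(* The 2-form attached to M = Z + W j: it is Delta u when M is the Hessian    *)
(* matrix of u.                                                               *)
Definition entry_form (l k : 'I_n) (q : quat R) : A :=
  zq q *: o2 (lshift n l) (rshift n k)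
  + (2^-1 * wq q) *: o2 (lshift n l) (lshift n k)
  + (2^-1 * conjc (wq q)) *: o2 (rshift n l) (rshift n k).

Definition mx_form M : A := \sum_l \sum_k entry_form l k (M l k).

Lemma entry_formD l k p q :
  entry_form l k (p + q) = entry_form l k p + entry_form l k q.
Proof.
rewrite /entry_form zqD wqD conjcD !mulrDr !scalerDl.
by rewrite [RHS]addrACA [X in _ = X + _]addrACA.
Qed.

Lemma entry_form0 l k : entry_form l k 0 = 0.
Proof. by apply: (addrI (entry_form l k 0)); rewrite -entry_formD !addr0. Qed.

Lemma entry_form_sum l k (I : Type) (r : seq I) (P : pred I) (F : I -> quat R) :
  entry_form l k (\sum_(i <- r | P i) F i) = \sum_(i <- r | P i) entry_form l k (F i).
Proof. exact: (big_morph _ (entry_formD l k) (entry_form0 l k)). Qed.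

Lemma entry_formZ l k (r : R) q :
  entry_form l k (qreal r * q) = r%:C *: entry_form l k q.
Proof.
rewrite /entry_form zqM wqM zq_real wq_real !mul0r subr0 addr0.
rewrite conjcM conjc_real !scalerDr !scalerA.
by congr (_ + _ *: _ + _ *: _); ring.
Qed.

Lemma mx_formD M M' : mx_form (M + M') = mx_form M + mx_form M'.
Proof.
rewrite -big_split; apply: eq_bigr => l _; rewrite -big_split.
by apply: eq_bigr => k _; rewrite mxE entry_formD.
Qed.

Lemma mx_formZ (r : R) M : mx_form (qreal r *: M) = r%:C *: mx_form M.
Proof.
rewrite scaler_sumr; apply: eq_bigr => l _; rewrite scaler_sumr.
by apply: eq_bigr => k _; rewrite mxE entry_formZ.
Qed.

Definition ebeta : A := \sum_(l < n) o2 (lshift n l) (rshift n l).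

Lemma mx_form1 : mx_form 1%:M = ebeta.
Proof.
apply: eq_bigr => l _; rewrite (bigD1 l)//= big1 ?addr0 => [|k kl].
  rewrite mxE eqxx mulr1n /entry_form -[1]/(qreal 1) zq_real wq_real conjc0.
  by rewrite !mulr0 !scale0r !addr0 scale1r.
by rewrite mxE eq_sym (negPf kl) mulr0n entry_form0.
Qed.

(* xi and eta = J xi for the column v, so that xi /\ eta is the form of v v^*. *)
Definition col_xi (v : 'I_n -> quat R) a : C :=
  match fintype.split a with inl l => zq (v l) | inr l => conjc (wq (v l)) end.
Definition col_eta (v : 'I_n -> quat R) a : C :=
  match fintype.split a with inl l => - wq (v l) | inr l => conjc (zq (v l)) end.
Definition col_form v : A := wedge1 (col_xi v) (col_eta v).

Lemma split_lshift l : fintype.split (lshift n l : 'I_(n + n)) = inl l.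
Proof. exact: (unsplitK (inl l : 'I_n + 'I_n)%type). Qed.

Lemma split_rshift l : fintype.split (rshift n l : 'I_(n + n)) = inr l.
Proof. exact: (unsplitK (inr l : 'I_n + 'I_n)%type). Qed.

(** A 2-form only depends on the antisymmetric part of its coefficients. Where both indices lie in
    the same half every pair is met twice, whence the factors 1/2 of [entry_form]. *)
Lemma two_formE (d : 'I_(n + n) -> 'I_(n + n) -> C) (q : 'I_n -> 'I_n -> quat R) :
  (forall l k, d (lshift n l) (rshift n k) - d (rshift n k) (lshift n l) = zq (q l k)) ->
  (forall l k, d (lshift n l) (lshift n k) - d (lshift n k) (lshift n l) = wq (q l k)) ->
  (forall l k, d (rshift n l) (rshift n k) - d (rshift n k) (rshift n l) = conjc (wq (q l k))) ->
  \sum_a \sum_b d a b *: o2 a b = \sum_l \sum_k entry_form l k (q l k).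
Proof.
move=> dz dw dw'.
have half (c : C) (x : A) : c *: x = (2^-1 * c) *: x + (2^-1 * c) *: x.
  by rewrite -scalerDl -mulrDl -mulr2n -[2^-1 *+ 2]mulr_natl divff ?mul1r// pnatr_eq0.
have antisym (F : 'I_n -> 'I_n -> C) (p : 'I_n -> 'I_n -> A) :
    (forall l k, p l k = - p k l) ->
    \sum_l \sum_k F l k *: p l k = \sum_l \sum_k (2^-1 * (F l k - F k l)) *: p l k.
  move=> pC; transitivity (\sum_l \sum_k (2^-1 * F l k) *: p l k +
                           \sum_l \sum_k (2^-1 * F l k) *: p l k).
    rewrite -big_split; apply: eq_bigr => l _; rewrite -big_split; apply: eq_bigr => k _.
    exact: half.
  rewrite [X in _ + X = _]exchange_big -big_split; apply: eq_bigr => l _.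
  rewrite -big_split; apply: eq_bigr => k _ /=.
  by rewrite [p k l]pC scalerN -scalerBl -mulrBr.
rewrite big_split_ord/=.
under eq_bigr => l _ do rewrite big_split_ord/=.
rewrite big_split/=.
under [X in _ + X]eq_bigr => l _ do rewrite big_split_ord/=.
rewrite [X in _ + X]big_split/=.
under [X in _ + (X + _)]eq_bigr => l _ do under eq_bigr => k _ do rewrite o2C.
rewrite [X in _ + (X + _)]exchange_big/=.
rewrite antisym; last by move=> l k; rewrite o2C.
rewrite [X in _ + (_ + X)]antisym; last by move=> l k; rewrite o2C.
rewrite -!big_split; apply: eq_bigr => l _ /=; rewrite -!big_split; apply: eq_bigr => k _ /=.
rewrite /entry_form -dw' -dw -dz.
by rewrite addrA -[X in X + _]addrA scalerN -scaleNr -scalerDl [X in X + _ = _]addrC.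
Qed.

Lemma col_formE v :
  col_form v = \sum_l \sum_k entry_form l k (v l * conjq (v k)).
Proof.
apply: two_formE => l k; rewrite /col_xi /col_eta ?split_lshift ?split_rshift;
  rewrite ?zqM ?wqM zq_conj wq_conj ?conjcD ?conjcN ?conjcM ?conjcN ?conjcK; ring.
Qed.

Lemma mx_form_diag (U : 'M[quat R]_n) (d : 'rV[R]_n) :
  mx_form (U *m diag_mx (map_mx qreal d) *m adjq U) =
  \sum_j (d ord0 j)%:C *: col_form (fun l => U l j).
Proof.
rewrite [RHS](eq_bigr (fun j => \sum_l \sum_k
    entry_form l k (qreal (d ord0 j) * (U l j * conjq (U k j))))); last first.
  move=> j _; rewrite col_formE scaler_sumr; apply: eq_bigr => l _.
  by rewrite scaler_sumr; apply: eq_bigr => k _; rewrite entry_formZ.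
rewrite exchange_big; apply: eq_bigr => l _ /=.
rewrite exchange_big; apply: eq_bigr => k _ /=.
rewrite -entry_form_sum mul_mx_diag mxE; congr entry_form.
apply: eq_bigr => j _; rewrite !mxE mulrA; congr (_ * _).
case: (U l j) => ? ? ? ?; congr Quat => /=; ring.
Qed.

Section unitary.
Variables (U : 'M[quat R]_n) (Uu : unitaryq U) (L : {scalar A}).
Hypothesis Ltop : L (\prod_(l < n) o2 (lshift n l) (rshift n l)) = 1.

Let y j := col_form (fun l => U l j).

(** The equation U U^* = 1 is a diagonalization of the identity with all eigenvalues 1. *)
Lemma ebeta_unitary : ebeta = \sum_j y j.
Proof.
have [UU _] := Uu; rewrite -mx_form1 -UU.
have -> : U *m adjq U = U *m diag_mx (map_mx qreal (const_mx 1)) *m adjq U.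
  have -> : diag_mx (map_mx qreal (const_mx 1)) = 1%:M :> 'M[quat R]_n.
    by apply/matrixP => i j; rewrite !mxE.
  by rewrite mulmx1.
rewrite mx_form_diag; apply: eq_bigr => j _.
by rewrite mxE scale1r.
Qed.

Lemma o2_sq0 a b : o2 a b ^+ 2 = 0.
Proof.
apply/eqP; have /eqP := o2M a b a b; rewrite -addr_eq0 -expr2 -mulr2n.
by rewrite -scaler_nat scaler_eq0 pnatr_eq0.
Qed.

Lemma ebeta_top : L (ebeta ^+ n) = n`!%:R.
Proof.
rewrite /ebeta expr_sum_ord_sq0 => [|l]; last exact: o2_sq0.
by rewrite mulr_natl linearMn Ltop.
Qed.

(** beta^n is n! times the product of the omega^l /\ omega^(n+l), and also n! times the product of
    the y_j. *)
Lemma prod_col_top : L (\prod_j y j) = 1.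
Proof.
have := ebeta_top; rewrite ebeta_unitary expr_sum_ord_sq0 => [|l]; last exact: wedge1_sq0.
rewrite mulr_natl linearMn -[LHS]mulr_natl -[RHS]mulr1.
by apply: mulfI; rewrite pnatr_eq0 -lt0n fact_gt0.
Qed.

Variables (d : 'rV[R]_n).
Let M := U *m diag_mx (map_mx qreal d) *m adjq U.

Lemma mx_form_top (z : C) :
  L ((mx_form M + z *: ebeta) ^+ n) = n`!%:R * \prod_j ((d ord0 j)%:C + z).
Proof.
rewrite /M mx_form_diag ebeta_unitary scaler_sumr -big_split/=.
rewrite (eq_bigr (fun j => ((d ord0 j)%:C + z) *: y j)); last first.
  by move=> j _; rewrite scalerDl.
rewrite expr_sum_ord_sq0 => [|j]; last by rewrite exprZn wedge1_sq0 scaler0.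
by rewrite mulr_natl linearMn scaler_prod linearZ/= prod_col_top mulr1 mulr_natl.
Qed.

(** Compare the coefficients of z^(n-m) in L ((tau(M) + z beta)^n) = n! \prod_j (d_j + z). *)
Lemma mx_form_elem_sym m : (m <= n)%N ->
  L (mx_form M ^+ m * ebeta ^+ (n - m)) = (m`! * (n - m)`!)%:R * (elem_sym m d)%:C.
Proof.
move=> mn.
have /polyP/(_ (n - m)%N) : line_poly L n (mx_form M) ebeta =
    n`!%:R *: \prod_(j < n) ((d ord0 j)%:C%:P + 'X).
  apply: poly_ext_nat => k; move: (k%:R : C) => z; rewrite horner_line_poly mx_form_top hornerZ horner_prod.
  by congr (_ * _); apply: eq_bigr => j _; rewrite !hornerE.
rewrite coef_poly ltnS leq_subr coefZ subKn// bin_sub// bigA_distr coef_sum.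
rewrite (eq_bigr (fun J : {set 'I_n} =>
    (#|J| == m)%:R * \prod_(j in J) (d ord0 j)%:C)); last first.
  move=> J _; rewrite (bigID (mem J))/= (eq_bigr (fun i => ((d ord0 i)%:C)%:P)) => [|i ->//].
  rewrite [X in _ * X](eq_bigr (fun=> 'X)) => [|i /negPf ->//].
  rewrite -(big_morph (@polyC C) (@polyCM C) (erefl _)) coefCM mulrC prodr_const coefXn.
  have cJ : (#|J| + #|(fun i => i \notin J)| = n)%N := etrans (cardC _) (card_ord n).
  have cJ' : #|(fun i => i \notin J)| = (n - #|J|)%N by rewrite -[X in (X - _)%N]cJ addKn.
  rewrite [X in (_ == X)%N](_ : _ = (n - #|J|)%N); last exact: cJ'.
  have Jn : (#|J| <= n)%N by rewrite -[X in (_ <= X)%N]cJ leq_addr.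
  suff -> : (n - m == n - #|J|)%N = (#|J| == m) by [].
  by apply/eqP/eqP; lia.
have <- : \sum_(J : {set 'I_n}) (#|J| == m)%:R * \prod_(j in J) (d ord0 j)%:C =
    (elem_sym m d)%:C.
  rewrite /elem_sym rmorph_sum [RHS]big_mkcond/=; apply: eq_bigr => J _.
  by rewrite rmorph_prod; case: eqP => _; rewrite ?mul1r ?mul0r.
rewrite -(bin_fact mn) natrM -mulrA -[X in X = _ -> _]mulr_natl.
by apply: mulfI; rewrite pnatr_eq0 -lt0n bin_gt0.
Qed.

End unitary.

(** The left-hand side does not mention a diagonalization, so all of them have the same e_m and
    [xget] returns it. *)
Lemma hess_op_top (L : {scalar A}) (U : 'M[quat R]_n) (d : 'rV[R]_n) M m :
  L (\prod_(l < n) o2 (lshift n l) (rshift n l)) = 1 -> unitaryq U ->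
  M = U *m diag_mx (map_mx qreal d) *m adjq U -> (m <= n)%N ->
  L (mx_form M ^+ m * ebeta ^+ (n - m)) = (m`! * (n - m)`!)%:R * (hess_op m M)%:C.
Proof.
move=> Ltop Uu -> mn; rewrite (mx_form_elem_sym Uu Ltop _ mn); congr (_ * _%:C).
apply/esym/xget_unique; first by exists U, d.
move=> _ [V [d' [Vu E ->]]]; apply: complexI.
have := mx_form_elem_sym Uu Ltop d mn; rewrite E (mx_form_elem_sym Vu Ltop _ mn).
by apply: mulfI; rewrite pnatr_eq0 -lt0n muln_gt0 !fact_gt0.
Qed.

End two_forms.

Section omega2.
Variables (R : realType) (n : nat).
Local Notation C := R[i].
Local Notation eform := (eform R n).
Implicit Types (a b c d : 'I_(n + n)).

Definition omega2 a b : eform := EForm (omega_form_even R a b).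

Lemma omega2C a b : omega2 a b = - omega2 b a.
Proof. by apply: val_inj; exact: omega_formC. Qed.

Lemma omega2M a b c d : omega2 a b * omega2 c d = - (omega2 c b * omega2 a d).
Proof.
apply: val_inj; rewrite [val (- _)]/= -scaleN1r !eform_valM /=.
rewrite (@anticomm_swap13 _ (@ewedge R n)) ?scaleN1r//.
- exact: ewedgeA.
- exact: ewedgeNl.
- exact: ewedgeNr.
- exact: omega_formC.
- exact: omega_formC.
- exact: omega_formC.
Qed.


End omega2.

(** * The quaternionic spectral theorem *)

Section quaternion_spectral.
Variable R : realType.
Local Notation C := R[i].
Local Notation H := (quat R).
#[local] Arguments conjc : simpl never.

Lemma conjqK : involutive (@conjq R).
Proof. by case=> a b c d; rewrite /conjq/= !opprK. Qed.

Lemma conjqD (x y : H) : conjq (x + y) = conjq x + conjq y.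
Proof. by case: x y => [????] [????]; rewrite /conjq/=; congr Quat => /=; rewrite opprD. Qed.

Lemma conjqM (x y : H) : conjq (x * y) = conjq y * conjq x.
Proof. by case: x y => [????] [????]; congr Quat => /=; ring. Qed.

Lemma conjq_real (r : R) : conjq (qreal r) = qreal r.
Proof. by congr Quat => /=; rewrite oppr0. Qed.

Lemma conjq0 : conjq (0 : H) = 0. Proof. exact: conjq_real. Qed.

Lemma conjq_sum (I : Type) (r : seq I) (P : pred I) (F : I -> H) :
  conjq (\sum_(i <- r | P i) F i) = \sum_(i <- r | P i) conjq (F i).
Proof. exact: (big_morph _ conjqD conjq0). Qed.

Lemma qrealC (r : R) (x : H) : qreal r * x = x * qreal r.
Proof. by case: x => ????; congr Quat => /=; ring. Qed.

Lemma qrealD (r s : R) : qreal (r + s) = qreal r + qreal s :> H.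
Proof. by congr Quat => /=; rewrite addr0. Qed.

Lemma qrealM (r s : R) : qreal (r * s) = qreal r * qreal s :> H.
Proof. by congr Quat => /=; ring. Qed.

Lemma qreal0 : qreal 0 = 0 :> H. Proof. by []. Qed.
Lemma qreal1 : qreal 1 = 1 :> H. Proof. by []. Qed.

Lemma qreal_sum (I : Type) (r : seq I) (P : pred I) (F : I -> R) :
  qreal (\sum_(i <- r | P i) F i) = \sum_(i <- r | P i) qreal (F i) :> H.
Proof. exact: (big_morph _ qrealD qreal0). Qed.

Definition qnorm2 (x : H) : R := qre x ^+ 2 + qi x ^+ 2 + qj x ^+ 2 + qk x ^+ 2.

Lemma qnorm2_ge0 x : 0 <= qnorm2 x.
Proof. by rewrite !addr_ge0 ?sqr_ge0. Qed.

Lemma qnorm2_eq0 x : (qnorm2 x == 0) = (x == 0).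
Proof.
case: x => a b c d; rewrite /qnorm2/= !paddr_eq0 ?addr_ge0 ?sqr_ge0// !sqrf_eq0.
by apply/andP/eqP => [[/andP[/andP[/eqP-> /eqP->] /eqP->] /eqP->]//|[-> -> -> ->]]; rewrite eqxx.
Qed.

Lemma mul_conjq x : conjq x * x = qreal (qnorm2 x).
Proof. by case: x => ????; congr Quat => /=; rewrite /qnorm2/=; ring. Qed.

Lemma mulq_conj x : x * conjq x = qreal (qnorm2 x).
Proof. by case: x => ????; congr Quat => /=; rewrite /qnorm2/=; ring. Qed.

(** [adjq] for rectangular matrices, needed for columns v and products such as v v^* below. *)
Definition adjmx m n (A : 'M[H]_(m, n)) : 'M[H]_(n, m) := map_mx conjq A^T.

Lemma adjqE n (A : 'M[H]_n) : adjq A = adjmx A.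
Proof. by apply/matrixP => i j; rewrite !mxE. Qed.

Lemma adjmxK m n (A : 'M[H]_(m, n)) : adjmx (adjmx A) = A.
Proof. by apply/matrixP => i j; rewrite !mxE conjqK. Qed.

Lemma adjmxM m n p (A : 'M[H]_(m, n)) (B : 'M[H]_(n, p)) :
  adjmx (A *m B) = adjmx B *m adjmx A.
Proof.
apply/matrixP => i j; rewrite !mxE conjq_sum.
by apply: eq_bigr => k _; rewrite conjqM !mxE.
Qed.

Lemma adjmxD m n (A B : 'M[H]_(m, n)) : adjmx (A + B) = adjmx A + adjmx B.
Proof. by apply/matrixP => i j; rewrite !mxE conjqD. Qed.

Lemma adjmxZ m n (r : R) (A : 'M[H]_(m, n)) :
  adjmx (qreal r *: A) = qreal r *: adjmx A.
Proof. by apply/matrixP => i j; rewrite !mxE conjqM conjq_real qrealC. Qed.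

Lemma adjmx_scalar n (x : H) : adjmx (x%:M : 'M[H]_n) = (conjq x)%:M.
Proof.
by apply/matrixP => i j; rewrite !mxE eq_sym; case: eqP => _; rewrite ?mulr0n ?conjq0// mulr1n.
Qed.

Lemma mulmx_scaleq m n p (r : R) (A : 'M[H]_(m, n)) (B : 'M[H]_(n, p)) :
  A *m (qreal r *: B) = qreal r *: (A *m B).
Proof.
apply/matrixP => i j; rewrite !mxE mulr_sumr; apply: eq_bigr => k _.
by rewrite !mxE mulrA -qrealC mulrA.
Qed.

Lemma mulmx_qreal m n (r : R) (A : 'M[H]_(m, n)) :
  A *m (qreal r)%:M = qreal r *: A.
Proof. by rewrite -scalemx1 mulmx_scaleq mulmx1. Qed.

Lemma adjmx_mul_self n (v : 'cV[H]_n) :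
  adjmx v *m v = (qreal (\sum_i qnorm2 (v i ord0)))%:M.
Proof.
apply/matrixP => i j; rewrite !mxE !ord1 eqxx mulr1n qreal_sum.
by apply: eq_bigr => k _; rewrite !mxE mul_conjq.
Qed.

Lemma sum_qnorm2_gt0 n (v : 'cV[H]_n) : v != 0 -> 0 < \sum_i qnorm2 (v i ord0).
Proof.
move=> v0; rewrite lt0r sumr_ge0 ?andbT => [|i _]; last exact: qnorm2_ge0.
apply: contra_neq v0 => N0; apply/matrixP => i j; rewrite ord1 mxE; apply/eqP.
move/psumr_eq0P : N0 => N0; rewrite -qnorm2_eq0; apply/eqP/N0 => // k _.
exact: qnorm2_ge0.
Qed.

Definition quat_of_C (z w : C) : H :=
  Quat (complex.Re z) (complex.Im z) (complex.Re w) (complex.Im w).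

Lemma zq_of_C z w : zq (quat_of_C z w) = z. Proof. by case: z w => ? ? []. Qed.
Lemma wq_of_C z w : wq (quat_of_C z w) = w. Proof. by case: z w => ? ? []. Qed.

Lemma quat_zwP (p q : H) : zq p = zq q -> wq p = wq q -> p = q.
Proof. by case: p q => [????] [????] [-> ->] [-> ->]. Qed.

Lemma zq_sum (I : Type) (r : seq I) (P : pred I) (F : I -> H) :
  zq (\sum_(i <- r | P i) F i) = \sum_(i <- r | P i) zq (F i).
Proof. exact: (big_morph _ (@zqD R) (erefl _)). Qed.

Lemma wq_sum (I : Type) (r : seq I) (P : pred I) (F : I -> H) :
  wq (\sum_(i <- r | P i) F i) = \sum_(i <- r | P i) wq (F i).
Proof. exact: (big_morph _ (@wqD R) (erefl _)). Qed.

(** M acts on C^(2n) by a complex matrix, an eigenvector of which yields M v = v l with l complex on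
    the right. Then v^* M v = |v|^2 l is self-adjoint, so l is real. *)
Lemma hyperhermitian_eigenvector n (M : 'M[H]_n.+1) : hyperhermitian M ->
  exists (v : 'cV[H]_n.+1) (r : R), v != 0 /\ M *m v = qreal r *: v.
Proof.
rewrite /hyperhermitian adjqE => Mh.
pose Z := map_mx (@zq R) M; pose W := map_mx (@wq R) M.
(* Eigenvectors are rows here, so G is the transpose of the matrix of M acting on the pairs (p, s)
   with v = p + conj(s) j. *)
pose G := block_mx Z^T (map_mx conjc W)^T (- W)^T (map_mx conjc Z)^T.
have [l /eigenvalueP[u uG u0]] := @eigenvalue_closed _ _ G isT.
pose p := lsubmx u; pose s := rsubmx u.
have [pE sE] : p *m Z^T + s *m (- W)^T = l *: p /\
    p *m (map_mx conjc W)^T + s *m (map_mx conjc Z)^T = l *: s.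
  by move: uG; rewrite -{1 2}[u]hsubmxK mul_row_block scale_row_mx => /eq_row_mx.
pose v : 'cV[H]_n.+1 := \col_i quat_of_C (p ord0 i) (conjc (s ord0 i)).
have Mv : M *m v = v *m (quat_of_C l 0)%:M.
  apply/matrixP => i j; rewrite ord1 !mxE big_ord1 !mxE eqxx mulr1n.
  apply: quat_zwP; rewrite ?zq_sum ?wq_sum.
    have := congr1 (fun m : 'rV[C]_n.+1 => m ord0 i) pE; rewrite !mxE.
    rewrite zqM !zq_of_C wq_of_C conjc0 mulr0 subr0 mulrC => <-.
    rewrite -big_split; apply: eq_bigr => k _ /=.
    by rewrite !mxE zqM zq_of_C wq_of_C conjcK mulrC; congr (_ + _); ring.
  have := congr1 (fun m : 'rV[C]_n.+1 => conjc (m ord0 i)) sE; rewrite !mxE conjcM => sE'.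
  rewrite wqM !wq_of_C !zq_of_C mulr0 add0r [RHS]mulrC -sE'.
  rewrite conjcD !(rmorph_sum (@conjc R)) -big_split; apply: eq_bigr => k _ /=.
  by rewrite !mxE wqM zq_of_C wq_of_C !conjcM !conjcK; ring.
have v0 : v != 0.
  apply: contra_neq u0 => v0; rewrite -[u]hsubmxK.
  suff [-> ->] : lsubmx u = 0 /\ rsubmx u = 0 by rewrite row_mx0.
  split; apply/rowP => i; have := congr1 (fun m : 'cV[H]_n.+1 => m i ord0) v0; rewrite !mxE.
    by move/(congr1 (@zq R)); rewrite zq_of_C -/p.
  by move/(congr1 (@wq R)); rewrite wq_of_C => /eqP; rewrite conjc_eq0 => /eqP.
exists v, (complex.Re l); split=> //.
suff lr : quat_of_C l 0 = qreal (complex.Re l).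
  rewrite Mv lr; apply/matrixP => i j; rewrite !mxE big_ord1 !mxE !ord1 eqxx mulr1n.
  by rewrite qrealC.
pose N := \sum_i qnorm2 (v i ord0).
have N0 : N != 0 by rewrite gt_eqF// sum_qnorm2_gt0.
have S : adjmx (adjmx v *m (M *m v)) = adjmx v *m (M *m v).
  by rewrite !adjmxM adjmxK Mh mulmxA.
move: S; rewrite Mv mulmxA adjmx_mul_self -/N -scalar_mxM adjmx_scalar => /matrixP/(_ ord0 ord0).
rewrite !mxE eqxx !mulr1n => /(congr1 (@qi R))/= E.
congr Quat; apply/eqP; have : N * complex.Im l == 0 by apply/eqP; lra.
by rewrite mulf_eq0 (negPf N0).
Qed.

(* Multiplying the eigenvector on the right by a unit quaternion makes its    *)
(* first entry a real c <= 0; then |v - e0|^2 = 2 - 2c > 0 and the reflection *)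
(* along v - e0 maps e0 to v.                                                 *)
Lemma unitary_first_column n (v : 'cV[H]_n.+1) : v != 0 ->
  exists (U : 'M[H]_n.+1) (q : H),
    [/\ adjmx U = U, U *m U = 1%:M & U *m delta_mx ord0 ord0 = v *m q%:M].
Proof.
move=> v0.
pose N := \sum_i qnorm2 (v i ord0).
have N0 : 0 < N by exact: sum_qnorm2_gt0.
have [q [c [qN qc c0]]] : exists (q : H) (c : R),
    [/\ qnorm2 q = N^-1, v ord0 ord0 * q = qreal c & c <= 0].
  have [z|z] := eqVneq (v ord0 ord0) 0.
    exists (qreal (Num.sqrt N^-1)), 0; rewrite z mul0r qreal0; split=> //.
    by rewrite /qnorm2/= expr0n/= !addr0 sqr_sqrtr// invr_ge0 ltW.
  pose a := qnorm2 (v ord0 ord0).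
  have a0 : 0 < a by rewrite lt0r qnorm2_eq0 z qnorm2_ge0.
  pose t := - Num.sqrt (N^-1 / a).
  exists (qreal t * conjq (v ord0 ord0)), (t * a); split.
  - have -> : qnorm2 (qreal t * conjq (v ord0 ord0)) = t ^+ 2 * a.
      by rewrite /a /qnorm2/=; ring.
    by rewrite sqrrN sqr_sqrtr ?divr_ge0 ?invr_ge0 ?ltW// divfK// gt_eqF.
  - by rewrite mulrA -qrealC -mulrA mulq_conj -qrealM.
  - by rewrite mulNr oppr_le0 mulr_ge0 ?sqrtr_ge0// ltW.
pose e0 : 'cV[H]_n.+1 := delta_mx ord0 ord0.
pose v' := v *m (q%:M : 'M[H]_1).
have v'v' : adjmx v' *m v' = 1%:M.
  rewrite adjmxM -mulmxA [adjmx v *m _]mulmxA adjmx_mul_self -/N adjmx_scalar -!scalar_mxM.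
  by rewrite mulrA -qrealC -mulrA mul_conjq -qrealM qN divff// gt_eqF.
have e0e0 : adjmx e0 *m e0 = 1%:M.
  rewrite adjmx_mul_self (bigD1 ord0)//= big1 => [|i i0].
    by rewrite mxE/= /qnorm2/= addr0 expr0n expr1n/= !addr0.
  by rewrite mxE (negPf i0) /= /qnorm2/= expr0n/= !addr0.
have v'0 : v' ord0 ord0 = qreal c by rewrite mxE big_ord1 mxE eqxx mulr1n.
have e0v' : adjmx e0 *m v' = (qreal c)%:M.
  apply/matrixP => i j; rewrite !ord1 mxE (bigD1 ord0)//= big1 => [|k k0].
    by rewrite addr0 v'0 !mxE /= -qreal1 conjq_real mul1r.
  by rewrite !mxE (negPf k0) conjq0 mul0r.
have v'e0 : adjmx v' *m e0 = (qreal c)%:M.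
  by rewrite -[LHS]adjmxK adjmxM adjmxK e0v' adjmx_scalar conjq_real.
pose w := v' - e0.
have adjN m' p' (A B : 'M[H]_(m', p')) : adjmx (A - B) = adjmx A - adjmx B.
  by apply/matrixP => i j; rewrite !mxE; case: (A j i) (B j i) => [????] [????]; congr Quat => /=; ring.
have ww : adjmx w *m w = (qreal (2 - 2 * c))%:M.
  rewrite adjN mulmxBl !mulmxBr v'v' e0e0 e0v' v'e0 -!raddfB/=; congr (_%:M).
  by congr Quat => /=; ring.
have we0 : adjmx w *m e0 = (qreal (c - 1))%:M.
  rewrite adjN mulmxBl e0e0 v'e0 -raddfB/=; congr (_%:M).
  by congr Quat => /=; ring.
(* The Householder reflection 1 - 2 w w^* / |w|^2, with |w|^2 = 2 - 2c. *)
pose k := 2 / (2 - 2 * c); have k0 : 2 - 2 * c != 0 by rewrite gt_eqF//; lra.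
pose U := 1%:M - qreal k *: (w *m adjmx w).
exists U, q; split.
- by rewrite /U adjN adjmxZ adjmxM adjmxK adjmx_scalar -qreal1 conjq_real.
- set P := w *m adjmx w.
  have PP : P *m P = qreal (2 - 2 * c) *: P.
    by rewrite /P -mulmxA [adjmx w *m _]mulmxA ww mulmxA mulmx_qreal scalemxAl.
  rewrite /U -/P mulmxBl mul1mx mulmxBr mulmx1 mulmx_scaleq -scalemxAl PP !scalerA -!qrealM.
  have -> : k * k * (2 - 2 * c) = k + k by rewrite /k; field; lra.
  by rewrite qrealD scalerDl opprB addrK subrK.
- rewrite -/e0 -/v' /U mulmxBl mul1mx -scalemxAl -mulmxA we0 mulmx_qreal scalerA -qrealM.
  have -> : k * (c - 1) = -1 by rewrite /k; field; lra.
  rewrite (_ : qreal (-1) = -1 :> H); last by congr Quat; rewrite /= oppr0.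
  by rewrite scaleN1r opprK addrC subrK.
Qed.

Lemma hermitian_block n (M : 'M[H]_(1 + n)) (r : R) : adjmx M = M ->
  (forall i, M i ord0 = qreal r * (i == ord0)%:R) ->
  M = block_mx (qreal r)%:M 0 0 (drsubmx M).
Proof.
move=> Mh M0; rewrite -[LHS]submxK; congr block_mx.
- apply/matrixP => i j; rewrite !ord1 !mxE eqxx mulr1n.
  by have := M0 ord0; rewrite eqxx mulr1 => <-; congr (M _ _); apply: val_inj.
- apply/matrixP => i j; rewrite -Mh !mxE.
  have := M0 (rshift 1 j); rewrite mulr0 => E.
  by rewrite [X in M _ X](_ : _ = ord0) ?E ?conjq0//; apply: val_inj; rewrite /= ord1.
- apply/matrixP => i j; rewrite !mxE.
  have := M0 (rshift 1 i); rewrite mulr0 => E.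
  by rewrite [X in M _ X](_ : _ = ord0) ?E//; apply: val_inj; rewrite /= ord1.
Qed.

(** Deflation: a reflection U sends e0 to a right multiple of an eigenvector, so U M U is block
    diagonal with a real first entry, and the induction hypothesis treats the other block. *)
Lemma hyperhermitian_spectral n (M : 'M[H]_n) : hyperhermitian M ->
  exists (U : 'M[H]_n) (d : 'rV[R]_n),
    unitaryq U /\ M = U *m diag_mx (map_mx qreal d) *m adjq U.
Proof.
elim: n M => [|n IH] M Mh.
  exists 1%:M, 0; split; last by apply/matrixP => -[].
  by split; apply/matrixP => -[].
have [v [r [v0 Mv]]] := hyperhermitian_eigenvector Mh.
have [U [q [Uh UU Ue]]] := unitary_first_column v0.
pose e0 : 'cV[H]_n.+1 := delta_mx ord0 ord0.
pose M' : 'M[H]_(1 + n) := U *m M *m U.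
have M'h : adjmx M' = M' by rewrite /M' !adjmxM Uh -adjqE Mh mulmxA.
have M'e : M' *m e0 = qreal r *: e0.
  rewrite /M' -[_ *m U *m _]mulmxA Ue -mulmxA [M *m _]mulmxA Mv -scalemxAl mulmx_scaleq -Ue.
  by rewrite mulmxA UU mul1mx.
have M'0 i : M' i ord0 = qreal r * (i == ord0)%:R.
  have := congr1 (fun A : 'cV[H]_n.+1 => A i ord0) M'e; rewrite !mxE (bigD1 ord0)//= big1.
    by rewrite !mxE mulr1 addr0 andbT.
  by move=> k k0; rewrite !mxE (negPf k0) mulr0.
pose M1 : 'M[H]_n := drsubmx M'.
have M'E := hermitian_block M'h M'0; rewrite -/M1 in M'E.
have M1h : hyperhermitian M1.
  rewrite /hyperhermitian adjqE; apply/matrixP => i j.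
  by rewrite /M1 -[in RHS]M'h !mxE.
have [U1 [d1 [[U1U U1U'] M1E]]] := IH M1 M1h.
rewrite adjqE in U1U U1U' M1E.
pose V : 'M[H]_(1 + n) := block_mx 1%:M 0 0 U1.
have Vadj : adjmx V = block_mx 1%:M 0 0 (adjmx U1).
  rewrite /adjmx tr_block_mx map_block_mx; congr block_mx.
  - by rewrite -/(adjmx _) adjmx_scalar -qreal1 conjq_real.
  - by apply/matrixP => i j; rewrite !mxE conjq0.
  - by apply/matrixP => i j; rewrite !mxE conjq0.
exists (U *m V), (row_mx r%:M d1 : 'rV[R]_(1 + n)).
rewrite /unitaryq !adjqE adjmxM Uh.
have VV : V *m adjmx V = 1%:M.
  by rewrite Vadj mulmx_block !mulmx0 !mul0mx !mulmx1 !addr0 add0r U1U -scalar_mx_block.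
have V'V : adjmx V *m V = 1%:M.
  by rewrite Vadj mulmx_block !mulmx0 !mul0mx !mulmx1 !addr0 add0r U1U' -scalar_mx_block.
split; first split.
- by rewrite mulmxA -[_ *m V *m _]mulmxA VV mulmx1.
- by rewrite !mulmxA -[_ *m U *m U]mulmxA UU mulmx1.
have -> : M = U *m M' *m U.
  by rewrite /M' !mulmxA UU mul1mx -mulmxA UU mulmx1.
rewrite -!mulmxA; congr (U *m _); rewrite !mulmxA; congr (_ *m U).
rewrite -/M' M'E M1E; apply/esym.
have dE : diag_mx (map_mx qreal (row_mx r%:M d1 : 'rV[R]_(1 + n))) =
    block_mx (qreal r)%:M 0 0 (diag_mx (map_mx qreal d1)) :> 'M[H]_(1 + n).
  rewrite map_row_mx diag_mx_row; congr block_mx.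
  by apply/matrixP => i j; rewrite !ord1 !mxE.
transitivity ((V *m block_mx (qreal r)%:M 0 0 (diag_mx (map_mx qreal d1)) : 'M[H]_(1 + n))
    *m adjmx V); first by rewrite -dE.
by rewrite Vadj !mulmx_block !mulmx0 !mul0mx !mulmx1 !mul1mx !addr0 !add0r mul0mx.
Qed.

End quaternion_spectral.

(** * Mixed products of matrices in the cone *)

Lemma exprD_sq0_pred (A : comNzRingType) (x y : A) (p : nat) : (0 < p)%N ->
  y ^+ 2 = 0 -> (x + y) ^+ p = x ^+ p + p%:R * (y * x ^+ p.-1).
Proof. by case: p => // p _; exact: exprD_sq0. Qed.

(** One eigenvalue is |v|^2 and the others are 0; the last clause is the form in which
    [rank_one_top] uses them. *)
Lemma rank_one_diag (R : realType) n (v : 'cV[quat R]_n) :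
  exists (U : 'M[quat R]_n) (d : 'rV[R]_n), [/\ unitaryq U,
    v *m adjmx v = U *m diag_mx (map_mx qreal d) *m adjq U
    & \prod_j ((d ord0 j)%:C + 1) = 1 + (\sum_i qnorm2 (v i ord0))%:C :> R[i]].
Proof.
have [v0|v0] := eqVneq v 0.
  exists 1%:M, 0; split.
  - by rewrite /unitaryq adjqE adjmx_scalar -qreal1 conjq_real qreal1 !mulmx1.
  - rewrite v0 mul0mx (_ : map_mx _ _ = 0) ?raddf0 ?mulmx0 ?mul0mx//.
    by apply/rowP => i; rewrite !mxE.
  - rewrite !big1 ?addr0// => i _; last by rewrite mxE add0r.
    by rewrite v0 mxE; apply/eqP; rewrite qnorm2_eq0.
case: n v v0 => [|n] v v0; first by case/eqP: v0; apply/matrixP => -[].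
set N := \sum_i _; have N0 : 0 < N by exact: sum_qnorm2_gt0.
have [U [q [Uh UU Ue]]] := unitary_first_column v0.
pose e0 : 'cV[quat R]_n.+1 := delta_mx ord0 ord0.
have e0e0 : adjmx e0 *m e0 = 1%:M.
  rewrite adjmx_mul_self (bigD1 ord0)//= big1 => [|i i0].
    by rewrite mxE/= /qnorm2/= addr0 expr0n expr1n/= !addr0.
  by rewrite mxE (negPf i0) /= /qnorm2/= expr0n/= !addr0.
pose d : 'rV[R]_n.+1 := \row_j (N *+ (j == ord0)).
exists U, d; split.
- by rewrite /unitaryq adjqE Uh.
- have -> : diag_mx (map_mx qreal d) = qreal N *: (e0 *m adjmx e0).
    apply/matrixP => i j; rewrite !mxE big_ord1 !mxE !andbT.
    have [->|ij] := eqVneq i j.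
      by case: (j == ord0); rewrite ?mulr1n ?mulr0n ?mul0r ?mulr0// -qreal1 conjq_real !mulr1.
    have [i0|i0] := eqVneq i ord0; last by rewrite mul0r mulr0.
    by rewrite -i0 eq_sym (negPf ij) conjq0 mulr0 mulr0.
  have Ue' : adjmx e0 *m U = adjmx (U *m e0) by rewrite adjmxM Uh.
  rewrite mulmx_scaleq -scalemxAl adjqE Uh -!mulmxA Ue' mulmxA Ue adjmxM.
  have qN : qreal N * qreal (qnorm2 q) = 1.
    have : adjmx (U *m e0) *m (U *m e0) = 1%:M.
      by rewrite adjmxM Uh -mulmxA [U *m (U *m _)]mulmxA UU mul1mx.
    rewrite Ue adjmxM -mulmxA [adjmx v *m _]mulmxA adjmx_mul_self -/N adjmx_scalar -!scalar_mxM.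
    move=> /matrixP/(_ ord0 ord0); rewrite !mxE eqxx !mulr1n => <-.
    by rewrite -mul_conjq mulrA qrealC mulrA.
  rewrite -mulmxA [q%:M *m _]mulmxA adjmx_scalar -scalar_mxM mulq_conj.
  by rewrite mulmxA mulmx_qreal -scalemxAl scalerA qN scale1r.
- rewrite (bigD1 ord0)//= mxE eqxx mulr1n big1 ?mulr1 1?addrC// => i i0.
  by rewrite mxE (negPf i0) mulr0n add0r.
Qed.

Section mixed_positivity.
Variables (R : realType) (n : nat) (A : comAlgType R[i]).
Local Notation C := R[i].
Local Notation H := (quat R).
Variable o2 : 'I_(n + n) -> 'I_(n + n) -> A.
Hypothesis o2C : forall a b, o2 a b = - o2 b a.
Hypothesis o2M : forall a b c d, o2 a b * o2 c d = - (o2 c b * o2 a d).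
Variable L : {scalar A}.
Hypothesis Ltop : L (\prod_(l < n) o2 (lshift n l) (rshift n l)) = 1.
Implicit Types M : 'M[H]_n.

Local Notation tau := (mx_form o2).
Local Notation beta := (ebeta o2).

Definition herm_form (x : A) := exists2 M, hyperhermitian M & x = tau M.

Lemma hyperhermitianD M M' : hyperhermitian M -> hyperhermitian M' ->
  hyperhermitian (M + M').
Proof. by rewrite /hyperhermitian !adjqE => Mh M'h; rewrite adjmxD Mh M'h. Qed.

Lemma hyperhermitianZ (r : R) M : hyperhermitian M -> hyperhermitian (qreal r *: M).
Proof. by rewrite /hyperhermitian !adjqE => Mh; rewrite adjmxZ Mh. Qed.

Lemma hyperhermitian_scalar (r : R) : hyperhermitian ((qreal r)%:M : 'M[H]_n).
Proof. by rewrite /hyperhermitian adjqE adjmx_scalar conjq_real. Qed.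

Lemma herm_formD x y : herm_form x -> herm_form y -> herm_form (x + y).
Proof.
move=> [M Mh ->] [M' M'h ->]; exists (M + M'); first exact: hyperhermitianD.
by rewrite mx_formD.
Qed.

Lemma herm_formZ (r : R) x : herm_form x -> herm_form (r%:C *: x).
Proof.
move=> [M Mh ->]; exists (qreal r *: M); first exact: hyperhermitianZ.
by rewrite mx_formZ.
Qed.

Lemma herm_form_beta : herm_form beta.
Proof.
by exists 1%:M; [exact: hyperhermitian_scalar|rewrite mx_form1].
Qed.

Lemma tau_hess_op M m : hyperhermitian M -> (m <= n)%N ->
  L (tau M ^+ m * beta ^+ (n - m)) = (m`! * (n - m)`!)%:R * (hess_op m M)%:C.
Proof.
move=> Mh mn; have [U [d [Uu ME]]] := hyperhermitian_spectral Mh.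
exact: (hess_op_top o2C o2M Ltop Uu ME mn).
Qed.

(** On the 2-form x of a hyperhermitian matrix, [beta_scalar m (x ^+ m)] is m! (n-m)! H_m, in the
    shape L (x^m) of the theory of hyperbolic forms. *)
Definition beta_scalar m : {scalar A} := mul_scalar L (beta ^+ (n - m)).

Lemma beta_scalarE m x : beta_scalar m x = L (beta ^+ (n - m) * x).
Proof. by []. Qed.

Lemma real_form_beta m : (m <= n)%N -> real_form herm_form (beta_scalar m) m.
Proof.
move=> mn _ [M Mh ->]; rewrite beta_scalarE mulrC tau_hess_op//.
by rewrite realM ?realn//; apply/complex_realP; eexists.
Qed.

(** For m = n the form is n! \prod_j (d_j + z) with real eigenvalues d_j. Going from m + 1 to m
    differentiates along beta. *)
Lemma hyperbolic_beta m : (m <= n)%N -> hyperbolic herm_form (beta_scalar m) m beta.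
Proof.
move=> mn; have {mn} [k nE] : exists k, n = (k + m)%N by exists (n - m)%N; rewrite subnK.
have E p : (forall x, beta_scalar p x = L (beta ^+ (n - p) * x)) by [].
elim: k m nE => [|k IH] m nE.
  rewrite add0n in nE; rewrite -nE; split => [||x z [M Mh ->] z0]; first exact: herm_form_beta.
    by rewrite E subnn expr0 mul1r (ebeta_top o2M Ltop) ltr0n fact_gt0.
  have [U [d [Uu ->]]] := hyperhermitian_spectral Mh.
  rewrite E subnn expr0 mul1r (mx_form_top o2C o2M Uu Ltop).
  rewrite mulf_neq0 ?pnatr_eq0 -?lt0n ?fact_gt0//; apply/prodf_neq0 => j _.
  by rewrite eq_complex negb_and; apply/orP; right; case: (z) z0 => ? ? /=; rewrite add0r => /gt_eqF ->.
have [|_ Hb Hn] := hyperbolic_deriv herm_formZ (IH m.+1 _); first by rewrite nE addSnnS.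
have nm : (n - m = (n - m.+1).+1)%N by rewrite nE; lia.
have EE x : beta_scalar m x = mul_scalar (beta_scalar m.+1) beta x.
  by rewrite [RHS]/mul_scalar !E nm exprSr mulrA.
split => [||x z Vx z0]; first exact: herm_form_beta.
- by rewrite EE.
- by rewrite EE; exact: Hn.
Qed.

(** Adding t beta to tau(M) amounts to adding t I to M, so the positivity defining Gamma_m is the
    one defining the cone of beta. *)
Lemma hyp_cone_Gamma m M : (m <= n)%N -> Gamma_cone m M ->
  hyp_cone herm_form (beta_scalar m) m beta (tau M).
Proof.
move=> mn [Mh Mpos]; split=> [|t t0]; first by exists M.
have -> : tau M + t%:C *: beta = tau ((qreal t)%:M + M).
  by rewrite mx_formD -scalemx1 mx_formZ mx_form1 addrC.
rewrite beta_scalarE mulrC.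
rewrite tau_hess_op//; last exact/hyperhermitianD/Mh/hyperhermitian_scalar.
by rewrite mulr_gt0 ?ltr0n ?muln_gt0 ?fact_gt0// ltcR Mpos.
Qed.

Lemma mixed_form_gt0 m (s : seq 'M[H]_n) : (m <= n)%N -> size s = m ->
  (forall M, M \in s -> Gamma_cone m M) ->
  0 < L (\prod_(M <- s) tau M * beta ^+ (n - m)).
Proof.
move=> mn sm sG; rewrite mulrC -beta_scalarE -(big_map tau predT id).
apply: (garding herm_formD herm_formZ _ (real_form_beta mn) (hyperbolic_beta mn)).
  by rewrite size_map.
by move=> _ /mapP[M /sG MG ->]; exact: hyp_cone_Gamma.
Qed.

(** Reality passes from m-th powers to mixed products by polarizing in one factor at a time. *)
Lemma mixed_form_real m (s : seq 'M[H]_n) : (m <= n)%N -> size s = m ->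
  (forall M, M \in s -> hyperhermitian M) ->
  L (\prod_(M <- s) tau M * beta ^+ (n - m)) \is Num.real.
Proof.
move=> mn sm sh; rewrite mulrC -beta_scalarE -(big_map tau predT id).
have : real_form herm_form (beta_scalar m) m by exact: real_form_beta.
have : forall x, x \in map tau s -> herm_form x.
  by move=> _ /mapP[M /sh Mh ->]; exists M.
have : size (map tau s) = m by rewrite size_map.
move: (beta_scalar m) => L'; elim: (map tau s) m {mn sm} L' => [|x r IH] m L' /= <- rV Lr.
  by have := Lr _ herm_form_beta; rewrite big_nil expr0.
rewrite big_cons; apply: (IH _ (mul_scalar L' x) erefl).
  by move=> y yr; apply: rV; rewrite in_cons yr orbT.
by apply: real_form_deriv => //; [exact: herm_formD|exact: herm_formZ|apply: rV; rewrite mem_head].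
Qed.

Lemma mx_form_rank_one (v : 'cV[H]_n) :
  tau (v *m adjmx v) = col_form o2 (fun l => v l ord0).
Proof.
rewrite (col_formE o2C); apply: eq_bigr => l _; apply: eq_bigr => k _.
by rewrite !mxE big_ord1 !mxE.
Qed.

(** The 2-form y of the rank one matrix has square 0, so L ((beta + y)^n) = n! + n L (y beta^(n-1));
    its eigenvalues make the same quantity n! (1 + |v|^2). *)
Lemma rank_one_top (v : 'cV[H]_n) :
  n%:R * L (tau (v *m adjmx v) * beta ^+ n.-1) =
  n`!%:R * (\sum_i qnorm2 (v i ord0))%:C.
Proof.
case: (posnP n) => [n0|n0].
  rewrite big_pred0 ?mulr0 => [|i]; last by have := ltn_ord i; rewrite {2}n0.
  by rewrite [X in X * _](_ : _ = 0) ?mul0r// n0.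
set N := \sum_i _.
have y0 : tau (v *m adjmx v) ^+ 2 = 0 by rewrite mx_form_rank_one wedge1_sq0.
suff : L ((beta + tau (v *m adjmx v)) ^+ n) = n`!%:R * (1 + N%:C).
  rewrite (exprD_sq0_pred _ n0 y0) raddfD/= (ebeta_top o2M Ltop).
  set X := tau _ * _; have -> : L (n%:R * X) = n%:R * L X.
    by rewrite mulr_natl linearMn mulr_natl.
  by rewrite mulrDr mulr1 => /addrI.
have [U [d [Uu ME dE]]] := rank_one_diag v.
rewrite -/N in dE.
by rewrite addrC -[beta]scale1r ME (mx_form_top o2C o2M Uu Ltop) dE.
Qed.

(** The 2-form of the rank one part has square 0, so the m-th power has two terms; [rank_one_top]
    evaluates the second. *)
Lemma hess_op_rank_one m (v : 'cV[H]_n) (al b : R) : (0 < m)%N -> (m <= n)%N ->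
  hess_op m (qreal al *: 1%:M + qreal b *: (v *m adjmx v)) =
  'C(n, m)%:R * al ^+ m +
  'C(n.-1, m.-1)%:R * al ^+ m.-1 * b * \sum_i qnorm2 (v i ord0).
Proof.
move=> m0 mn; set N := \sum_i _; set M := _ + _.
have Mh : hyperhermitian M.
  apply: hyperhermitianD; apply: hyperhermitianZ; first exact: hyperhermitian_scalar.
  by rewrite /hyperhermitian adjqE adjmxM adjmxK.
have n0 : (0 < n)%N by exact: leq_trans mn.
apply: complexI; have := tau_hess_op Mh mn.
rewrite mx_formD !mx_formZ mx_form1.
have y0 : (b%:C *: tau (v *m adjmx v)) ^+ 2 = 0.
  by rewrite exprZn mx_form_rank_one (wedge1_sq0 o2M) scaler0.
rewrite (exprD_sq0_pred _ m0 y0) mulrDl raddfD/= !exprZn.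
rewrite -scalerAl linearZ/= -exprD subnKC// (ebeta_top o2M Ltop).
have -> : m%:R * (b%:C *: tau (v *m adjmx v) * (al%:C ^+ m.-1 *: beta ^+ m.-1)) * beta ^+ (n - m) =
    (m%:R * b%:C * al%:C ^+ m.-1) *: (tau (v *m adjmx v) * beta ^+ n.-1).
  have -> : n.-1 = (m.-1 + (n - m))%N by lia.
  have mE (x : A) : m%:R * x = (m%:R : C) *: x by rewrite mulr_natl scaler_nat.
  rewrite exprD; set T := tau _; move: T (beta ^+ m.-1) (beta ^+ (n - m)) => T B B'.
  by rewrite mE -!scalerAl -scalerAr -scalerAl !scalerA mulrA.
rewrite linearZ/= => E.
have nz (k : nat) : k`!%:R != 0 :> C by rewrite pnatr_eq0 -lt0n fact_gt0.
have nn : n%:R != 0 :> C by rewrite pnatr_eq0 -lt0n.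
have XE : L (tau (v *m adjmx v) * beta ^+ n.-1) = n.-1`!%:R * N%:C.
  apply: (mulfI nn); rewrite rank_one_top -/N -{1}(prednK n0) factS prednK//.
  by rewrite natrM mulrA.
have F : (m * n.-1`! = 'C(n.-1, m.-1) * (m`! * (n - m)`!))%N.
  have mn' : (m.-1 <= n.-1)%N by lia.
  have mF : (m`! = m * m.-1`!)%N by rewrite -{1}(prednK m0) factS prednK.
  rewrite -(bin_fact mn') mF.
  have -> : (n.-1 - m.-1 = n - m)%N by lia.
  by rewrite mulnCA -!mulnA.
have M0 : (m`! * (n - m)`!)%:R != 0 :> C by rewrite natrM mulf_neq0.
apply: (mulfI M0); rewrite -E XE -(bin_fact mn) -/N.
rewrite rmorphD !rmorphM !rmorphXn !rmorph_nat /= mulrDr; congr (_ + _).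
  by ring.
have := congr1 (fun k => k%:R : C) F; rewrite /= !natrM => F'.
have -> : m%:R * b%:C * al%:C ^+ m.-1 * (n.-1`!%:R * N%:C) =
  (m%:R * n.-1`!%:R) * (b%:C * al%:C ^+ m.-1 * N%:C) by ring.
by rewrite F'; ring.
Qed.

End mixed_positivity.

Section top_degree.
Variables (R : realType) (n : nat).
Local Notation C := R[i].
Local Notation eform := (eform R n).
Local Notation form := (Defs.form R n).
Local Notation o2 := (@omega2 R n).

Definition index_of (a : 'I_(n + n)) : 'I_n :=
  match fintype.split a with inl l => l | inr l => l end.

Lemma index_lshift l : index_of (lshift n l) = l.
Proof. by rewrite /index_of split_lshift. Qed.

Lemma index_rshift l : index_of (rshift n l) = l.
Proof. by rewrite /index_of split_rshift. Qed.

Definition index_set (r : seq 'I_n) : {set 'I_(n + n)} := [set a | index_of a \in r]%SET.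

Lemma ewedge_basis_disjoint (I J : {set 'I_(n + n)}) : [disjoint I & J]%B ->
  exists2 c : C, c != 0 & ewedge_basis I J = c *: form_basis (I :|: J)%SET :> form.
Proof.
move=> IJ; exists ((-1) ^+ inversions I J); first by rewrite signr_eq0.
by rewrite /ewedge_basis IJ.
Qed.

(** A further pair omega^l /\ omega^(n+l) meets no index already present, so every partial product
    is a nonzero multiple of a basis form. *)
Lemma Omega2n_index (r : seq 'I_n) : uniq r ->
  exists2 c : C, c != 0 &
  \big[ewedge/form1]_(l <- r) ewedge (omega_form (lshift n l)) (omega_form (rshift n l)) =
  c *: form_basis (index_set r) :> form.
Proof.
elim: r => [|l r IH] /=.
  have -> : index_set [::] = finset.set0 by apply/finset.setP => a; rewrite !inE.
  by move=> _; exists 1; rewrite ?oner_eq0// big_nil scale1r.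
move=> /andP[lr /IH[c c0 E]]; rewrite big_cons E.
have [|c1 c10 E1] := @ewedge_basis_disjoint [set lshift n l]%SET [set rshift n l]%SET.
  by rewrite disjoints1 inE -val_eqE/=; apply/eqP => E'; have := ltn_ord l; lia.
rewrite ewedgeZr ewedge_form_basis E1 ewedgeZl ewedge_form_basis.
have [|c2 c20 E2] := @ewedge_basis_disjoint
    ([set lshift n l] :|: [set rshift n l])%SET (index_set r).
  rewrite disjoint_setUl !disjoints1 !inE index_lshift index_rshift.
  by rewrite (negPf lr).
exists (c * (c1 * c2)); first by rewrite !mulf_neq0.
rewrite E2 !scalerA -mulrA.
suff -> : index_set (l :: r) = ([set lshift n l] :|: [set rshift n l] :|: index_set r)%SET by [].
apply/finset.setP => a; rewrite !inE; congr (_ || _); apply/esym.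
rewrite /index_of; case: fintype.splitP => j aj; rewrite -!val_eqE/= aj.
  by have := ltn_ord j; have := ltn_ord l; case: eqP; case: eqP; lia.
by have := ltn_ord j; have := ltn_ord l; case: eqP; case: eqP; case: eqP; lia.
Qed.

Lemma Omega2n_neq0 : (Omega2n : form) [set: 'I_(n + n)]%SET != 0.
Proof.
have [c c0 E] := Omega2n_index (index_enum_uniq 'I_n).
have eT : index_set (index_enum 'I_n) = [set: 'I_(n + n)]%SET.
  by apply/finset.setP => a; rewrite !inE mem_index_enum.
by rewrite /Omega2n E eT ffunE form_basisE eqxx /GRing.scale/= mulr1.
Qed.

Definition top_form (x : eform) : C := top_coef (val x).

Lemma top_form_is_scalar : scalar top_form.
Proof. by move=> z x y; rewrite /top_form /top_coef !ffunE /= mulrDl -mulrA. Qed.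

HB.instance Definition _ := GRing.isLinear.Build C eform C *%R top_form
  top_form_is_scalar.

Lemma top_form_Omega :
  top_form (\prod_(l < n) o2 (lshift n l) (rshift n l)) = 1.
Proof.
by rewrite /top_form eform_prod /top_coef -/(Omega2n) divff// Omega2n_neq0.
Qed.

Lemma val_ebeta : val (ebeta o2) = beta_form.
Proof. exact: (raddf_sum (val : eform -> form)). Qed.

Lemma val_ebetaX k : val (ebeta o2 ^+ k) = \big[ewedge/form1]_(i < k) beta_form.
Proof. by rewrite -val_ebeta -(eform_prod _ _ (fun=> ebeta o2)) prodr_const card_ord. Qed.

Definition mixed_top m (x : 'I_m.-1 -> eform) (y : eform) : C :=
  top_form (\prod_i x i * (ebeta o2 ^+ (n - m) * y)).

Lemma mixed_top_coef m (x : 'I_m.-1 -> eform) (y : eform) :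
  top_coef (ewedge (\big[ewedge/form1]_(i < m.-1) val (x i))
     (ewedge (\big[ewedge/form1]_(i < n - m) beta_form) (val y))) = mixed_top x y.
Proof. by rewrite /mixed_top /top_form !eform_valM eform_prod val_ebetaX. Qed.

Lemma mixed_top_seq m (M : 'I_m.-1 -> 'M[quat R]_n) (M' : 'M[quat R]_n) :
  mixed_top (fun i => mx_form o2 (M i)) (mx_form o2 M') =
  top_form (\prod_(N <- M' :: [seq M i | i <- index_enum 'I_m.-1]) mx_form o2 N *
            ebeta o2 ^+ (n - m)).
Proof. by rewrite /mixed_top big_cons big_map; congr top_form; rewrite mulrA mulrC mulrA. Qed.

Lemma mixed_top_gt0 m (M : 'I_m.-1 -> 'M[quat R]_n) (M' : 'M[quat R]_n) :
  (0 < m)%N -> (m <= n)%N -> (forall i, Gamma_cone m (M i)) -> Gamma_cone m M' ->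
  0 < mixed_top (fun i => mx_form o2 (M i)) (mx_form o2 M').
Proof.
move=> m0 mn HM HM'; rewrite mixed_top_seq.
apply: (mixed_form_gt0 (@omega2C R n) (@omega2M R n) top_form_Omega mn).
  by rewrite /= size_map -[index_enum _]enumT size_enum_ord prednK.
by move=> N; rewrite in_cons => /orP[/eqP->//|/mapP[i _ ->]].
Qed.

Lemma mixed_top_real m (M : 'I_m.-1 -> 'M[quat R]_n) (M' : 'M[quat R]_n) :
  (0 < m)%N -> (m <= n)%N -> (forall i, hyperhermitian (M i)) -> hyperhermitian M' ->
  mixed_top (fun i => mx_form o2 (M i)) (mx_form o2 M') \is Num.real.
Proof.
move=> m0 mn HM HM'; rewrite mixed_top_seq.
apply: (mixed_form_real (@omega2C R n) (@omega2M R n) top_form_Omega mn).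
  by rewrite /= size_map -[index_enum _]enumT size_enum_ord prednK.
by move=> N; rewrite in_cons => /orP[/eqP->//|/mapP[i _ ->]].
Qed.

Lemma hess_op_scalar_rank_one m (v : 'cV[quat R]_n) (al b : R) :
  (0 < m)%N -> (m <= n)%N ->
  hess_op m (qreal al *: 1%:M + qreal b *: (v *m adjmx v)) =
  'C(n, m)%:R * al ^+ m +
  'C(n.-1, m.-1)%:R * al ^+ m.-1 * b * \sum_i qnorm2 (v i ord0).
Proof. exact: (hess_op_rank_one (@omega2C R n) (@omega2M R n) top_form_Omega). Qed.

End top_degree.

(** * Integration over R^N *)

Section one_variable_integrals.
Variable R : realType.
Local Notation mu := (@lebesgue_measure R).
Implicit Types (s t x b : R) (k : nat).

(** The antiderivative of t^k exp(-s t) obtained by integrating by parts k times. *)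
Fixpoint gamma_prim s k t : R :=
  if k is k'.+1 then - (t ^+ k * expR (- (s * t))) / s + k%:R / s * gamma_prim s k' t
  else - expR (- (s * t)) / s.

Lemma is_derive_expRN s t :
  is_derive t 1 (fun x : R => expR (- (s * x))) (- s * expR (- (s * t))).
Proof.
have -> : (fun x : R => expR (- (s * x))) = expR \o (fun x => - s * x).
  by apply/funext => x /=; rewrite mulNr.
apply: is_derive_eq.
by rewrite /= /GRing.scale/= mulr1 mulNr mulrC.
Qed.

Lemma is_derive_gamma_prim s k t : s != 0 ->
  is_derive t 1 (gamma_prim s k) (t ^+ k * expR (- (s * t))).
Proof.
move=> s0; elim: k => [|k IH].
  have -> : gamma_prim s 0 = (fun x => - s^-1 * expR (- (s * x))).
    by apply/funext => x /=; rewrite !mulNr mulrC.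
  have D := is_derive_expRN s t.
  apply: is_derive_eq.
  by rewrite expr0 mul1r /GRing.scale/= mulNr mulrA mulrN mulVf// mulN1r opprK.
have D := is_derive_expRN s t.
have -> : gamma_prim s k.+1 = (fun x : R => - s^-1 * (x ^+ k.+1 * expR (- (s * x)))
    + k.+1%:R / s * gamma_prim s k x).
  by apply/funext => x /=; rewrite !mulNr mulrC.
move: (gamma_prim s k) IH => g IH.
have DX : is_derive t 1 (fun x : R => x ^+ k.+1) (k.+1%:R * t ^+ k).
  have -> : (fun x : R => x ^+ k.+1) = id ^+ k.+1 by apply/funext => x; rewrite exprfctE.
  apply: is_derive_eq.
  by rewrite /GRing.scale/= mulr1.
apply: is_derive_eq.
by rewrite /= /GRing.scale/= exprS; field.
Qed.

Lemma gamma_prim0 s k : gamma_prim s k 0 = - (k`!%:R / s ^+ k.+1).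
Proof.
elim: k => [|k IH] /=; first by rewrite mulr0 oppr0 expR0 expr1 fact0 mulNr.
rewrite IH exprS mul0r mul0r oppr0 mul0r add0r factS natrM [in RHS]exprS invfM; ring.
Qed.

Lemma expRN_pow_cvg0 s k : 0 < s -> t ^+ k * expR (- (s * t)) @[t --> +oo] --> (0 : R).
Proof.
move=> s0; pose K := (k.+1%:R / s) ^+ k.+1.
have bound t : 0 < t -> 0 <= t ^+ k * expR (- (s * t)) <= K * t^-1.
  move=> t0; rewrite mulr_ge0 ?exprn_ge0 ?expR_ge0 ?(ltW t0)//=.
  rewrite ler_pdivlMr// mulrAC -exprSr expRN ler_pdivrMr ?expR_gt0//.
  (* Splitting exp(s t) into k + 1 equal factors and using exp y >= 1 + y gives exp(s t) >= (s t /
     (k+1))^(k+1). *)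
  have -> : s * t = (s * t / k.+1%:R) *+ k.+1 by rewrite -mulr_natr divfK// pnatr_eq0.
  have st0 : 0 < s * t / k.+1%:R by rewrite divr_gt0 ?mulr_gt0.
  rewrite -[_ *+ k.+1]mulr_natl expRM_natl -exprMn lerXn2r ?nnegrE ?mulr_ge0 ?expR_ge0 ?invr_ge0 ?(ltW s0) ?(ltW t0)//.
  rewrite -ler_pdivrMl ?divr_gt0//.
  apply: le_trans (expR_ge1Dx _); rewrite invf_div.
  have -> : s / k.+1%:R * t = s * t / k.+1%:R by rewrite mulrAC.
  by rewrite lerDr.
apply: (@squeeze_cvgr _ _ _ _ (fun=> 0) (fun t => K * t^-1)).
- near=> t; apply: bound; near: t; exact: nbhs_pinfty_gt.
- exact: cvg_cst.
- rewrite -[X in _ --> X](mulr0 K); apply: cvgM; first exact: cvg_cst.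
  by apply/gtr0_cvgV0; [exact: nbhs_pinfty_gt|exact: cvg_id].
Unshelve. all: end_near. Qed.

Lemma gamma_prim_cvg0 s k : 0 < s -> gamma_prim s k t @[t --> +oo] --> (0 : R).
Proof.
move=> s0; elim: k => [|k IH].
  have -> : gamma_prim s 0 = (fun t => - s^-1 * (t ^+ 0 * expR (- (s * t)))).
    by apply/funext => x /=; rewrite expr0 mul1r !mulNr mulrC.
  rewrite -[X in _ --> X](mulr0 (- s^-1)).
  by apply: cvgM; [exact: cvg_cst|exact: expRN_pow_cvg0].
have -> : gamma_prim s k.+1 = (fun x : R => - s^-1 * (x ^+ k.+1 * expR (- (s * x)))
    + k.+1%:R / s * gamma_prim s k x).
  by apply/funext => x /=; rewrite !mulNr mulrC.
rewrite -[X in _ --> X](addr0 0); apply: cvgD.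
  rewrite -[X in _ --> X](mulr0 (- s^-1)).
  by apply: cvgM; [exact: cvg_cst|exact: expRN_pow_cvg0].
rewrite -[X in _ --> X](mulr0 (k.+1%:R / s)).
by apply: cvgM; [exact: cvg_cst|exact: IH].
Qed.

Lemma integral_gamma s k : 0 < s ->
  (\int[mu]_(t in `[0%R, +oo[) (t ^+ k * expR (- (s * t)))%:E = (k`!%:R / s ^+ k.+1)%:E)%E.
Proof.
move=> s0; have s0' : s != 0 by rewrite gt_eqF.
have cF : continuous (gamma_prim s k).
  move=> t; apply: differentiable_continuous; apply/derivable1_diffP.
  by have [] := is_derive_gamma_prim k t s0'.
rewrite (@ge0_continuous_FTC2y R _ (gamma_prim s k) 0 0).
- by rewrite gamma_prim0 sub0e -EFinN opprK.
- by move=> t t0; rewrite mulr_ge0 ?exprn_ge0 ?expR_ge0.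
- apply: continuous_subspaceT => t; apply: cvgM; first exact: exprn_continuous.
  apply: (cvg_comp _ expR); last exact: continuous_expR.
  by apply: cvgN; apply: cvgM; [exact: cvg_cst|exact: cvg_id].
- exact: gamma_prim_cvg0.
- by move=> t _; have [] := is_derive_gamma_prim k t s0'.
- exact/cvg_at_right_filter/cF.
- by move=> t _; rewrite derive1E; have [_ ->] := is_derive_gamma_prim k t s0'.
Qed.

Lemma integral_invSsqr :
  (\int[mu]_(t in `[0%R, +oo[) ((1 + t) ^- 2)%:E = 1)%E.
Proof.
pose F t : R := - (1 + t)^-1.
have dF t : 0 <= t -> is_derive t 1 F ((1 + t) ^- 2).
  move=> t0; have t1 : 1 + t != 0 by rewrite gt_eqF//; lra.
  apply: is_derive_eq.
  by rewrite add0r /GRing.scale/= mulr1 opprK.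
rewrite (@ge0_continuous_FTC2y R _ F 0 0).
- by rewrite /F addr0 invr1 sub0e -EFinN opprK.
- by move=> t t0; rewrite invr_ge0 exprn_ge0//; lra.
- apply/continuous_in_subspaceT => t; rewrite inE/= in_itv/= andbT => t0.
  have t1 : 1 + t != 0 by rewrite gt_eqF//; lra.
  under eq_fun do rewrite -exprVn.
  apply: (cvg_comp _ (fun x => x ^+ 2)); last exact: exprn_continuous.
  by apply: cvgV => //; apply: cvgD; [exact: cvg_cst|exact: cvg_id].
- rewrite -oppr0; apply: cvgN; apply/gtr0_cvgV0.
    by near=> t; have : 0 < t by [near: t; exact: nbhs_pinfty_gt]; lra.
  exact: cvg_addrl.
- by move=> t t0; have [] := dF t (ltW t0).
- apply: cvg_at_right_filter; apply: differentiable_continuous.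
  by apply/derivable1_diffP; have [] := dF 0 (lexx 0).
- by move=> t; rewrite in_itv/= andbT => t0; rewrite derive1E; have [_ ->] := dF t (ltW t0).
Unshelve. all: end_near. Qed.

Lemma integral_gaussian s b : 0 < s ->
  (\int[mu]_x (expR (- (s * (x - b) ^+ 2)))%:E = (Num.sqrt (pi / s))%:E)%E.
Proof.
(* The integrand is a multiple of the normal density with mean b and variance 1 / (2 s). *)
move=> s0; pose sg : R := Num.sqrt ((2 * s)^-1).
have sg2 : sg ^+ 2 = (2 * s)^-1 by rewrite sqr_sqrtr// invr_ge0 mulr_ge0// ltW.
have sg0 : sg != 0 by rewrite gt_eqF// sqrtr_gt0 invr_gt0 mulr_gt0.
have pk0 := normal_peak_gt0 sg0.
have E x : expR (- (s * (x - b) ^+ 2)) = (normal_peak sg)^-1 * normal_pdf b sg x.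
  rewrite normal_pdfE// mulKf ?gt_eqF// /normal_fun; congr expR.
  by rewrite -[_ *+ 2]mulr_natl sg2; field; lra.
under eq_integral do rewrite E EFinM.
rewrite integralZl//; last exact: integrable_normal_pdf.
rewrite integral_normal_pdf mule1 /normal_peak invrK; congr (_%:E); congr Num.sqrt.
by rewrite -[_ *+ 2]mulr_natl sg2; field; lra.
Qed.

End one_variable_integrals.

(** * Measurability and iterated integrals on R^N *)

Section rV_integration.
Variable R : realType.
Implicit Types N : nat.

(** The sigma-algebra is generated by the coordinates, so U is written as a countable union of cubes
    with rational centres. *)
Lemma open_rV_measurable N (U : set 'rV[R]_N) : open U -> measurable U.
Proof.
move=> oU.
pose B (p : 'rV[rat]_N * nat) : set 'rV[R]_N :=
  [set y | forall i, `|y ord0 i - ratr (p.1 ord0 i)| < p.2.+1%:R^-1].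
have mB p : measurable (B p).
  have -> : B p = \bigcap_(i in [set: 'I_N])
      ((fun x : 'rV[R]_N => x ord0 i : measurableTypeR R) @^-1`
         `]ratr (p.1 ord0 i) - p.2.+1%:R^-1, ratr (p.1 ord0 i) + p.2.+1%:R^-1[%classic).
    apply/seteqP; split => y /= H i; [move=> _|].
      by rewrite /= in_itv/= -ltr_distl; exact: H.
    by have := H i I; rewrite /= in_itv/= -ltr_distl.
  apply: fin_bigcap_measurable => [|i _]; first exact: finite_finset.
  rewrite -[X in measurable X]setTI; exact: measurable_rV_coord.
have -> : U = \bigcup_p (if `[< B p `<=` U >] then B p else set0).
  apply/seteqP; split => [x Ux|x [p _]]; last by case: asboolP => // BU /BU.
  have /nbhs_ballP[e /= e0 eU] : nbhs x U by exact: open_nbhs_nbhs.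
  (* Two points of a cube of half-side 1 / (k+1) differ by less than 2 / (k+1) < e in each
     coordinate. *)
  pose k := Num.trunc (2 / e).
  have ke : 2 / (k.+1)%:R < e.
    rewrite ltr_pdivrMr// mulrC -ltr_pdivrMr//.
    by have := @truncnS_gt _ (2 / e); rewrite -/k.
  have rx (i : 'I_N) : exists q : rat, `|x ord0 i - ratr q| < k.+1%:R^-1.
    have xk : x ord0 i - k.+1%:R^-1 < x ord0 i + k.+1%:R^-1.
      by rewrite ltrBlDr -addrA ltrDl addr_gt0 ?invr_gt0.
    have [q] := rat_in_itvoo xk; rewrite in_itv/= => /andP[q1 q2].
    by exists q; rewrite distrC ltr_distl q1 q2.
  pose q : 'rV[rat]_N := \row_i projT1 (cid (rx i)).
  exists (q, k) => //; have Bx : B (q, k) x.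
    by move=> i /=; rewrite mxE; exact: (projT2 (cid (rx i))).
  case: asboolP => // -[] y By; apply: eU; split=> // i j; rewrite ord1.
  have := By j; have := Bx j => /=; set r := ratr _ => A C.
  rewrite /ball/=; have -> : x ord0 j - y ord0 j = (x ord0 j - r) - (y ord0 j - r) by ring.
  apply: le_lt_trans (ler_normB _ _) _.
  apply: lt_trans ke; rewrite -[2]/(1 + 1) mulrDl mul1r.
  exact: ltrD.
apply: countable_bigcupT_measurable => [|p]; first exact: countableP.
by case: ifP.
Qed.

Lemma continuous_rV_measurable N (f : 'rV[R]_N -> R) :
  continuous f -> measurable_fun setT f.
Proof.
move=> cf; apply: (measurability _ (RGenOpens.measurableE R)).
move=> _ [_ [a [b ->]] <-]; rewrite setTI; apply: open_rV_measurable.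
by move/continuousP : cf; apply; exact: interval_open.
Qed.

Lemma closed_rV_measurable N (U : set 'rV[R]_N) : closed U -> measurable U.
Proof.
move=> /closed_openC oU; rewrite -[U]setCK; apply: measurableC.
exact: open_rV_measurable.
Qed.

Local Open Scope ereal_scope.
Local Notation mu := (@lebesgue_measure R).
Local Notation leb := (lebesgue_rV R).

Lemma ge0_integral_rV_prod N (f : 'rV[R]_N.+1 -> \bar R) :
  measurable_fun setT f -> (forall x, 0 <= f x) ->
  \int[leb N.+1]_x f x = \int[mu \x leb N]_p f (rV_cons p).
Proof.
move=> mf f0.
exact: (@ge0_integral_pushforward _ _ _ _ R (@rV_cons R N) (@measurable_rV_cons R N)
  (mu \x leb N) setT f measurableT mf (fun y _ => f0 y)).
Qed.

Lemma ge0_integral_rV_cons N (f : 'rV[R]_N.+1 -> \bar R) :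
  measurable_fun setT f -> (forall x, 0 <= f x) ->
  \int[leb N.+1]_x f x = \int[mu]_x \int[leb N]_y f (rV_cons (x, y)).
Proof.
move=> mf f0; rewrite ge0_integral_rV_prod// fubini_tonelli1//.
by apply: measurableT_comp => //; exact: measurable_rV_cons.
Qed.

Lemma integrable_rV_prod N (f : 'rV[R]_N.+1 -> \bar R) :
  (leb N.+1).-integrable setT f ->
  (mu \x leb N).-integrable setT (f \o rV_cons).
Proof.
move=> /integrableP[mf fi]; apply/integrableP; split.
  by apply: measurableT_comp => //; exact: measurable_rV_cons.
rewrite -(ge0_integral_rV_prod (f := fun x => `|f x|))//.
exact: measurableT_comp.
Qed.

Lemma integral_rV_prod N (f : 'rV[R]_N.+1 -> \bar R) :
  (leb N.+1).-integrable setT f ->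
  \int[leb N.+1]_x f x = \int[mu \x leb N]_p f (rV_cons p).
Proof.
move=> fi; have mf := measurable_int _ fi.
exact: (@integral_pushforward _ _ _ _ R (@rV_cons R N) (@measurable_rV_cons R N)
  (mu \x leb N) setT f mf (integrable_rV_prod fi) measurableT).
Qed.

Lemma integral_rV_cons12 N (f : 'rV[R]_N.+1 -> \bar R) :
  (leb N.+1).-integrable setT f ->
  \int[leb N.+1]_x f x = \int[mu]_x \int[leb N]_y f (rV_cons (x, y)).
Proof.
by move=> fi; rewrite integral_rV_prod// -(integral12_prod_meas1 (integrable_rV_prod fi)).
Qed.

Lemma integral_rV_cons21 N (f : 'rV[R]_N.+1 -> \bar R) :
  (leb N.+1).-integrable setT f ->
  \int[leb N.+1]_x f x = \int[leb N]_y \int[mu]_x f (rV_cons (x, y)).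
Proof.
by move=> fi; rewrite integral_rV_prod// -(integral21_prod_meas1 (integrable_rV_prod fi)).
Qed.

Definition rbox N (M : R) : set 'rV[R]_N := [set x | forall i, (`|x ord0 i| <= M)%R].

#[global] Arguments rbox : clear implicits.

Lemma measurable_rbox N M : measurable (rbox N M).
Proof.
have -> : rbox N M = \bigcap_(i in [set: 'I_N])
    ((fun x : 'rV[R]_N => x ord0 i : measurableTypeR R) @^-1` `[(- M)%R, M]).
  apply/seteqP; split => y /= H i; [move=> _|].
    by rewrite /= in_itv/= -ler_norml; exact: H.
  by have := H i I; rewrite /= in_itv/= -ler_norml.
apply: fin_bigcap_measurable => [|i _]; first exact: finite_finset.
by rewrite -[X in measurable X]setTI; apply: measurable_rV_coord.
Qed.

Lemma rbox_lty N M : leb N (rbox N M) < +oo.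
Proof.
elim: N => [|N IH].
  by rewrite /= /rV_dirac0; apply: le_lt_trans (ltry 1); rewrite diracE lee_fin; case: (_ \in _).
rewrite /= /rV_prod /pushforward.
have -> : rV_cons @^-1` (rbox N.+1 M) = `[(- M)%R, M]%classic `*` (rbox N M) :> set (measurableTypeR R * 'rV[R]_N).
  apply/seteqP; split => -[x y] /=.
    move=> H; split => /=; first by have := H ord0; rewrite rV_cons0 in_itv/= -ler_norml.
    by move=> i; have := H (lift ord0 i); rewrite mxE liftK.
  rewrite in_itv/= -ler_norml => -[xM H] i; case: (unliftP ord0 i) => [j ->|->].
    by rewrite mxE liftK.
  by rewrite rV_cons0.
rewrite product_measure1E//; last exact: measurable_rbox.
have itv_lty : mu `[(- M)%R, M]%classic < +oo.
  by rewrite lebesgue_measure_itv/=; case: ifP => // _; exact: ltry.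
apply: lte_mul_pinfty => //.
by rewrite ge0_fin_numE.
Qed.

Lemma bounded_supp_integrable N (f : 'rV[R]_N -> R) (B M : R) :
  measurable_fun setT f -> (forall x, `|f x| <= B)%R ->
  (forall x, f x != 0%R -> rbox N M x) -> (leb N).-integrable setT (EFin \o f).
Proof.
move=> mf fB fM; pose x0 : 'rV[R]_N := const_mx 0%R.
have B0 : (0 <= B)%R by rewrite (le_trans _ (fB x0)).
apply/integrableP.
split.
by move/measurable_EFinP : mf.
have mbox : measurable_fun setT (EFin \o (\1_(rbox N M) : 'rV[R]_N -> R)).
  by apply/measurable_EFinP; apply: measurable_indic; exact: measurable_rbox.

apply: (@le_lt_trans _ _ (\int[leb N]_x (B%:E * (\1_(rbox N M) x)%:E))).
  apply: ge0_le_integral => //.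
  - by apply/measurable_EFinP; exact: measurableT_comp.
  - exact: measurable_funeM.
  - move=> x _; rewrite /= -EFinM lee_fin indicE.
    have [fx|/fM xM] := eqVneq (f x) 0%R.
      by rewrite fx normr0 mulr_ge0.
    by rewrite mem_set// mulr1.
rewrite ge0_integralZl// integral_indic//; last exact: measurable_rbox.
by rewrite setIT lte_mul_pinfty// ?rbox_lty// lee_fin.
Qed.

Lemma compact_rbox N (K : set 'rV[R]_N) : compact K -> exists M : R, K `<=` rbox N M.
Proof.
move=> /compact_bounded[M [_ MK]]; exists (M + 1)%R => x Kx i.
have := MK (M + 1)%R ltac:(by rewrite ltrDl) x Kx; apply: le_trans.
by rewrite [leRHS]mx_normrE; apply: (le_bigmax _ (fun ij => `|x ij.1 ij.2|%R) (ord0, i)).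
Qed.

End rV_integration.

(** * Powers of the distance as superpositions of Gaussians *)

Section potentials.
Variable R : realType.
Implicit Types (N k : nat) (s t e w : R).
Local Open Scope ereal_scope.
Local Notation mu := (@lebesgue_measure R).
Local Notation leb := (lebesgue_rV R).

Lemma sqrtX4 n (x : R) : (0 <= x)%R -> (Num.sqrt x ^+ (4 * n) = x ^+ (2 * n))%R.
Proof. by move=> x0; rewrite -[4%N]/(2 * 2)%N -mulnA exprM sqr_sqrtr. Qed.

Definition sqdist N (x a : 'rV[R]_N) : R := (\sum_i (x ord0 i - a ord0 i) ^+ 2)%R.

Lemma sqdist_ge0 N (x a : 'rV[R]_N) : (0 <= sqdist x a)%R.
Proof. by apply: sumr_ge0 => i _; exact: sqr_ge0. Qed.

Lemma sqdist_eq0 N (x a : 'rV[R]_N) : (sqdist x a == 0)%R = (x == a).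
Proof.
apply/eqP/eqP => [|->]; last by rewrite /sqdist big1// => i _; rewrite subrr expr0n.
move/psumr_eq0P => H; apply/rowP => i; apply/eqP.
by rewrite -subr_eq0 -sqrf_eq0 H// => j _; exact: sqr_ge0.
Qed.

Lemma sqdist_cons N (x : R) (y : 'rV[R]_N) (a : 'rV[R]_N.+1) :
  sqdist (rV_cons (x, y)) a = ((x - a ord0 ord0) ^+ 2 + sqdist y (rV_behead a))%R.
Proof.
rewrite /sqdist big_ord_recl rV_cons0; congr (_ + _)%R; apply: eq_bigr => i _.
by rewrite !mxE liftK.
Qed.

Lemma measurable_sqdist N (a : 'rV[R]_N) : measurable_fun setT (fun x => sqdist x a).
Proof.
apply: measurable_sum => i; apply: measurable_funX; apply: measurable_funB => //.
exact: measurable_rV_coord.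
Qed.

Lemma measurable_exp_sqdist N (a : 'rV[R]_N) s :
  measurable_fun setT (fun x => (expR (- (s * sqdist x a)))%:E).
Proof.
apply/measurable_EFinP; apply: measurableT_comp => //; apply: measurableT_comp => //.
by apply: measurable_funM => //; exact: measurable_sqdist.
Qed.

Lemma integral_gaussian_rV N (a : 'rV[R]_N) s : (0 < s)%R ->
  \int[leb N]_x (expR (- (s * sqdist x a)))%:E = (Num.sqrt (pi / s) ^+ N)%:E.
Proof.
move=> s0; elim: N a => [|N IH] a.
  rewrite integral_dirac//; last exact: measurable_exp_sqdist.
  by rewrite diracT mul1e /sqdist big_ord0 mulr0 oppr0 expR0.
rewrite ge0_integral_rV_cons//; last exact: measurable_exp_sqdist.
under eq_integral => x _.
  under eq_integral => y _ do rewrite sqdist_cons mulrDr opprD expRD EFinM.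
  rewrite ge0_integralZl//; last exact: measurable_exp_sqdist.
  rewrite IH; over.
rewrite ge0_integralZr//=; last first.
  apply/measurable_EFinP; apply: measurableT_comp => //; apply: measurableT_comp => //.
  by apply: measurable_funM => //; apply: measurable_funX; exact: measurable_funB.
by rewrite integral_gaussian// -EFinM exprS.
Qed.

(* Negative powers of |q - a|^2 are superpositions of Gaussians: the potential *)
(* is exp (- w s) k! / (s + e)^(k+1) with s = |q - a|^2, and Tonelli reduces   *)
(* its integral in q to a one-dimensional integral in t.                      *)
Definition potential_density N k w e (a : 'rV[R]_N) (t : R) (q : 'rV[R]_N) : R :=
  (t ^+ k * expR (- (e * t)) * expR (- ((t + w) * sqdist q a)))%R.

Definition potential N k w e (a : 'rV[R]_N) (q : 'rV[R]_N) : \bar R :=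
  \int[mu]_(t in `]0%R, +oo[) (potential_density k w e a t q)%:E.

Lemma potential_density_ge0 N k w e (a : 'rV[R]_N) t q : (0 <= t)%R ->
  (0 <= potential_density k w e a t q)%R.
Proof. by move=> t0; rewrite !mulr_ge0 ?exprn_ge0 ?expR_ge0. Qed.

Lemma potential_Tonelli N k w e (a : 'rV[R]_N) : (0 <= w)%R ->
  measurable_fun setT (potential k w e a) /\
  \int[leb N]_q potential k w e a q =
  \int[mu]_(t in `]0%R, +oo[)
    (t ^+ k * expR (- (e * t)) * Num.sqrt (pi / (t + w)) ^+ N)%:E.
Proof.
move=> w0.
pose h (p : measurableTypeR R * 'rV[R]_N) : \bar R :=
  (\1_(`]0%R, +oo[%classic) p.1 * potential_density k w e a p.1 p.2)%:E.
have h0 p : 0 <= h p.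
  rewrite lee_fin indicE; case: (boolP (_ \in _)) => p0; last by rewrite mul0r.
  rewrite mul1r potential_density_ge0//; move: p0; rewrite inE/= in_itv/= andbT.
  exact: ltW.
have mh : measurable_fun setT h.
  apply/measurable_EFinP; apply: measurable_funM.
    apply: measurableT_comp => //; exact: measurable_indic.
  rewrite /potential_density; apply: measurable_funM; first apply: measurable_funM.
  - by apply: measurable_funX; exact: measurable_fst.
  - apply: measurableT_comp => //; apply: measurableT_comp => //.
    by apply: measurable_funM => //; exact: measurable_fst.
  - apply: measurableT_comp => //; apply: measurableT_comp => //.
    apply: measurable_funM; first by apply: measurable_funD => //; exact: measurable_fst.
    have := measurableT_comp (measurable_sqdist a) (@measurable_snd _ _ (measurableTypeR R) 'rV[R]_N).
    exact.
have potE q : potential k w e a q = \int[mu]_t h (t, q).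
  rewrite /potential integral_mkcond; apply: eq_integral => t _.
  by rewrite /h/= patchE indicE; case: ifP => _; rewrite ?mul1r ?mul0r.
split.
  rewrite (_ : potential k w e a = fubini_G mu h); last exact/funext.
  exact: measurable_fun_fubini_tonelli_G.
under eq_integral do rewrite potE.
rewrite -(@fubini_tonelli _ _ _ _ R mu (leb N) h mh h0) [RHS]integral_mkcond.
apply: eq_integral => t _; rewrite /fubini_F patchE /h/= indicE.
case: (boolP (_ \in _)) => [|_]; last first.
  by under eq_integral do rewrite mul0r; rewrite integral0.
rewrite inE/= in_itv/= andbT => t0.
under eq_integral do rewrite mul1r EFinM.
rewrite ge0_integralZl//; last 2 first.
- exact: measurable_exp_sqdist.
- by rewrite lee_fin mulr_ge0 ?expR_ge0 ?exprn_ge0// ltW.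
by rewrite integral_gaussian_rV -?EFinM//; rewrite ltr_wpDr.
Qed.

Lemma potentialE N k w e (a q : 'rV[R]_N) : (0 < sqdist q a + e)%R ->
  potential k w e a q =
  (expR (- (w * sqdist q a)) * (k`!%:R / (sqdist q a + e) ^+ k.+1))%:E.
Proof.
move=> qe; rewrite EFinM -integral_gamma//.
have mg : measurable_fun setT (fun t : R => (t ^+ k * expR (- ((sqdist q a + e) * t)))%:E).
  apply/measurable_EFinP; apply: measurable_funM; first exact: exprn_measurable.
  by apply: measurableT_comp => //; apply: measurableT_comp => //; exact: measurable_funM.
rewrite -integral_itv_obnd_cbnd; last by apply: measurable_funTS; exact: mg.
have g0 (t : R) : `]0%R, +oo[%classic t -> 0 <= (t ^+ k * expR (- ((sqdist q a + e) * t)))%:E.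
  by rewrite /= in_itv/= andbT => t0; rewrite lee_fin mulr_ge0 ?expR_ge0 ?exprn_ge0// ltW.
rewrite -ge0_integralZl ?lee_fin ?expR_ge0//; last exact: measurable_funTS.
apply: eq_integral => t _; rewrite -EFinM /potential_density; congr (_%:E).
have E : (expR (- (e * t)) * expR (- ((t + w) * sqdist q a)) =
    expR (- (w * sqdist q a)) * expR (- ((sqdist q a + e) * t)))%R.
  by rewrite -!expRD; congr expR; ring.
by rewrite -mulrA E mulrCA.
Qed.

Lemma measurable_potential_density N k w e (a q : 'rV[R]_N) :
  measurable_fun setT (fun t => (potential_density k w e a t q)%:E).
Proof.
apply/measurable_EFinP; apply: measurable_funM; first apply: measurable_funM.
- exact: exprn_measurable.
- by apply: measurableT_comp => //; apply: measurableT_comp => //; exact: measurable_funM.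
- apply: measurableT_comp => //; apply: measurableT_comp => //.
  by apply: measurable_funM => //; exact: measurable_funD.
Qed.

(** At e = 0 the integral dominates its value k! / s^(k+1) at e = s, for every s > 0. *)
Lemma potential_diag N k w (a : 'rV[R]_N) : potential k w 0 a a = +oo.
Proof.
have aa : sqdist a a = 0%R by apply/eqP; rewrite sqdist_eq0.
have pos e (t : R) : `]0%R, +oo[%classic t -> 0 <= (potential_density k w e a t a)%:E.
  by rewrite /= in_itv/= andbT => t0; rewrite lee_fin potential_density_ge0// ltW.
have ge (s : R) : (0 < s)%R -> (k`!%:R / s ^+ k.+1)%:E <= potential k w 0 a a.
  move=> s0; have := @potentialE N k w s a a; rewrite aa add0r mulr0 oppr0 expR0 mul1r.
  move=> <-//; apply: ge0_le_integral => //.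
  - exact: pos.
  - by apply: measurable_funTS; exact: measurable_potential_density.
  - by apply: measurable_funTS; exact: measurable_potential_density.
  - move=> t; rewrite /= in_itv/= andbT => t0; rewrite lee_fin /potential_density.
    rewrite ler_wpM2r ?expR_ge0// ler_wpM2l ?exprn_ge0 ?(ltW t0)//.
    by rewrite ler_expR mul0r oppr0 oppr_le0 mulr_ge0// ltW.
have : 0 <= potential k w 0 a a by apply: integral_ge0 => t; exact: pos.
case E : (potential k w 0 a a) => [r| |]//; rewrite lee_fin => r0.
have r1 : (0 < r + 1)%R by lra.
have := ge (r + 1)^-1%R; rewrite invr_gt0 r1 E lee_fin => /(_ isT).
rewrite exprVn invrK => H; exfalso.
have : (r + 1 <= k`!%:R * (r + 1) ^+ k.+1)%R.
  rewrite -[leLHS]mul1r ler_pM ?ler1n ?fact_gt0//; first lra.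
  by rewrite -[leLHS]expr1 ler_weXn2l//; lra.
lra.
Qed.

(** With k = 2n and w = 0, the Gaussian integral (pi / t)^(2n) cancels t^(2n) and leaves pi^(2n)
    times the integral of exp(-e t). *)
Lemma integral_potential_invSn n e (a : 'rV[R]_(4 * n)) : (0 < e)%R ->
  \int[leb (4 * n)]_q ((sqdist q a + e) ^- (2 * n).+1)%:E =
  (pi ^+ (2 * n) / ((2 * n)`!%:R * e))%:E.
Proof.
move=> e0; have [_] := @potential_Tonelli (4 * n) (2 * n) 0 e a (lexx _).
have f0 : ((2 * n)`!%:R != 0 :> R)%R by rewrite pnatr_eq0 -lt0n fact_gt0.
under eq_integral => q _.
  rewrite potentialE ?ltr_wpDl ?sqdist_ge0// mul0r oppr0 expR0 mul1r EFinM.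
  over.
have mq : measurable_fun setT (fun q : 'rV[R]_(4 * n) => ((sqdist q a + e) ^- (2 * n).+1)%:E).
  have [+ _] := @potential_Tonelli (4 * n) (2 * n) 0 e a (lexx _).
  move=> /(measurable_funeM ((2 * n)`!%:R^-1)%:E); apply: eq_measurable_fun => q _.
  rewrite potentialE ?ltr_wpDl ?sqdist_ge0// mul0r oppr0 expR0 mul1r -EFinM mulKf//.
rewrite ge0_integralZl//; last first.
  by move=> q _; rewrite lee_fin invr_ge0 exprn_ge0// addr_ge0 ?sqdist_ge0// ltW.
under [X in _ = X -> _]eq_integral => t.
  rewrite inE/= in_itv/= andbT addr0 => t0.
  have -> : (t ^+ (2 * n) * expR (- (e * t)) * Num.sqrt (pi / t) ^+ (4 * n) =
             pi ^+ (2 * n) * (t ^+ 0 * expR (- (e * t))))%R.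
    rewrite sqrtX4; last by rewrite divr_ge0 ?pi_ge0// ltW.
    rewrite expr0 mul1r exprMn exprVn mulrC mulrA divfK//.
    by rewrite expf_neq0// gt_eqF.
  rewrite EFinM; over.
have mE : measurable_fun setT (fun t : R => (t ^+ 0 * expR (- (e * t)))%:E).
  apply/measurable_EFinP; apply: measurable_funM; first exact: exprn_measurable.
  by apply: measurableT_comp => //; apply: measurableT_comp => //; exact: measurable_funM.
rewrite ge0_integralZl//; last 3 first.
- exact: measurable_funTS.
- by move=> t _; rewrite lee_fin expr0 mul1r expR_ge0.
- by rewrite lee_fin exprn_ge0// pi_ge0.
rewrite integral_itv_obnd_cbnd; last exact: measurable_funTS.
rewrite integral_gamma// fact0 expr1 -EFinM => H.
have : (((2 * n)`!%:R)^-1)%:E * ((2 * n)`!%:R%:E * \int[leb (4 * n)]_q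
    ((sqdist q a + e) ^- (2 * n).+1)%:E) = (((2 * n)`!%:R)^-1)%:E * (pi ^+ (2 * n) * (1 / e))%:E.
  by rewrite H.
rewrite muleA -EFinM mulVf// mul1e => ->; rewrite -EFinM; congr (_%:E).
by field; rewrite f0 gt_eqF.
Qed.

(** Off a, this potential is exp(-s) (2n-2)! / s^(2n-1) with s = |q-a|^2; the weight w = 1 gives
    decay at infinity. In t, the integrand t^(2n-2) (pi / (t+1))^(2n) is at most pi^(2n)
    (1+t)^(-2). *)
Lemma potential_integral_lty n (a : 'rV[R]_(4 * n)) : (0 < n)%N ->
  \int[leb (4 * n)]_q potential (2 * n).-2 1 0 a q < +oo.
Proof.
move=> n0; have [_ ->] := @potential_Tonelli (4 * n) (2 * n).-2 1 0 a ler01.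
have m1 : measurable_fun (`]0%R, +oo[%classic : set (measurableTypeR R)) (fun t : R => (1 + t)^-1 : measurableTypeR R)%R.
  apply: open_continuous_measurable_fun; first exact: interval_open.
  move=> t; rewrite inE/= in_itv/= andbT => t0.
  apply: cvgV; first by rewrite gt_eqF//; lra.
  by apply: cvgD; [exact: cvg_cst|exact: cvg_id].
have m2 : measurable_fun (`]0%R, +oo[%classic : set (measurableTypeR R)) (fun t : R => ((1 + t) ^- 2)%:E).
  apply/measurable_EFinP; rewrite (_ : (fun _ => _) = (fun t : R => ((1 + t)^-1 ^+ 2)%R)).
    exact: measurable_funX.
  by apply/funext => t; rewrite exprVn.
under eq_integral => t.
  rewrite inE/= in_itv/= andbT => t0.
  rewrite mul0r oppr0 expR0 mulr1 sqrtX4; last by rewrite divr_ge0 ?pi_ge0//; lra.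
  rewrite exprMn (addrC t) mulrCA.
  over.
apply: (@le_lt_trans _ _ (\int[mu]_(t in `]0%R, +oo[)
    ((pi ^+ (2 * n))%:E * ((1 + t) ^- 2)%:E))).
  apply: ge0_le_integral => //.
  - move=> t; rewrite /= in_itv/= andbT => t0.
    by rewrite lee_fin !mulr_ge0 ?exprn_ge0 ?pi_ge0 ?invr_ge0 ?addr_ge0// ltW.
  - apply/measurable_EFinP; apply: measurable_funM => //.
    by apply: measurable_funM; [apply: measurable_funTS; exact: exprn_measurable|exact: measurable_funX].
  - exact: measurable_funeM.
  - move=> t; rewrite /= in_itv/= andbT => t0; rewrite -EFinM lee_fin.
    rewrite ler_pM2l ?exprn_gt0 ?pi_gt0//.
    have : (1 < 2 * n)%N by lia.
    case: (2 * n)%N => [|[|k]] //= _; rewrite -addn2 exprD mulrA [X in (_ * X)%R]exprVn.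
    rewrite -[leRHS]mul1r ler_wpM2r ?invr_ge0 ?exprn_ge0//; first lra.
    rewrite -exprMn exprn_ile1 ?mulr_ge0 ?invr_ge0//; [lra|lra|].
    by rewrite ler_pdivrMr; lra.
rewrite ge0_integralZl//; last 2 first.
- by move=> t _; rewrite lee_fin invr_ge0 sqr_ge0.
- by rewrite lee_fin exprn_ge0// pi_ge0.
by rewrite integral_itv_obnd_cbnd// integral_invSsqr mule1 ltry.
Qed.

End potentials.

(** * The fundamental solution and its regularization *)

Lemma cvg_powR (R : realType) (s p : R) : 0 < s -> x `^ p @[x --> s] --> s `^ p.
Proof.
move=> s0; have d : derivable (fun x : R => x `^ p) s 1.
  by apply: derivable_powR; rewrite in_itv/= s0.
suff: {for s, continuous (fun x : R => x `^ p)} by [].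
by apply: differentiable_continuous; apply/derivable1_diffP.
Qed.

Section fundamental_solution_basic.
Variables (R : realType) (n m : nat) (a : 'rV[R]_(4 * n)).
Hypotheses (m0 : (0 < m)%N) (mn : (m <= n)%N).
Implicit Types (q : 'rV[R]_(4 * n)) (e : R).
Local Notation kap := (@kappa R n m).
Local Notation leb := (lebesgue_rV R).

Lemma kappa_ge1 : 1 <= kap.
Proof.
rewrite /kappa lerBrDr -[1 + 1]/(2%:R) ler_pdivlMr ?ltr0n// -natrM ler_nat.
by rewrite leq_mul2l mn orbT.
Qed.

(** As m >= 1. Thus |q-a|^(-2 kappa) is no more singular at a than |q-a|^(-2(2n-1)), which is
    locally integrable. *)
Lemma kappa_le : kap <= (2 * n).-1%:R.
Proof.
have n0 : (0 < n)%N by exact: leq_trans mn.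
rewrite /kappa lerBlDr natr1 prednK ?muln_gt0//.
by rewrite ler_pdivrMr ?ltr0n// -natrM ler_nat leq_pmulr.
Qed.

Lemma enormB q : enorm (q - a) = Num.sqrt (sqdist q a).
Proof.
by rewrite /enorm /sqdist; congr Num.sqrt; apply: eq_bigr => i _; rewrite !mxE.
Qed.

Lemma continuous_sqdist N (b : 'rV[R]_N) : continuous (fun q : 'rV[R]_N => sqdist q b).
Proof.
apply: continuous_big => [|i _]; first exact: add_continuous.
move=> q; exact: (cvg_comp _ _ (cvgB (@coord_continuous R 1 N ord0 i q) (cvg_cst _))
  (@exprn_continuous R 2 _)).
Qed.

Lemma KmE q : q != a -> Km m a q = (- sqdist q a `^ (- kap))%:E.
Proof.
move=> /negbTE qa; rewrite /Km qa enormB -powR12_sqrt ?sqdist_ge0// -powRrM.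
by rewrite mulrA mulVf ?pnatr_eq0// mul1r powRN mulN1r.
Qed.

Lemma Km_epsE e q : Km_eps m a e q = - (sqdist q a + e) `^ (- kap).
Proof. by rewrite /Km_eps enormB sqr_sqrtr ?sqdist_ge0. Qed.

Lemma sqdist_gt0 q : q != a -> 0 < sqdist q a.
Proof. by move=> qa; rewrite lt0r sqdist_eq0 qa sqdist_ge0. Qed.

Lemma sqdistD_gt0 q e : 0 < e -> 0 < sqdist q a + e.
Proof. by move=> e0; rewrite ltr_wpDl ?sqdist_ge0. Qed.

Lemma Km_eps_le0 e q : Km_eps m a e q <= 0.
Proof. by rewrite Km_epsE oppr_le0 powR_ge0. Qed.

Lemma Km_le_eps e q : 0 < e -> (Km m a q <= (Km_eps m a e q)%:E)%E.
Proof.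
move=> e0; have [->|qa] := eqVneq q a; first by rewrite /Km eqxx leNye.
rewrite KmE// lee_fin Km_epsE lerN2 !powRN lef_pV2 ?posrE ?powR_gt0 ?sqdistD_gt0 ?sqdist_gt0//.
rewrite ge0_ler_powR ?nnegrE ?sqdist_ge0 ?lerDl ?(ltW e0)//.
- exact: le_trans ler01 kappa_ge1.
- exact/ltW/sqdistD_gt0.
Qed.

Lemma Km_neq_pinfty q : Km m a q != +oo%E.
Proof. by rewrite /Km; case: ifP. Qed.

Lemma cvg_Km_eps q : q != a ->
  Km_eps m a e q @[e --> 0^'+] --> - sqdist q a `^ (- kap).
Proof.
move=> qa; apply: cvg_at_right_filter; rewrite /=.
under eq_fun do rewrite Km_epsE.
apply: cvgN; have c : sqdist q a + e @[e --> (0 : R)] --> sqdist q a.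
  rewrite -[X in _ --> X]addr0; apply: cvgD; [exact: cvg_cst|exact: cvg_id].
exact: (cvg_comp _ _ c (@cvg_powR _ _ _ (sqdist_gt0 qa))).
Qed.

Lemma continuous_Km_eps e : 0 < e -> continuous (Km_eps m a e).
Proof.
move=> e0 q; rewrite /continuous_at Km_epsE (_ : Km_eps m a e = fun q => - (sqdist q a + e) `^ (- kap)); last exact/funext/Km_epsE.
exact: (cvgN (cvg_comp _ _ (cvgD (@continuous_sqdist _ a q) (cvg_cst e))
  (@cvg_powR _ _ _ (sqdistD_gt0 _ e0)))).
Qed.

(* Km is the infimum of the continuous functions Km_eps. *)
Lemma usc_Km : usc setT (Km m a).
Proof.
move=> q _ r Kr.
suff [e [e0 er]] : exists e, 0 < e /\ Km_eps m a e q < r.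
  have : \forall y \near q, Km_eps m a e y < r.
    exact: (@cvgr_lt _ _ (nbhs q) _ (Km_eps m a e) _ (continuous_Km_eps e0 (x := q)) _ er).
  by apply: filterS => y yr; rewrite (le_lt_trans (Km_le_eps y e0))// lte_fin.
have [qa|qa] := eqVneq q a.
  have r0 : 0 < 1 + `|r| by rewrite ltr_wpDr.
  (* For this e, K_{m,e}(a) = -(1 + |r|)^kappa <= -(1 + |r|) < r, since kappa >= 1. *)
  exists (1 + `|r|)^-1; rewrite invr_gt0 r0; split => //.
  rewrite Km_epsE qa (_ : sqdist a a = 0) ?add0r; last by apply/eqP; rewrite sqdist_eq0.
  rewrite powRN -powRN.
  have <- : (1 + `|r|) `^ kap = (1 + `|r|)^-1 `^ (- kap).
    by rewrite -[(1 + _)^-1]powR_inv1 ?(ltW r0)// -powRrM mulrNN mul1r.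
  have : 1 + `|r| <= (1 + `|r|) `^ kap by rewrite le1r_powR ?kappa_ge1// lerDl.
  have : - `|r| <= r by rewrite lerNl; apply: le_trans (ler_norm (- r)) _; rewrite normrN.
  by lra.
move: Kr; rewrite KmE// lte_fin => Kr.
have H : \forall e \near 0^'+, Km_eps m a e q < r by apply: cvgr_lt (cvg_Km_eps qa) _ Kr.
have H0 : \forall e \near (0:R)^'+, 0 < e by exact: nbhs_right_gt.
have [e [? ?]] := filter_ex (filterI H0 H).
by exists e.
Qed.

Lemma measurable_Km : measurable_fun setT (Km m a).
Proof.
rewrite (_ : Km m a = fun q => if sqdist q a == 0 then -oo%E else (- sqdist q a `^ (- kap))%:E); last first.
  by apply/funext => q; rewrite sqdist_eq0; case: ifPn => [/eqP->|/KmE->]//; rewrite /Km eqxx.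
apply: measurable_fun_ifT => //.
- exact: (measurable_fun_eqr (measurable_sqdist a) (measurable_cst _)).
- apply/measurable_EFinP; apply: measurableT_comp => //.
  exact: (measurableT_comp (measurable_powR _) (measurable_sqdist a)).
Qed.

(** On K, where |q-a|^2 <= D, the constant exp D makes up for the Gaussian weight of the integrable
    potential P, which then dominates the singularity. *)
Lemma L1loc_Km : L1loc setT (Km m a).
Proof.
move=> K cK _; have n0 : (0 < n)%N by exact: leq_trans mn.
have mK : measurable K by apply: closed_rV_measurable; apply: compact_closed.
have [M KM] := compact_rbox cK.
have Klty : (leb (4 * n) K < +oo)%E.
  apply: le_lt_trans (rbox_lty (4 * n) M); apply: le_measure; rewrite ?inE//.
  exact: measurable_rbox.
have [D KD] : exists D, forall q, K q -> sqdist q a <= D.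
  exists (\sum_(i < 4 * n) (M + `|a ord0 i|) ^+ 2) => q /KM qM.
  apply: ler_sum => i _; rewrite -[X in X <= _]real_normK ?num_real// lerXn2r ?nnegrE//.
    by rewrite (le_trans _ (lerD (qM i) (lexx _)))// addr_ge0.
  by rewrite (le_trans (ler_normB _ _))// lerD2r.
pose P := potential (2 * n).-2 1 0 a.
have [mP _] := @potential_Tonelli R (4 * n) (2 * n).-2 1 0 a ler01.
have P0 q : (0 <= P q)%E.
  apply: integral_ge0 => t; rewrite /= in_itv/= andbT => t0.
  by rewrite lee_fin potential_density_ge0// ltW.
have iP : (leb (4 * n)).-integrable setT P.
  apply/integrableP; split => //; under eq_integral do rewrite gee0_abs//.
  exact: potential_integral_lty.
have k0 : 0 <= kap by exact: le_trans ler01 kappa_ge1.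
(* |q - a|^(-2 kappa) <= 1 + |q - a|^(-2 (2n - 1)), as kappa <= 2n - 1. *)
apply: (@le_integrable _ _ _ _ _ mK _ (fun q => (1 + (expR D)%:E * P q)%E)).
- exact: measurable_funTS measurable_Km.
- move=> q Kq; have e0 : (0 < (expR D)%:E :> \bar R)%E by rewrite lte_fin expR_gt0.
  have r0 : (0 <= 1 + (expR D)%:E * P q)%E.
    by rewrite adde_ge0// mule_ge0// ltW.
  (* At q = a both functions are infinite, by [potential_diag]. *)
  rewrite (gee0_abs r0); have [qa|qa] := eqVneq q a.
    by rewrite /P qa potential_diag gt0_muley// addey// leey.
  have s0 := sqdist_gt0 qa.
  rewrite KmE// /= normrN ger0_norm ?powR_ge0// /P potentialE ?addr0// -EFinM -EFinD lee_fin mul1r.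
  have -> : (2 * n).-2.+1 = (2 * n).-1 by lia.
  rewrite mulrA -expRD.
  have E1 : 1 <= expR (D - sqdist q a) * (2 * n).-2`!%:R.
    rewrite -[leLHS]mul1r ler_pM// ?ler1n ?fact_gt0//.
    by rewrite -expR0 ler_expR subr_ge0 KD.
  rewrite mulrA; apply: (@le_trans _ _ (1 + (sqdist q a ^+ (2 * n).-1)^-1)); last first.
    by rewrite lerD2l -[leLHS]mul1r ler_wpM2r// invr_ge0 exprn_ge0// ltW.
  have [s1|s1] := leP 1 (sqdist q a).
    rewrite powRN ler_wpDr ?invr_ge0 ?exprn_ge0 ?(ltW s0)// invf_le1 ?powR_gt0//.
    by rewrite -(powRr0 (sqdist q a)) ler_powR.
  rewrite ler_wpDl// powRN lef_pV2 ?posrE ?powR_gt0 ?exprn_gt0//.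
  rewrite -powR_mulrn ?(ltW s0)//; apply: ger_powR; last exact: kappa_le.
  by rewrite s0 ltW.
- apply: integrableD => //; last exact: integrableS (integrableZl measurableT _ iP).
  apply/integrableP; split=> //.
  by under eq_integral do rewrite abse1; rewrite integral_cst// mul1e.
Qed.

End fundamental_solution_basic.

(** * Differential calculus on R^N *)

Section directional_derivatives.
Variables (R : realType) (V : normedModType R).
Implicit Types (f : V -> R) (x v : V).

(** A derivative along v is the ordinary derivative of h |-> f (h v + x), which opens directional
    derivatives to the calculus of one variable. *)
Lemma is_derive_line f x v (t d : R) : is_derive (t *: v + x) v f d ->
  is_derive t 1 (fun h : R => f (h *: v + x)) d.
Proof.
have E : (fun h : R => h^-1 *: (((fun h : R => f (h *: v + x)) \o shift t) (h *: 1) -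
    f (t *: v + x))) =
  (fun h : R => h^-1 *: ((f \o shift (t *: v + x)) (h *: v) - f (t *: v + x))).
  apply/funext => h /=; congr (_ *: (f _ - _)).
  by rewrite [h *: 1]mulr1 scalerDl addrA.
move=> [d1 d2]; split; first by rewrite /derivable E.
by rewrite -d2 /derive E.
Qed.

Lemma is_derive_of_line f x v (d : R) :
  is_derive (0 : R) 1 (fun h : R => f (h *: v + x)) d -> is_derive x v f d.
Proof.
have E : (fun h : R => h^-1 *: (((fun h : R => f (h *: v + x)) \o shift 0) (h *: 1) -
    f (0 *: v + x))) =
  (fun h : R => h^-1 *: ((f \o shift x) (h *: v) - f x)).
  apply/funext => h /=; rewrite scale0r add0r; congr (_ *: (f _ - _)).
  by rewrite [h *: 1]mulr1 addr0.
move=> [d1 d2]; split; first by rewrite /derivable -E.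
by rewrite -d2 /derive E.
Qed.

Lemma is_derive_line_comp (g : R -> R) f x v (d c : R) :
  is_derive x v f d -> is_derive (f x) 1 g c ->
  is_derive x v (fun y => g (f y)) (c * d).
Proof.
move=> fd gc; apply: is_derive_of_line.
apply: (@is_derive1_comp _ g (fun h : R => f (h *: v + x)) 0 c d).
  by rewrite scale0r add0r.
by apply: is_derive_line; rewrite scale0r add0r.
Qed.

Lemma continuous_line x v : continuous (fun h : R => h *: v + x).
Proof.
by move=> h; apply: cvgD; [apply: cvgZr_tmp; exact: cvg_id|exact: cvg_cst].
Qed.

End directional_derivatives.

Lemma MVT_origin (R : realType) (F F' : R -> R) (h : R) :
  (forall s : R, is_derive s 1 F (F' s)) -> 0 < h ->
  exists2 s, 0 < s < h & F h - F 0 = F' s * h.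
Proof.
move=> dF h0; have cF : {within `[0, h], continuous F}.
  apply: derivable_within_continuous => s _.
  by have [] := dF s.
have [s sI] := MVT h0 (fun s _ => dF s) cF.
by rewrite subr0 => ->; exists s => //; move: sI; rewrite in_itv.
Qed.

Section Ck_calculus.
Variables (R : realType) (N : nat).
Local Notation point := 'rV[R]_N.
Local Notation basis i := (delta_mx ord0 i : point).
Implicit Types (f g : point -> R) (i j : 'I_N) (k : nat).

Definition is_partial i f f' := forall x, is_derive x (basis i) f (f' x).

Lemma is_partialE i f f' : is_partial i f f' -> partial i f = f'.
Proof. by move=> H; apply/funext => x; have [_] := H x. Qed.

Lemma Ck_intro k f (df : 'I_N -> point -> R) : continuous f ->
  (forall i, is_partial i f (df i)) -> (forall i, Ck k setT (df i)) ->
  Ck k.+1 setT f.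
Proof.
move=> cf pf cdf; split; first by move=> x _; exact: cf.
move=> i; split; last by rewrite (is_partialE (pf i)).
by move=> x _; have [] := pf i x.
Qed.

Lemma Ck0_intro f : continuous f -> Ck 0 setT f.
Proof. by move=> cf; split => // x _; exact: cf. Qed.

Lemma continuous_add f g : continuous f -> continuous g -> continuous (fun x => f x + g x).
Proof. by move=> cf cg x; apply: (@continuousD _ _ _ f g x); [exact: cf|exact: cg]. Qed.

Lemma continuous_mul f g : continuous f -> continuous g -> continuous (fun x => f x * g x).
Proof. by move=> cf cg x; apply: (@continuousM _ _ f g x); [exact: cf|exact: cg]. Qed.

Lemma Ck_continuous k f : Ck k setT f -> continuous f.
Proof. by case: k => [|k] [cf _] x; exact: cf. Qed.

Lemma Ck_is_partial k f i : Ck k.+1 setT f -> is_partial i f (partial i f).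
Proof. by move=> [_ /(_ i)[df _]] x; apply: derivableP; exact: df. Qed.

Lemma Ck_partial k f i : Ck k.+1 setT f -> Ck k setT (partial i f).
Proof. by move=> [_ /(_ i)[]]. Qed.

Lemma CkW k l f : (k <= l)%N -> Ck l setT f -> Ck k setT f.
Proof.
elim: k l f => [|k IH] [|l] f //= kl [cf df]; split => // i.
by have [d c] := df i; split => //; exact: IH c.
Qed.

Lemma is_partialD i f f' g g' : is_partial i f f' -> is_partial i g g' ->
  is_partial i (fun x => f x + g x) (fun x => f' x + g' x).
Proof. by move=> pf pg x; exact: (is_deriveD (pf x) (pg x)). Qed.

Lemma is_partialM i f f' g g' : is_partial i f f' -> is_partial i g g' ->
  is_partial i (fun x => f x * g x) (fun x => f' x * g x + f x * g' x).
Proof.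
move=> pf pg x; apply: is_derive_eq; first exact: (is_deriveM (pf x) (pg x)).
by rewrite /GRing.scale/= addrC (mulrC (g x)).
Qed.

Lemma is_partial_cst i (c : R) : is_partial i (fun=> c) (fun=> 0).
Proof. by move=> x; exact: is_derive_cst. Qed.

Lemma is_partialZ i f f' (c : R) : is_partial i f f' ->
  is_partial i (fun x => c * f x) (fun x => c * f' x).
Proof.
move=> pf x; apply: is_derive_eq; first exact: (is_partialM (is_partial_cst i c) pf).
by rewrite mul0r add0r.
Qed.

Lemma is_partial_sum i (I : Type) (r : seq I) (F F' : I -> point -> R) :
  (forall s, is_partial i (F s) (F' s)) ->
  is_partial i (fun x => \sum_(s <- r) F s x) (fun x => \sum_(s <- r) F' s x).
Proof.
move=> pF; elim: r => [|s r IH].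
  rewrite (_ : (fun x => _) = fun=> 0); last by apply/funext => x; rewrite big_nil.
  rewrite (_ : (fun x => \sum_(s <- [::]) F' s x) = fun=> 0); last by apply/funext => x; rewrite big_nil.
  exact: is_partial_cst.
rewrite (_ : (fun x => _) = fun x => F s x + \sum_(s <- r) F s x); last by apply/funext => x; rewrite big_cons.
rewrite (_ : (fun x => \sum_(s <- _ :: _) F' s x) = fun x => F' s x + \sum_(s <- r) F' s x); last by apply/funext => x; rewrite big_cons.
exact: is_partialD.
Qed.

Lemma is_partial_coord i j (c : R) :
  is_partial i (fun x => x ord0 j - c) (fun=> (i == j)%:R).
Proof.
move=> x; apply: is_derive_of_line.
rewrite (_ : (fun h : R => _) = fun h => h * (i == j)%:R + (x ord0 j - c)); last first.
  by apply/funext => h; rewrite !mxE/= eq_sym addrA.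
by apply: is_derive_eq; rewrite addr0 /GRing.scale/= mulr0 add0r mulr1.
Qed.

Lemma is_partial_sqdist (a : point) i :
  is_partial i (fun x => sqdist x a) (fun x => 2 * (x ord0 i - a ord0 i)).
Proof.
have H : is_partial i (fun x => sqdist x a) (fun x => \sum_(j < N)
    ((i == j)%:R * (x ord0 j - a ord0 j) + (x ord0 j - a ord0 j) * (i == j)%:R)).
  apply: is_partial_sum => j.
  by apply: is_partialM; exact: is_partial_coord.
move=> x; apply: is_derive_eq; first exact: H.
rewrite (bigD1 i)//= eqxx mul1r mulr1 big1 ?addr0 ?mulr_natl ?mulr2n// => j.
by rewrite eq_sym => /negbTE->; rewrite mul0r mulr0 addr0.
Qed.

Lemma Ck_cst k (c : R) : Ck k setT (fun _ : point => c).
Proof.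
have C b : continuous (fun _ : point => b : R) by exact: cst_continuous.
elim: k c => [|k IH] c; first exact: Ck0_intro.
apply: (@Ck_intro _ _ (fun=> fun=> 0)) => //.
by move=> i; exact: is_partial_cst.
Qed.

Lemma CkD k f g : Ck k setT f -> Ck k setT g -> Ck k setT (fun x => f x + g x).
Proof.
elim: k f g => [|k IH] f g cf cg.
  by apply/Ck0_intro/continuous_add; apply: Ck_continuous; eassumption.
apply: (@Ck_intro _ _ (fun i x => partial i f x + partial i g x)).
- by apply: continuous_add; apply: Ck_continuous; eassumption.
- by move=> i; apply: is_partialD; [exact: Ck_is_partial cf|exact: Ck_is_partial cg].
- by move=> i; apply: IH; exact: Ck_partial.
Qed.

Lemma CkM k f g : Ck k setT f -> Ck k setT g -> Ck k setT (fun x => f x * g x).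
Proof.
elim: k f g => [|k IH] f g cf cg.
  by apply/Ck0_intro/continuous_mul; apply: Ck_continuous; eassumption.
apply: (@Ck_intro _ _ (fun i x => partial i f x * g x + f x * partial i g x)).
- by apply: continuous_mul; apply: Ck_continuous; eassumption.
- by move=> i; apply: is_partialM; [exact: Ck_is_partial cf|exact: Ck_is_partial cg].
- move=> i; apply: CkD; apply: IH; try exact: Ck_partial.
    by apply: CkW cg.
  by apply: CkW cf.
Qed.

Lemma CkN k f : Ck k setT f -> Ck k setT (fun x => - f x).
Proof.
move=> cf; rewrite (_ : (fun x => _) = fun x => -1 * f x).
  by apply: CkM => //; exact: Ck_cst.
by apply/funext => x; rewrite mulN1r.
Qed.

Lemma Ck_sum k (I : Type) (r : seq I) (F : I -> point -> R) :
  (forall s, Ck k setT (F s)) -> Ck k setT (fun x => \sum_(s <- r) F s x).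
Proof.
move=> cF; elim: r => [|s r IH]; first by under eq_fun do rewrite big_nil; exact: Ck_cst.
by under eq_fun do rewrite big_cons; exact: CkD.
Qed.

Lemma Ck_coord k i (c : R) : Ck k setT (fun x : point => x ord0 i - c).
Proof.
have C : continuous (fun x : point => x ord0 i - c).
  by move=> x; exact: (cvgB (@coord_continuous R 1 N ord0 i x) (cvg_cst _)).
case: k => [|k]; first by split => // x _; exact: C.
apply: (@Ck_intro _ _ (fun j => fun=> (j == i)%:R)) => // j.
  exact: is_partial_coord.
exact: Ck_cst.
Qed.

Lemma is_partial_powR_sqdist (a : point) i (e p : R) : 0 < e ->
  is_partial i (fun x => (sqdist x a + e) `^ p)
    (fun x => p * (sqdist x a + e) `^ (p - 1) * (2 * (x ord0 i - a ord0 i))).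
Proof.
move=> e0 x.
apply: (@is_derive_line_comp _ _ (fun y => y `^ p) (fun x => sqdist x a + e)).
  apply: is_derive_eq; first exact: (is_partialD (is_partial_sqdist a i) (is_partial_cst i e)).
  by rewrite addr0.
by apply: is_derive1_powR; rewrite ltr_wpDl ?sqdist_ge0.
Qed.

Lemma Ck_powR_sqdist k (a : point) (e p : R) : 0 < e ->
  Ck k setT (fun x => (sqdist x a + e) `^ p).
Proof.
move=> e0; have C q : continuous (fun x => (sqdist x a + e) `^ q).
  have x0 x : 0 < sqdist x a + e by rewrite ltr_wpDl ?sqdist_ge0.
  have c1 : continuous (fun x => sqdist x a + e).
    by apply: continuous_add; [exact: continuous_sqdist|exact: cst_continuous].
  by move=> x; exact: (cvg_comp _ _ (c1 x) (cvg_powR (x0 x))).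
elim: k p => [|k IH] p; first by split => // x _; exact: C.
apply: (Ck_intro (C p)).
  by move=> i; exact: is_partial_powR_sqdist.
move=> i; apply: CkM; first by apply: CkM => //; exact: Ck_cst.
by apply: CkM; [exact: Ck_cst|exact: Ck_coord].
Qed.

(** The mean value theorem in the direction i, applied to the difference of f in the direction j,
    and then in the direction j. *)
Lemma mixed_difference f i j x (h : R) : Ck 2 setT f -> 0 < h ->
  exists s t : R, [/\ 0 < s < h, 0 < t < h &
   f (h *: basis i + (h *: basis j + x)) - f (h *: basis i + x) -
     (f (h *: basis j + x) - f x) =
   partial j (partial i f) (t *: basis j + (s *: basis i + x)) * h * h].
Proof.
move=> cf h0.
pose F s := f (s *: basis i + (h *: basis j + x)) - f (s *: basis i + x).
have dF (s : R) : is_derive s 1 F (partial i f (s *: basis i + (h *: basis j + x)) -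
    partial i f (s *: basis i + x)).
  by apply: is_deriveB; apply: is_derive_line; exact: (Ck_is_partial i cf).
have [s sI] := MVT_origin dF h0.
rewrite /F !scale0r !add0r => ->.
pose G t := partial i f (t *: basis j + (s *: basis i + x)).
have cif := Ck_partial i cf.
have dG (t : R) : is_derive t 1 G (partial j (partial i f) (t *: basis j + (s *: basis i + x))).
  by apply: is_derive_line; exact: (Ck_is_partial j cif).
have [t tI] := MVT_origin dG h0.
rewrite /G scale0r add0r => E.
by exists s, t; split => //; rewrite -E addrCA.
Qed.

(** Schwarz: the second difference of f is symmetric in i and j, so the two mixed derivatives take a
    common value, each at some point close to x; both are continuous at x. *)
Lemma partialC f i j x : Ck 2 setT f ->
  partial i (partial j f) x = partial j (partial i f) x.
Proof.
move=> cf; apply/eqP; rewrite -subr_eq0 -normr_le0; apply/ler_addgt0Pl => e e0.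
rewrite addr0.
have e20 : 0 < e / 2 by rewrite divr_gt0.
have near_line (k l : 'I_N) : exists2 d : R, 0 < d & forall s t : R, 0 < s < d -> 0 < t < d ->
    `|partial l (partial k f) x - partial l (partial k f) (t *: basis l + (s *: basis k + x))| < e / 2.
  have /Ck_continuous/(_ x)/cvgrPdist_lt/(_ _ e20) := Ck_partial l (Ck_partial k cf).
  move=> /nbhs_normP[r/= r0 H]; pose C := `|basis l| + `|basis k| + 1.
  have C0 : 0 < C by rewrite ltr_wpDl ?addr_ge0.
  exists (r / C); first by rewrite divr_gt0.
  move=> s t /andP[s0 sd] /andP[t0 td]; apply: H; rewrite /ball_/=.
  rewrite -normrN opprB addrA addrK.
  apply: le_lt_trans (ler_normD _ _) _; rewrite !normrZ !gtr0_norm//.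
  apply: (@le_lt_trans _ _ (r / C * (C - 1))).
    by rewrite /C addrK mulrDr lerD// ler_wpM2r// ltW.
  by rewrite mulrBr mulr1 mulfVK ?gt_eqF// ltrBlDr ltrDl divr_gt0.
have [d1 d10 H1] := near_line i j; have [d2 d20 H2] := near_line j i.
pose h := Num.min d1 d2; have h0 : 0 < h by rewrite lt_min d10.
have [s [t [/andP[s0 sh] /andP[t0 th] E1]]] := mixed_difference i j x cf h0.
have [s' [t' [/andP[s'0 s'h] /andP[t'0 t'h] E2]]] := mixed_difference j i x cf h0.
move: sh th s'h t'h; rewrite !lt_min => /andP[? ?] /andP[? ?] /andP[? ?] /andP[? ?].
have E : partial j (partial i f) (t *: basis j + (s *: basis i + x)) =
    partial i (partial j f) (t' *: basis i + (s' *: basis j + x)).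
  have cancel (P Q b c d u : R) : b - c - (d - u) = P * h * h ->
      b - d - (c - u) = Q * h * h -> P = Q.
    have hh : h * h != 0 by rewrite mulf_neq0// gt_eqF.
    by move=> PE QE; apply: (mulIf hh); rewrite !mulrA -PE -QE; ring.
  by rewrite addrCA in E2; exact: cancel E1 E2.
have := H1 s t; rewrite s0 t0/= => /(_ ltac:(by []) ltac:(by [])) {}H1.
have := H2 s' t'; rewrite s'0 t'0/= => /(_ ltac:(by []) ltac:(by [])) {}H2.
rewrite -E in H2; move: H1 H2.
move: (partial j (partial i f) x) (partial i (partial j f) x) => A B.
move: (partial j _ _) => P; clear.
by rewrite !ltr_norml ler_norml => /andP[? ?] /andP[? ?]; apply/andP; split; lra.
Qed.

End Ck_calculus.

(** * Integration by parts *)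

Section integration_by_parts.
Variable R : realType.
Local Notation mu := (@lebesgue_measure R).
Local Notation leb := (lebesgue_rV R).

Lemma continuous_compact_supp_bounded (T : topologicalType) (f : T -> R) (K : set T) :
  continuous f -> compact K -> (forall x, f x != 0 -> K x) ->
  exists B, forall x, `|f x| <= B.
Proof.
move=> cf cK fK.
have : compact (f @` K) by apply: continuous_compact => //; exact: continuous_subspaceT.
move=> /compact_bounded[M [_ MK]]; exists (Num.max 0 (M + 1)) => x.
have [->|fx] := eqVneq (f x) 0; first by rewrite normr0 le_max lexx.
by rewrite le_max (MK (M + 1)) ?orbT ?ltrDl//=; exists x => //; exact: fK.
Qed.

Lemma continuous_compact_supp_integrable N (f : 'rV[R]_N -> R) (K : set 'rV[R]_N) :
  continuous f -> compact K -> (forall x, f x != 0 -> K x) ->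
  (leb N).-integrable setT (EFin \o f).
Proof.
move=> cf cK fK; have [B fB] := continuous_compact_supp_bounded cf cK fK.
have [M KM] := compact_rbox cK.
apply: (@bounded_supp_integrable _ _ _ B M) => //; first exact: continuous_rV_measurable.
by move=> x /fK/KM.
Qed.

Lemma integral_derivative0 (g g' : R -> R) (M : R) :
  (forall t : R, is_derive t 1 g (g' t)) -> continuous g' ->
  (forall t, g t != 0 -> `|t| <= M) -> (forall t, g' t != 0 -> `|t| <= M) ->
  (\int[mu]_t (g' t)%:E = 0)%E.
Proof.
(* b lies strictly outside the support, so g vanishes at -b and at b. *)
move=> dg cg' gM g'M; pose b : R := `|M| + 1.
have bM : M < b by rewrite (le_lt_trans (ler_norm M))// ltrDl.
have b0 : 0 < b by rewrite ltr_wpDl.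
have ab : - b < b by rewrite gtrN.
have gb t : `|t| = b -> g t = 0.
  by move=> tb; apply/eqP/negPn/negP => /gM; rewrite tb leNgt bM.
have cg t : {for t, continuous g}.
  by apply: differentiable_continuous; apply/derivable1_diffP; have [] := dg t.
have -> : (\int[mu]_t (g' t)%:E = \int[mu]_(t in `[(- b)%R, b]) (g' t)%:E)%E.
  rewrite [RHS]integral_mkcond; apply: eq_integral => t _; rewrite patchE.
  case: ifPn => //; rewrite notin_setE/= in_itv/= -ler_norml => tb.
  have [->//|/g'M tM] := eqVneq (g' t) 0.
  by exfalso; apply: tb; rewrite (le_trans tM)// ltW.
rewrite (@continuous_FTC2 R g' g (- b) b ab).
- by rewrite !gb ?sube0// ?normrN gtr0_norm.
- exact: continuous_subspaceT.
- split.
  + by move=> t _; have [] := dg t.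
  + exact: cvg_at_right_filter (cg _).
  + exact: cvg_at_left_filter (cg _).
- by move=> t _; rewrite derive1E; have [_ ->] := dg t.
Qed.

Lemma rV_cons_line N (t : R) (y : 'rV[R]_N) :
  rV_cons (t, y) = t *: delta_mx ord0 ord0 + rV_cons (0, y).
Proof.
apply/rowP => i; rewrite !mxE/=; case: unliftP => [j ->|->] /=.
  by rewrite mulr0 add0r.
by rewrite mulr1 addr0.
Qed.

Lemma rV_cons_lift N (h t : R) (y : 'rV[R]_N) j :
  rV_cons (t, h *: delta_mx ord0 j + y) =
  h *: delta_mx ord0 (lift ord0 j) + rV_cons (t, y).
Proof.
apply/rowP => i; rewrite !mxE/=; case: unliftP => [k ->|->] /=.
  by rewrite !mxE /= (inj_eq lift_inj).
by rewrite mulr0 add0r.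
Qed.

(** Fubini isolates the i-th variable, in which the fundamental theorem of calculus gives 0.
    Measurability of g' and its continuity along the direction i both pass to the slices of the
    induction on N. *)
Lemma is_partial_measurable_integral0 N (i : 'I_N) (g g' : 'rV[R]_N -> R) (B M : R) :
  is_partial i g g' -> measurable_fun setT g' ->
  (forall x, continuous (fun t : R => g' (t *: delta_mx ord0 i + x))) ->
  (forall x, `|g' x| <= B) ->
  (forall x, g x != 0 -> rbox N M x) -> (forall x, g' x != 0 -> rbox N M x) ->
  (\int[leb N]_x (g' x)%:E = 0)%E.
Proof.
elim: N i g g' => [|N IH] i g g'; first by case: i.
move=> pg mg' cg' g'B gM g'M.
have ig' := bounded_supp_integrable mg' g'B g'M.
case: (unliftP ord0 i) => [j|] ij; rewrite {i}ij in pg cg' *.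
  rewrite integral_rV_cons12// integral0_eq// => x _.
  apply: (IH j (fun y => g (rV_cons (x, y)))).
  - move=> y; apply: is_derive_of_line.
    under eq_fun do rewrite rV_cons_lift.
    by apply: is_derive_line; rewrite scale0r add0r; exact: pg.
  - apply: measurableT_comp mg' _; apply: measurableT_comp (@measurable_rV_cons R N) _.
    exact: measurable_pair1.
  - by move=> y; under eq_fun do rewrite rV_cons_lift; exact: cg'.
  - by move=> y; exact: g'B.
  - by move=> y /gM H j'; have := H (lift ord0 j'); rewrite mxE liftK.
  - by move=> y /g'M H j'; have := H (lift ord0 j'); rewrite mxE liftK.
rewrite integral_rV_cons21// integral0_eq// => y _.
apply: (@integral_derivative0 (fun t => g (rV_cons (t, y))) _ M).
- move=> t; under eq_fun do rewrite rV_cons_line.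
  by rewrite [rV_cons (t, y)]rV_cons_line; apply: is_derive_line; exact: pg.
- by under eq_fun do rewrite rV_cons_line; exact: cg'.
- by move=> t /gM/(_ ord0); rewrite rV_cons0.
- by move=> t /g'M/(_ ord0); rewrite rV_cons0.
Qed.

Lemma integral_partial0 N (i : 'I_N) (g : 'rV[R]_N -> R) (K : set 'rV[R]_N) :
  Ck 1 setT g -> compact K -> (forall x, g x != 0 -> K x) ->
  (forall x, partial i g x != 0 -> K x) ->
  (\int[leb N]_x (partial i g x)%:E = 0)%E.
Proof.
move=> cg cK gK g'K; have cg' := Ck_continuous (Ck_partial i cg).
have [B g'B] := continuous_compact_supp_bounded cg' cK g'K.
have [M KM] := compact_rbox cK.
apply: (@is_partial_measurable_integral0 _ i g _ B M) => //.
- exact: Ck_is_partial cg.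
- exact: continuous_rV_measurable.
- by move=> x t; exact: (cvg_comp _ _ (@continuous_line _ _ x _ t) (cg' _)).
- by move=> x /gK/KM.
- by move=> x /g'K/KM.
Qed.

End integration_by_parts.

(** * Symmetry of the mixed operator *)

Section hessian_forms.
Variables (R : realType) (N : nat) (A : comAlgType R[i]) (E : 'I_N -> 'I_N -> A).
Local Notation point := 'rV[R]_N.
Implicit Types (F G : point -> A).

(** This is Delta v when E p q is the coefficient of d_p d_q in Delta. *)
Definition hessian_form (v : point -> R) (x : point) : A :=
  \sum_p \sum_q (partial p (partial q v) x)%:C *: E p q.

(* A carries no topology: F is C^1, with partial derivatives F' i, when it is  *)
(* a finite combination of fixed elements of A with C^1 coefficients.         *)
Definition C1form F (F' : 'I_N -> point -> A) := exists (J : finType) (a : J -> point -> R) (y : J -> A),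
  [/\ forall j, Ck 1 setT (a j),
      forall x, F x = \sum_j (a j x)%:C *: y j
    & forall i x, F' i x = \sum_j (partial i (a j) x)%:C *: y j].

Lemma C1form_mul F (F' : 'I_N -> point -> A) G (G' : 'I_N -> point -> A) : C1form F F' -> C1form G G' ->
  C1form (fun x => F x * G x) (fun i x => F' i x * G x + F x * G' i x).
Proof.
move=> [J [a [y [aC FE F'E]]]] [K [b [z [bC GE G'E]]]].
exists (J * K)%type, (fun p x => a p.1 x * b p.2 x), (fun p => y p.1 * z p.2).
have prodE (c : J -> R) (d : K -> R) :
    (\sum_j (c j)%:C *: y j) * (\sum_k (d k)%:C *: z k) =
    \sum_(p : J * K) (c p.1 * d p.2)%:C *: (y p.1 * z p.2).
  rewrite big_distrlr/= pair_big/=; apply: eq_bigr => p _.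
  by rewrite -scalerAl -scalerAr scalerA rmorphM.
split.
- by move=> p; apply: CkM.
- by move=> x; rewrite FE GE prodE.
- move=> i x; rewrite FE GE F'E G'E !prodE -big_split/=; apply: eq_bigr => p _.
  rewrite -scalerDl -rmorphD; congr (_%:C *: _).
  have /is_partialE -> := is_partialM (Ck_is_partial i (aC p.1)) (Ck_is_partial i (bC p.2)).
  by [].
Qed.

Lemma C1form_cst (c : A) : C1form (fun=> c) (fun _ _ => 0).
Proof.
exists 'I_1, (fun=> fun=> 1), (fun=> c); split => [j|x|i x].
- exact: Ck_cst.
- by rewrite big_ord1 scale1r.
- by rewrite big_ord1 (is_partialE (is_partial_cst i 1)) scale0r.
Qed.

Lemma C1form_hessian v : Ck 3 setT v ->
  C1form (hessian_form v)
    (fun i x => \sum_p \sum_q (partial i (partial p (partial q v)) x)%:C *: E p q).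
Proof.
move=> cv; exists ('I_N * 'I_N)%type, (fun p => partial p.1 (partial p.2 v)),
  (fun p => E p.1 p.2); split => [p|x|i x].
- by apply: Ck_partial; apply: Ck_partial.
- by rewrite /hessian_form pair_big.
- by rewrite pair_big.
Qed.

(** The matrix with entries F E_ij has divergence-free columns and rows, F' being the gradient of
    F. *)
Definition divfree F := exists F' : 'I_N -> point -> A, [/\ C1form F F',
  forall j x, \sum_i F' i x * E i j = 0 & forall i x, \sum_j F' j x * E i j = 0].

(** By Leibniz and commutativity, each divergence for F G is G times that for F plus F times that
    for G. *)
Lemma divfree_mul F G : divfree F -> divfree G -> divfree (fun x => F x * G x).
Proof.
move=> [F' [cF rF lF]] [G' [cG rG lG]].
exists (fun i x => F' i x * G x + F x * G' i x); split; first exact: C1form_mul.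
- move=> j x; transitivity (G x * (\sum_i F' i x * E i j) + F x * (\sum_i G' i x * E i j)).
    by rewrite !mulr_sumr -big_split; apply: eq_bigr => i _ /=; ring.
  by rewrite rF rG !mulr0 addr0.
- move=> i x; transitivity (G x * (\sum_j F' j x * E i j) + F x * (\sum_j G' j x * E i j)).
    by rewrite !mulr_sumr -big_split; apply: eq_bigr => j _ /=; ring.
  by rewrite lF lG !mulr0 addr0.
Qed.

Lemma divfree_cst (c : A) : divfree (fun=> c).
Proof.
exists (fun _ _ => 0); split; first exact: C1form_cst.
- by move=> j x; rewrite big1// => i _; rewrite mul0r.
- by move=> i x; rewrite big1// => j _; rewrite mul0r.
Qed.

Lemma divfree_prod m (F : 'I_m -> point -> A) : (forall k, divfree (F k)) ->
  divfree (fun x => \prod_k F k x).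
Proof.
elim: m F => [|m IH] F dF.
  rewrite (_ : (fun x => _) = fun=> 1); first exact: divfree_cst.
  by apply/funext => x; rewrite big_ord0.
rewrite (_ : (fun x => _) = fun x => F ord0 x * \prod_k F (lift ord0 k) x).
  by apply: divfree_mul => //; exact: IH.
by apply/funext => x; rewrite big_ord_recl.
Qed.

Hypothesis E_swapl : forall p q i j, E p q * E i j = - (E i q * E p j).
Hypothesis E_swapr : forall p q i j, E p q * E i j = - (E p j * E i q).

Lemma self_opp0 (y : A) : y = - y -> y = 0.
Proof.
move=> yN; have y2 : (2 : R[i]) *: y = 0 by rewrite scaler_nat mulr2n {1}yN addNr.
have n2 : (2 : R[i]) != 0 by rewrite pnatr_eq0.
by rewrite -[y](scalerK n2) y2 scaler0.
Qed.

(* Antisymmetry of E against the symmetry of third derivatives. *)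
Lemma divfree_hessian v : Ck 3 setT v -> divfree (hessian_form v).
Proof.
move=> cv; eexists; split; first exact: C1form_hessian cv.
- move=> j x; apply: self_opp0.
  have expand : \sum_i (\sum_p \sum_q (partial i (partial p (partial q v)) x)%:C *: E p q) * E i j =
      \sum_i \sum_p \sum_q (partial i (partial p (partial q v)) x)%:C *: (E p q * E i j).
    apply: eq_bigr => i _; rewrite mulr_suml; apply: eq_bigr => p _.
    by rewrite mulr_suml; apply: eq_bigr => q _; rewrite scalerAl.
  rewrite {1}expand exchange_big expand -sumrN; apply: eq_bigr => i _.
  rewrite -sumrN; apply: eq_bigr => p _; rewrite -sumrN; apply: eq_bigr => q _.
  have -> : partial i (partial p (partial q v)) x = partial p (partial i (partial q v)) x.
    exact: partialC (Ck_partial q cv).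
  by rewrite (E_swapl p q i j) scalerN opprK.
- move=> i x; apply: self_opp0.
  have expand : \sum_j (\sum_p \sum_q (partial j (partial p (partial q v)) x)%:C *: E p q) * E i j =
      \sum_p \sum_j \sum_q (partial j (partial p (partial q v)) x)%:C *: (E p q * E i j).
    rewrite exchange_big; apply: eq_bigr => j _; rewrite mulr_suml; apply: eq_bigr => p _.
    by rewrite mulr_suml; apply: eq_bigr => q _; rewrite scalerAl.
  rewrite {1}expand expand -sumrN; apply: eq_bigr => p _.
  rewrite [LHS]exchange_big/= -sumrN; apply: eq_bigr => j _; rewrite -sumrN; apply: eq_bigr => q _.
  have sym : partial q (partial j v) = partial j (partial q v).
    by apply/funext => y; exact: partialC (CkW (leqnSn 2) cv).
  have s1 : partial q (partial p (partial j v)) x = partial p (partial q (partial j v)) x.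
    exact: partialC (Ck_partial j cv).
  have s2 : partial p (partial j (partial q v)) x = partial j (partial p (partial q v)) x.
    exact: partialC (Ck_partial q cv).
  by rewrite s1 sym s2 (E_swapr p q i j) scalerN opprK.
Qed.

End hessian_forms.

Section supports.
Variables (R : realType) (N : nat).
Implicit Types (w : 'rV[R]_N -> R).

Lemma supp_neq0 w x : w x != 0 -> supp w x.
Proof. by move=> wx; apply: subset_closure. Qed.

Lemma partial_supp (i : 'I_N) w x : partial i w x != 0 -> supp w x.
Proof.
apply: contra_neqP => xw.
have : \forall y \near x, w y = 0.
  have : open (~` supp w) by apply: closed_openC; exact: closed_closure.
  rewrite openE => /(_ x xw); apply: filterS => y yw; apply/eqP/negPn/negP => wy.
  by apply: yw; exact: supp_neq0.
move=> w0; rewrite /partial (@near_eq_derive _ _ _ w (cst 0)) ?derive_cst//.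
Qed.

Lemma partial2_supp (i j : 'I_N) w x : partial i (partial j w) x != 0 -> supp w x.
Proof.
have /closure_id E := @closed_closure _ [set y | w y != 0].
move=> /partial_supp; rewrite [in X in _ -> X]/supp E.
by apply: closure_subset => y; exact: partial_supp.
Qed.

End supports.

(** The right-hand side is the divergence of \sum_j (u S_ij d_j w - w S_ji d_j u). Derivatives of S
    drop out by the two divergence conditions, and products of first derivatives cancel because S is
    transposed in the second term. *)
Lemma green_sum_identity (R : comPzRingType) N (u w : R) (pu pw : 'I_N -> R)
    (ppu ppw S : 'I_N -> 'I_N -> R) (S' : 'I_N -> 'I_N -> 'I_N -> R) :
  (forall j, \sum_i S' i i j = 0) -> (forall j, \sum_i S' i j i = 0) ->
  (forall i j, ppu i j = ppu j i) ->
  u * (\sum_p \sum_q ppw p q * S p q) - w * (\sum_p \sum_q ppu p q * S p q) =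
  \sum_i \sum_j (((pu i * S i j + u * S' i i j) * pw j + u * S i j * ppw i j) +
    -1 * ((pw i * S j i + w * S' i j i) * pu j + w * S j i * ppu i j)).
Proof.
move=> S'r S'l ppuC; symmetry; transitivity (
    \sum_i \sum_j u * (ppw i j * S i j) +
    (\sum_i \sum_j pu i * S i j * pw j - \sum_i \sum_j pu j * S j i * pw i) +
    \sum_i \sum_j S' i i j * (u * pw j) - \sum_i \sum_j S' i j i * (w * pu j)
    - \sum_i \sum_j w * (ppu j i * S j i)).
  rewrite -!sumrB -!big_split -!sumrB/=; apply: eq_bigr => i _.
  rewrite -!sumrB -!big_split -!sumrB/=; apply: eq_bigr => j _.
  by rewrite (ppuC i j); ring.
rewrite [X in _ + (_ - X)]exchange_big subrr addr0.
rewrite [X in _ + X - _ - _]exchange_big [X in _ - X - _]exchange_big/=.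
rewrite [X in _ + X - _ - _]big1 => [|j _]; last by rewrite -mulr_suml S'r mul0r.
rewrite [X in _ - X - _]big1 => [|j _]; last by rewrite -mulr_suml S'l mul0r.
rewrite addr0 subr0 [X in _ - X]exchange_big !mulr_sumr.
by congr (_ - _); apply: eq_bigr => i _; rewrite mulr_sumr.
Qed.

Section green.
Variables (R : realType) (N : nat) (A : comAlgType R[i]) (E : 'I_N -> 'I_N -> A).
Variable L : {scalar A}.
Local Notation point := 'rV[R]_N.
Local Notation leb := (lebesgue_rV R).
Implicit Types (F : point -> A) (u w : point -> R).
Local Notation ReL y := (complex.Re (L y)).

Lemma ReL_sum (I : finType) (a : I -> R) (y : I -> A) :
  ReL (\sum_k (a k)%:C *: y k) = \sum_k a k * ReL (y k).
Proof.
rewrite linear_sum raddf_sum; apply: eq_bigr => k _.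
by rewrite linearZ /=; case: (L (y k)) => b c /=; rewrite mul0r subr0.
Qed.

Lemma C1form_Re F (F' : 'I_N -> point -> A) (y : A) : C1form F F' ->
  Ck 1 setT (fun x => ReL (F x * y)) /\
  forall i, is_partial i (fun x => ReL (F x * y)) (fun x => ReL (F' i x * y)).
Proof.
move=> [J [a [z [aC FE F'E]]]].
have E0 : (fun x => ReL (F x * y)) = fun x => \sum_k ReL (z k * y) * a k x.
  apply/funext => x; rewrite FE mulr_suml.
  under eq_bigr do rewrite -scalerAl.
  by rewrite ReL_sum; apply: eq_bigr => k _; rewrite mulrC.
have E1 i : (fun x => ReL (F' i x * y)) = fun x => \sum_k ReL (z k * y) * partial i (a k) x.
  apply/funext => x; rewrite F'E mulr_suml.
  under eq_bigr do rewrite -scalerAl.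
  by rewrite ReL_sum; apply: eq_bigr => k _; rewrite mulrC.
rewrite E0; split.
  by apply: Ck_sum => k; apply: CkM => //; exact: Ck_cst.
move=> i; rewrite E1; apply: is_partial_sum => k.
by apply: is_partialZ; exact: Ck_is_partial (aC k).
Qed.

Lemma ReL_hessian F w x : ReL (F x * hessian_form E w x) =
  \sum_p \sum_q partial p (partial q w) x * ReL (F x * E p q).
Proof.
rewrite /hessian_form !pair_big/= mulr_sumr -ReL_sum.
by congr (complex.Re (L _)); apply: eq_bigr => p _; rewrite -scalerAr.
Qed.

Lemma Ck_ReL_hessian F w : divfree E F -> Ck 2 setT w ->
  Ck 0 setT (fun x => ReL (F x * hessian_form E w x)).
Proof.
move=> [F' [/C1form_Re cF _ _]] cw.
rewrite (_ : (fun x => _) = fun x => \sum_p \sum_q partial p (partial q w) x * ReL (F x * E p q)).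
  apply: Ck_sum => p; apply: Ck_sum => q; apply: CkM.
    by apply: Ck_partial; exact: Ck_partial.
  by have [c _] := cF (E p q); exact: CkW c.
by apply/funext => x; exact: ReL_hessian.
Qed.

(** By [green_sum_identity] the difference of the integrands is the divergence of a field supported
    in the compact support of w, and its integral is 0. *)
Lemma hessian_green F u w : divfree E F -> Ck 2 setT u -> Ck 2 setT w ->
  compact (supp w) ->
  (\int[leb N]_x (u x * ReL (F x * hessian_form E w x))%:E =
   \int[leb N]_x (w x * ReL (F x * hessian_form E u x))%:E)%E.
Proof.
move=> dF cu cw Kw; have [F' [cF rF lF]] := dF.
pose S i j x := ReL (F x * E i j).
pose S' k i j x := ReL (F' k x * E i j).
have cS i j : Ck 1 setT (S i j) by have [] := C1form_Re (E i j) cF.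
have dS k i j : is_partial k (S i j) (S' k i j) by case: (C1form_Re (E i j) cF) => _; exact.
have S'r j x : \sum_i S' i i j x = 0.
  by rewrite /S' -raddf_sum -linear_sum rF raddf0.
have S'l i x : \sum_j S' j i j x = 0.
  by rewrite /S' -raddf_sum -linear_sum lF raddf0.
pose H i x := \sum_j (u x * S i j x * partial j w x + -1 * (w x * S j i x * partial j u x)).
pose H' i x := \sum_j (((partial i u x * S i j x + u x * S' i i j x) * partial j w x +
     u x * S i j x * partial i (partial j w) x) +
   -1 * ((partial i w x * S j i x + w x * S' i j i x) * partial j u x +
     w x * S j i x * partial i (partial j u) x)).
have c1 (f : point -> R) : Ck 2 setT f -> Ck 1 setT f by exact: CkW.
have dH i : is_partial i (H i) (H' i).
  apply: is_partial_sum => j; apply: is_partialD; last apply: is_partialZ.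
    apply: is_partialM; last exact: Ck_is_partial (Ck_partial j cw).
    by apply: is_partialM; [exact: Ck_is_partial cu|exact: dS].
  apply: is_partialM; last exact: Ck_is_partial (Ck_partial j cu).
  by apply: is_partialM; [exact: Ck_is_partial cw|exact: dS].
have cH i : Ck 1 setT (H i).
  apply: Ck_sum => j; apply: CkD; last apply: CkM; last apply: CkM; try exact: Ck_cst.
  - by apply: CkM; [apply: CkM => //; exact: c1|exact: Ck_partial].
  - by apply: CkM => //; exact: c1.
  - exact: Ck_partial.
have wE x : ~ supp w x -> w x = 0.
  by move=> xw; apply/eqP/negPn/negP => /supp_neq0.
have pwE i x : ~ supp w x -> partial i w x = 0.
  by move=> xw; apply/eqP/negPn/negP => /partial_supp.
have ppwE i j x : ~ supp w x -> partial i (partial j w) x = 0.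
  by move=> xw; apply/eqP/negPn/negP => /partial2_supp.
have H0 i x : H i x != 0 -> supp w x.
  apply: contra_neqP => xw; rewrite /H big1// => j _.
  by rewrite wE// pwE// !(mul0r, mulr0) addr0.
have H'0 i x : H' i x != 0 -> supp w x.
  apply: contra_neqP => xw; rewrite /H' big1// => j _.
  by rewrite wE// !pwE// ppwE// !(mul0r, mulr0, addr0).
have intH i : (leb N).-integrable setT (EFin \o (H' i)) /\ (\int[leb N]_x (H' i x)%:E = 0)%E.
  rewrite -(is_partialE (dH i)); split.
    apply: (continuous_compact_supp_integrable _ Kw); first exact: Ck_continuous (Ck_partial i (cH i)).
    by move=> x; rewrite (is_partialE (dH i)); exact: H'0.
  apply: (integral_partial0 (cH i) Kw); first exact: H0.
  by move=> x; rewrite (is_partialE (dH i)); exact: H'0.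
have divE x : u x * ReL (F x * hessian_form E w x) - w x * ReL (F x * hessian_form E u x) =
    \sum_i H' i x.
  transitivity (u x * (\sum_p \sum_q partial p (partial q w) x * S p q x) -
      w x * (\sum_p \sum_q partial p (partial q u) x * S p q x)).
    by congr (u x * _ - w x * _); exact: ReL_hessian.
  apply: (@green_sum_identity _ _ (u x) (w x) (partial^~ u ^~ x) (partial^~ w ^~ x)
    (fun i j => partial i (partial j u) x) (fun i j => partial i (partial j w) x)
    (fun i j => S i j x) (fun k i j => S' k i j x)) => [j|j|i j]; [exact: S'r|exact: S'l|].
  exact: partialC.
pose f x := u x * ReL (F x * hessian_form E w x).
pose g x := w x * ReL (F x * hessian_form E u x).
have int_f : (leb N).-integrable setT (EFin \o f).
  apply: (continuous_compact_supp_integrable _ Kw).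
    apply: (@Ck_continuous _ _ 0); apply: CkM; first exact: CkW cu.
    exact: Ck_ReL_hessian.
  move=> x; apply: contra_neqP => xw; rewrite /f ReL_hessian big1 ?mulr0// => p _.
  by rewrite big1// => q _; rewrite ppwE// mul0r.
have int_g : (leb N).-integrable setT (EFin \o g).
  apply: (continuous_compact_supp_integrable _ Kw).
    apply: (@Ck_continuous _ _ 0); apply: CkM; first exact: CkW cw.
    exact: Ck_ReL_hessian.
  by move=> x; apply: contra_neqP => xw; rewrite /g wE ?mul0r.
have : (\int[leb N]_x ((f x)%:E - (g x)%:E) = 0)%E.
  under eq_integral do rewrite -EFinB divE -sumEFin.
  rewrite integral_sum//; last by move=> i; case: (intH i).
  by rewrite big1// => i _; case: (intH i).
have fin h : (leb N).-integrable setT (EFin \o h) -> (\int[leb N]_x (h x)%:E \is a fin_num)%E.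
  by move=> /(integrable_fin_num measurableT).
rewrite (integralB_EFin measurableT int_f int_g).
suff conclude (b c : \bar R) : b \is a fin_num -> c \is a fin_num -> (b - c = 0)%E -> b = c.
  exact: conclude (fin _ int_f) (fin _ int_g).
clear; case: b c => [b| |] [c| |]//= _ _ /eqP.
by rewrite -EFinB eqe subr_eq0 => /eqP ->.
Qed.

End green.

(** * The quaternionic Hessian in real coordinates *)

Section baston_coordinates.
Variables (R : realType) (n : nat).
Local Notation C := R[i].
Local Notation point := 'rV[R]_(4 * n).
Local Notation eform := (eform R n).
Local Notation form := (Defs.form R n).
Local Notation o2 := (@omega2 R n).
Implicit Types (a : 'I_(n + n)) (i j : 'I_(4 * n)) (u : point -> R).

(** The operator nabla_{a alpha} is \sum_i ([nabla_coef alpha a i]) d_i. *)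
Definition nabla_coef (alpha : 'I_2) a i : C :=
  match fintype.split a, alpha == 0 with
  | inl l, true => (i == coordH l 0)%:R + 'i * (i == coordH l 1)%:R
  | inl l, false => - (i == coordH l 2)%:R - 'i * (i == coordH l 3)%:R
  | inr l, true => (i == coordH l 2)%:R - 'i * (i == coordH l 3)%:R
  | inr l, false => (i == coordH l 0)%:R - 'i * (i == coordH l 1)%:R
  end.

Lemma sum_delta (f : 'I_(4 * n) -> C) k : \sum_i (i == k)%:R * f i = f k.
Proof.
by rewrite (bigD1 k)//= eqxx mul1r big1 ?addr0// => i /negbTE->; rewrite mul0r.
Qed.

Lemma nabla_coefE alpha a (f : 'I_(4 * n) -> C) :
  \sum_i nabla_coef alpha a i * f i =
  match fintype.split a, alpha == 0 with
  | inl l, true  => f (coordH l 0) + 'i * f (coordH l 1)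
  | inl l, false => - f (coordH l 2) - 'i * f (coordH l 3)
  | inr l, true  => f (coordH l 2) - 'i * f (coordH l 3)
  | inr l, false => f (coordH l 0) - 'i * f (coordH l 1)
  end.
Proof.
rewrite /nabla_coef; case: (fintype.split a) => l; case: (alpha == 0).
all: under eq_bigr do rewrite ?mulrDl ?mulrBl ?mulNr -mulrA.
all: by rewrite ?sumrB ?big_split ?sumrN/= -?mulr_sumr !sum_delta.
Qed.

Lemma nablaE alpha a (f : point -> C) x :
  nabla a alpha f x = \sum_i nabla_coef alpha a i * cpartial i f x.
Proof. by rewrite nabla_coefE. Qed.

Lemma cpartial_sum i (J : finType) (c : J -> C) (g : J -> point -> R) x :
  (forall k, Ck 1 setT (g k)) ->
  cpartial i (fun y => \sum_k c k * (g k y)%:C) x = \sum_k c k * (partial i (g k) x)%:C.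
Proof.
move=> cg; have re (h : J -> R) : complex.Re (\sum_k c k * (h k)%:C) = \sum_k complex.Re (c k) * h k.
  by rewrite raddf_sum; apply: eq_bigr => k _; case: (c k) => ? ? /=; rewrite mulr0 subr0.
have im (h : J -> R) : complex.Im (\sum_k c k * (h k)%:C) = \sum_k complex.Im (c k) * h k.
  by rewrite raddf_sum; apply: eq_bigr => k _; case: (c k) => ? ? /=; rewrite mulr0 add0r.
rewrite /cpartial; under [fun y => complex.Re _]eq_fun do rewrite re.
under [fun y => complex.Im _]eq_fun do rewrite im.
have d (e : J -> R) : partial i (fun y => \sum_k e k * g k y) x = \sum_k e k * partial i (g k) x.
  rewrite (is_partialE (is_partial_sum _ (fun k => is_partialZ (e k) (Ck_is_partial i (cg k))))).
  by [].
by rewrite !d -re -im; case: (\sum_k _).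
Qed.

Lemma dform_sum alpha (J : finType) (y : J -> form) (g : J -> point -> R) x :
  (forall k, Ck 1 setT (g k)) ->
  dform alpha (fun x => \sum_k (g k x)%:C *: y k) x =
  \sum_k \sum_a \sum_i (nabla_coef alpha a i * (partial i (g k) x)%:C) *:
    ewedge (omega_form a) (y k).
Proof.
move=> cg; rewrite /dform.
have coefE I a : nabla a alpha (fun x => (\sum_k (g k x)%:C *: y k) I) x =
    \sum_k y k I * \sum_i nabla_coef alpha a i * (partial i (g k) x)%:C.
  rewrite (_ : (fun x => _) = fun x => \sum_k y k I * (g k x)%:C); last first.
    by apply/funext => z; rewrite sum_ffunE; apply: eq_bigr => k _; rewrite ffunE mulrC.
  rewrite nablaE; under eq_bigr do rewrite cpartial_sum// mulr_sumr.
  rewrite exchange_big; apply: eq_bigr => k _; rewrite mulr_sumr.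
  by apply: eq_bigr => i _; rewrite mulrCA.
under eq_bigr do under eq_bigr do rewrite coefE scaler_suml.
rewrite exchange_big; under eq_bigr do rewrite exchange_big.
rewrite exchange_big; apply: eq_bigr => k _; apply: eq_bigr => a _.
rewrite -scaler_suml [in RHS](form_sum (y k)) ewedge_sumr scaler_sumr.
by apply: eq_bigr => I _; rewrite ewedgeZr scalerA mulrC.
Qed.

(** The coefficient of d_i d_j in Delta = d_0 d_1. *)
Definition hess_basis i j : eform :=
  wedge1 o2 (nabla_coef 0 ^~ i) (nabla_coef 1 ^~ j).

Lemma hess_basis_swapl i j k l :
  hess_basis i j * hess_basis k l = - (hess_basis k j * hess_basis i l).
Proof. exact: (wedge1M (@omega2M R n)). Qed.

Lemma hess_basis_swapr i j k l :
  hess_basis i j * hess_basis k l = - (hess_basis i l * hess_basis k j).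
Proof. by rewrite hess_basis_swapl mulrC. Qed.

Lemma hess_basis_two (f : 'I_(4 * n) -> 'I_(4 * n) -> R) :
  \sum_i \sum_j (f i j)%:C *: hess_basis i j =
  \sum_a \sum_b (\sum_i nabla_coef 0 a i * \sum_j nabla_coef 1 b j * (f i j)%:C) *: o2 a b.
Proof.
rewrite /hess_basis /wedge1.
transitivity (\sum_i \sum_a \sum_b \sum_j
    (nabla_coef 0 a i * (nabla_coef 1 b j * (f i j)%:C)) *: o2 a b).
  apply: eq_bigr => i _.
  transitivity (\sum_j \sum_a \sum_b
      (nabla_coef 0 a i * (nabla_coef 1 b j * (f i j)%:C)) *: o2 a b).
    apply: eq_bigr => j _; rewrite scaler_sumr; apply: eq_bigr => a _.
    rewrite scaler_sumr; apply: eq_bigr => b _; rewrite scalerA.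
    by rewrite [in RHS]mulrA mulrC.
  rewrite exchange_big; apply: eq_bigr => a _.
  by rewrite exchange_big.
rewrite exchange_big; apply: eq_bigr => a _.
rewrite exchange_big; apply: eq_bigr => b _.
rewrite scaler_suml; apply: eq_bigr => i _.
by rewrite mulr_sumr scaler_suml.
Qed.

Lemma hessian_form_two u x : hessian_form hess_basis u x =
  \sum_a \sum_b (\sum_i nabla_coef 0 a i * \sum_j nabla_coef 1 b j *
    (partial i (partial j u) x)%:C) *: o2 a b.
Proof. exact: (hess_basis_two (fun i j => partial i (partial j u) x)). Qed.

(** The 1-form d_1 u is odd, so the computation runs among all forms and reaches the even algebra
    only after d_0. *)
Lemma baston_hessian_form u x : Ck 2 setT u ->
  baston u x = val (hessian_form hess_basis u x).
Proof.
move=> cu; have E1 : dform 1 (fun x => (Complex (u x) 0) *: (form1 : form)) =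
    fun y => \sum_(p : 'I_(n + n) * 'I_(4 * n))
      (partial p.2 u y)%:C *: (nabla_coef 1 p.1 p.2 *: omega_form p.1).
  have E0 : (fun x => (Complex (u x) 0) *: (form1 : form)) =
      fun x => \sum_(k < 1) (u x)%:C *: (form1 : form).
    by apply/funext => z; rewrite big_ord1.
  apply/funext => y; rewrite E0 dform_sum; last by move=> _; exact: CkW cu.
  rewrite big_ord1 pair_big; apply: eq_bigr => p _.
  by rewrite ewedge1r scalerA mulrC.
rewrite /baston E1 dform_sum; last by move=> p; exact: Ck_partial.
rewrite hessian_form_two.
rewrite (raddf_sum (val : eform -> form)) exchange_big; apply: eq_bigr => a _.
rewrite (raddf_sum (val : eform -> form)).
rewrite -(pair_big xpredT xpredT (fun b j => \sum_i (nabla_coef 0 a i * (partial i (partial j u) x)%:C)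
  *: ewedge (omega_form a) (nabla_coef 1 b j *: omega_form b)))/=; apply: eq_bigr => b _.
transitivity ((\sum_i nabla_coef 0 a i * \sum_j nabla_coef 1 b j *
    (partial i (partial j u) x)%:C) *: ewedge (omega_form a) (omega_form b)); last by [].
rewrite scaler_suml exchange_big; apply: eq_bigr => i _.
rewrite mulr_sumr scaler_suml; apply: eq_bigr => j _.
by rewrite ewedgeZr scalerA -mulrA [X in _ * X]mulrC.
Qed.

(** This is \sum_{c,d} h_cd e_c conj(e_d), where e_0, ..., e_3 are 1, i, j, k. *)
Definition quat_hess (h : 'I_4 -> 'I_4 -> R) : quat R :=
  Quat (h 0 0 + h 1 1 + h 2 2 + h 3 3) (h 1 0 - h 0 1 + h 3 2 - h 2 3)
       (h 2 0 - h 0 2 + h 1 3 - h 3 1) (h 3 0 - h 0 3 + h 2 1 - h 1 2).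

Lemma quat_hess_sum (h : 'I_4 -> 'I_4 -> R) :
  let P c := Quat (h c 0) (- h c 1) (- h c 2) (- h c 3) in
  P 0 + iq * P 1 + jq * P 2 + kq * P 3 = quat_hess h.
Proof. by congr Quat => /=; ring. Qed.

Lemma conjq_quat_hess (h : 'I_4 -> 'I_4 -> R) :
  conjq (quat_hess h) = quat_hess (fun c d => h d c).
Proof. by congr Quat => /=; ring. Qed.

Lemma qhessianE u x l k : Ck 2 setT u -> qhessian u x l k =
  quat_hess (fun c d => partial (coordH l c) (partial (coordH k d) u) x).
Proof.
move=> cu; rewrite mxE.
have p0 i (r : R) : partial i (fun _ : point => r) = fun=> 0.
  by rewrite (is_partialE (is_partial_cst i r)).
have -> : dq k (fun y => qreal (u y)) = fun y => Quat (partial (coordH k 0) u y)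
    (- partial (coordH k 1) u y) (- partial (coordH k 2) u y) (- partial (coordH k 3) u y).
  apply/funext => y; rewrite /dq /dqbar /qpartial /= !p0.
  move: (partial _ u y) (partial _ u y) (partial _ u y) (partial _ u y) => r0 r1 r2 r3.
  by congr Quat => /=; ring.
have pN i j y : partial i (fun z => - partial j u z) y = - partial i (partial j u) y.
  have := is_partialZ (-1) (Ck_is_partial i (Ck_partial j cu)).
  by move=> /is_partialE/(congr1 (fun f => f y)); rewrite mulN1r => <-;
    congr (partial _ _ _); apply/funext => z; rewrite mulN1r.
pose h c d := partial (coordH l c) (partial (coordH k d) u) x.
rewrite -[RHS](quat_hess_sum h) /dqbar.
have qpE c : qpartial (coordH l c) (fun y => Quat (partial (coordH k 0) u y)
    (- partial (coordH k 1) u y) (- partial (coordH k 2) u y) (- partial (coordH k 3) u y)) x =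
    Quat (h c 0) (- h c 1) (- h c 2) (- h c 3).
  by rewrite /qpartial; congr Quat; exact: pN.
by rewrite !qpE.
Qed.

Section symmetric_coefficients.
Variables (f : 'I_(4 * n) -> 'I_(4 * n) -> R) (fC : forall i j, f i j = f j i).
Variables l k : 'I_n.
Let d a b := \sum_i nabla_coef 0 a i * \sum_j nabla_coef 1 b j * (f i j)%:C.
Let h (c e : 'I_4) := f (coordH l c) (coordH k e).

(** For symmetric f, antisymmetrizing the coefficients of the omega^a /\ omega^b reproduces the z
    and w parts of the quaternionic Hessian entry, as [two_formE] requires. *)
Lemma nabla_coef_quat_hess :
  [/\ d (lshift n l) (rshift n k) - d (rshift n k) (lshift n l) = zq (quat_hess h),
      d (lshift n l) (lshift n k) - d (lshift n k) (lshift n l) = wq (quat_hess h) &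
      d (rshift n l) (rshift n k) - d (rshift n k) (rshift n l) = conjc (wq (quat_hess h))].
Proof.
rewrite /d; split; under [X in X - _]eq_bigr do rewrite nabla_coefE;
  under [X in _ - X]eq_bigr do rewrite nabla_coefE;
  rewrite !nabla_coefE ?split_lshift ?split_rshift/= !(fC (coordH k _)) -!/(h _ _);
  move: h => h'; by apply/eqP; rewrite eq_complex/=; apply/andP; split; apply/eqP; ring.
Qed.

End symmetric_coefficients.

Lemma hessian_form_qhessian u x : Ck 2 setT u ->
  hessian_form hess_basis u x = mx_form o2 (qhessian u x).
Proof.
move=> cu; rewrite hessian_form_two.
pose f i j := partial i (partial j u) x.
have fC i j : f i j = f j i by exact: partialC.
apply: (two_formE (@omega2C R n)) => l k; rewrite qhessianE//;
  case: (nabla_coef_quat_hess fC l k) => z w w'; [exact: z|exact: w|exact: w'].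
Qed.

Lemma qhessian_hyperhermitian u x : Ck 2 setT u -> hyperhermitian (qhessian u x).
Proof.
move=> cu; apply/matrixP => l k; rewrite mxE !qhessianE//.
rewrite conjq_quat_hess.
exact: (congr1 quat_hess (funext (fun c => funext (fun d => partialC _ _ _ cu)))).
Qed.

End baston_coordinates.

Section coordH_sums.
Variables (R : realType) (n : nat).

Lemma coordH_eq (l k : 'I_n) (c d : 'I_4) :
  (coordH l c == coordH k d) = (l == k) && (c == d).
Proof.
apply/eqP/andP => [/(congr1 val)/= E|[/eqP-> /eqP->]//].
have := ltn_ord c; have := ltn_ord d => ? ?.
by split; apply/eqP/val_inj => /=; lia.
Qed.

Lemma sum_coordH (V : nmodType) (F : 'I_(4 * n) -> V) :
  \sum_i F i = \sum_l \sum_c F (coordH l c).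
Proof.
rewrite pair_big/= (reindex (fun p : 'I_n * 'I_4 => coordH p.1 p.2))//.
have H1 (i : 'I_(4 * n)) : (i %/ 4 < n)%N by have := ltn_ord i; lia.
have H2 (i : 'I_(4 * n)) : (i %% 4 < 4)%N by rewrite ltn_pmod.
exists (fun i => (Ordinal (H1 i), Ordinal (H2 i))) => [[l c]|i] _.
  by have := ltn_ord c => ?; congr (_, _); apply/val_inj => /=; lia.
by apply/val_inj => /=; lia.
Qed.

Lemma sum_ord4 (V : nmodType) (f : 'I_4 -> V) : \sum_c f c = f 0 + f 1 + f 2 + f 3.
Proof.
rewrite !big_ord_recr big_ord0/= add0r.
by congr (f _ + f _ + f _ + f _); exact/val_inj.
Qed.

Lemma quat_hess_delta (l k : 'I_n) (r : R) :
  quat_hess (fun c d => r * (coordH l c == coordH k d)%:R) =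
  qreal (4 * r) * (l == k)%:R.
Proof.
rewrite /quat_hess !coordH_eq; case: eqP => _ /=.
  by rewrite !mulr1 !mulr0 /qreal; congr Quat; ring.
by rewrite !mulr0 -[RHS]/(qreal 0) /qreal; congr Quat; ring.
Qed.

Lemma quat_hess_rank_one (y z : 'I_4 -> R) (r : R) :
  quat_hess (fun c d => r * (y c * z d)) =
  qreal r * (Quat (y 0) (y 1) (y 2) (y 3) * conjq (Quat (z 0) (z 1) (z 2) (z 3))).
Proof. by congr Quat => /=; ring. Qed.

Lemma quat_hessD (g h : 'I_4 -> 'I_4 -> R) :
  quat_hess (fun c d => g c d + h c d) = quat_hess g + quat_hess h.
Proof. by congr Quat => /=; ring. Qed.

End coordH_sums.

(** * The Hessian of the regularized solution *)

Section hessian_of_Km_eps.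
Variables (R : realType) (n m : nat) (a : 'rV[R]_(4 * n)) (e : R).
Hypotheses (m0 : (0 < m)%N) (mn : (m <= n)%N) (e0 : 0 < e).
Local Notation kap := (@kappa R n m).
Local Notation K := (Km_eps m a e).
Local Notation rho x := (sqdist x a + e).

Lemma Ck_Km_eps k : Ck k setT K.
Proof.
rewrite (_ : K = fun q => - rho q `^ (- kap)); last exact/funext/Km_epsE.
by apply: CkN; exact: Ck_powR_sqdist.
Qed.

Lemma partial_Km_eps j :
  partial j K = fun x => 2 * kap * rho x `^ (- kap - 1) * (x ord0 j - a ord0 j).
Proof.
have H := is_partialZ (-1) (is_partial_powR_sqdist a j (- kap) e0).
rewrite (_ : K = fun q => -1 * rho q `^ (- kap)); last by apply/funext => q; rewrite Km_epsE mulN1r.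
by rewrite (is_partialE H); apply/funext => x; move: (_ `^ _) => r; ring.
Qed.

Lemma partial2_Km_eps i j x :
  partial i (partial j K) x =
  2 * kap * rho x `^ (- kap - 1) * (i == j)%:R +
  - (4 * kap * (kap + 1) * rho x `^ (- kap - 2)) *
    ((x ord0 i - a ord0 i) * (x ord0 j - a ord0 j)).
Proof.
have H := is_partialM (is_partialZ (2 * kap) (is_partial_powR_sqdist a i (- kap - 1) e0))
  (is_partial_coord i j (a ord0 j)).
rewrite partial_Km_eps (is_partialE H) (_ : - kap - 1 - 1 = - kap - 2); last by ring.
by move: (_ `^ (_ - 2)) (_ `^ (_ - 1)) => r s; ring.
Qed.

Definition qvec (x : 'rV[R]_(4 * n)) : 'cV[quat R]_n :=
  \col_l let y c := x ord0 (coordH l c) - a ord0 (coordH l c) in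
    Quat (y 0) (y 1) (y 2) (y 3).

Lemma qnorm2_qvec x : \sum_l qnorm2 (qvec x l ord0) = sqdist x a.
Proof.
rewrite /sqdist [RHS]sum_coordH; apply: eq_bigr => /= l _.
by rewrite mxE sum_ord4.
Qed.

Lemma qhessian_Km_eps x : qhessian K x =
  qreal (8 * kap * rho x `^ (- kap - 1)) *: 1%:M +
  qreal (- (4 * kap * (kap + 1) * rho x `^ (- kap - 2))) *: (qvec x *m adjmx (qvec x)).
Proof.
apply/matrixP => l k; rewrite qhessianE; last exact: Ck_Km_eps.
rewrite !mxE big_ord1 !mxE.
under [fun c d => _]eq_fun => c do under eq_fun => d do rewrite partial2_Km_eps.
rewrite quat_hessD quat_hess_delta.
rewrite (quat_hess_rank_one (fun c => x ord0 (coordH l c) - a ord0 (coordH l c))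
  (fun c => x ord0 (coordH k c) - a ord0 (coordH k c))).
by rewrite !mulrA -natrM.
Qed.

(** From kappa + 1 = 2n/m and n C(n-1, m-1) = m C(n, m). *)
Lemma binomial_kappa : 'C(n.-1, m.-1)%:R * (kap + 1) = 2 * 'C(n, m)%:R :> R.
Proof.
have := mul_bin_diag n m.-1; rewrite prednK// => /(congr1 (fun k => k%:R : R)).
have m0' : m%:R != 0 :> R by rewrite pnatr_eq0 -lt0n.
rewrite !natrM /kappa subrK natrM => E.
transitivity (2 / m%:R * (n%:R * 'C(n.-1, m.-1)%:R) : R); first by field.
by rewrite E; field.
Qed.

(** With r = rho^(-kappa-2), [binomial_kappa] merges the two terms of H_m: the last factor is t + 8
    kappa (rho - |q-a|^2) r, and rho - |q-a|^2 = e. The shift by t is the one in the definition of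
    Gamma_m. *)
Lemma hess_op_Km_eps_shift x t : 0 <= t ->
  hess_op m ((qreal t)%:M + qhessian K x) =
  'C(n, m)%:R * (t + 8 * kap * rho x `^ (- kap - 1)) ^+ m.-1 *
    (t + 8 * kap * e * rho x `^ (- kap - 2)).
Proof.
move=> t0; rewrite qhessian_Km_eps -(scalemx1 _ (qreal t)) addrA -scalerDl.
rewrite -qrealD.
rewrite hess_op_scalar_rank_one// qnorm2_qvec.
have rx : 0 < rho x by exact: sqdistD_gt0.
have -> : rho x `^ (- kap - 1) = rho x * rho x `^ (- kap - 2).
  rewrite -[X in X * _]powRr1 ?(ltW rx)// -powRD; last by rewrite (gt_eqF rx) implybT.
  by congr (_ `^ _); ring.
have := binomial_kappa; rewrite -[in X in _ * _ ^+ X](prednK m0) exprS.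
move: (X in X ^+ m.-1) => X.
move: ('C(n.-1, m.-1)%:R : R) ('C(n, m)%:R : R) (rho x `^ _) (X ^+ m.-1) => b1 b2 r P E.
have -> : b1 * P * - (4 * kap * (kap + 1) * r) * sqdist x a =
    - (4 * kap * (b1 * (kap + 1)) * r) * P * sqdist x a by ring.
by rewrite E; ring.
Qed.

Lemma Gamma_cone_Km_eps x : Gamma_cone m (qhessian K x).
Proof.
have k0 : 0 < kap by exact: lt_le_trans ltr01 (kappa_ge1 R m0 mn).
have rx : 0 < rho x by exact: sqdistD_gt0.
split; first exact: qhessian_hyperhermitian (Ck_Km_eps 2).
move=> t t0; rewrite hess_op_Km_eps_shift//.
rewrite mulr_gt0// ?mulr_gt0 ?exprn_gt0// ?ltr0n ?bin_gt0//.
- by rewrite ltr_wpDl// !mulr_gt0// powR_gt0.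
- by rewrite ltr_wpDl// !mulr_gt0// powR_gt0.
Qed.

(** At t = 0 the exponents of 1/rho add up to (kappa + 1)(m - 1) + kappa + 2 = (kappa + 1) m + 1 =
    2n + 1. *)
Lemma hessian_op_Km_eps x : hessian_op m K x =
  'C(n, m)%:R * (8 * kap) ^+ m * (e * (rho x) ^- (2 * n).+1).
Proof.
have rx : 0 < rho x by exact: sqdistD_gt0.
have m0' : m%:R != 0 :> R by rewrite pnatr_eq0 -lt0n.
have := @hess_op_Km_eps_shift x 0 (lexx _).
rewrite -[(qreal 0)%:M]/(0%:M) raddf0 add0r /hessian_op => ->; rewrite !add0r.
have -> : rho x ^- (2 * n).+1 = rho x `^ (- kap - 1) ^+ m.-1 * rho x `^ (- kap - 2).
  rewrite -[_ ^+ m.-1]powR_mulrn ?powR_ge0// -powRrM -powRD; last by rewrite (gt_eqF rx) implybT.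
  rewrite -powR_invn ?(ltW rx)//; congr (_ `^ _).
  have -> : (2 * n).+1%:R = (kap + 1) * m%:R + 1 :> R.
    by rewrite /kappa subrK divfK// natr1.
  have -> : m%:R = m.-1%:R + 1 :> R by rewrite natr1 prednK.
  ring.
have -> : (8 * kap) ^+ m = 8 * kap * (8 * kap) ^+ m.-1 by rewrite -exprS prednK.
by rewrite exprMn; ring.
Qed.

End hessian_of_Km_eps.

(** * The two assertions *)

Section approximate_identity.
Variables (R : realType) (n : nat) (a : 'rV[R]_(4 * n)).
Local Notation point := 'rV[R]_(4 * n).
Local Notation leb := (lebesgue_rV R (4 * n)).
Implicit Types (e : R) (q : point).

(* H_m(K_{m,e}) up to a constant factor. *)
Definition bubble e q : R := e * (sqdist q a + e) ^- (2 * n).+1.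

Lemma bubble_ge0 e q : 0 < e -> 0 <= bubble e q.
Proof.
by move=> e0; rewrite mulr_ge0 ?invr_ge0 ?exprn_ge0 ?addr_ge0 ?sqdist_ge0 ?(ltW e0).
Qed.

Lemma measurable_bubble e : 0 < e -> measurable_fun setT (bubble e).
Proof.
move=> e0; apply: continuous_rV_measurable.
rewrite (_ : bubble e = fun q => e * (sqdist q a + e) `^ (- (2 * n).+1%:R)); last first.
  by apply/funext => q; rewrite /bubble powR_invn ?(ltW (sqdistD_gt0 a q e0)).
by apply: (@Ck_continuous _ _ 0); apply: CkM; [exact: Ck_cst|exact: Ck_powR_sqdist].
Qed.

Definition bubble_mass : R := pi ^+ (2 * n) / (2 * n)`!%:R.

Lemma integral_bubble e : 0 < e -> (\int[leb]_q (bubble e q)%:E = bubble_mass%:E)%E.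
Proof.
move=> e0; under eq_integral do rewrite EFinM.
rewrite ge0_integralZl//; last 3 first.
- apply/measurable_EFinP; rewrite (_ : (fun _ => _) = fun q => e^-1 * bubble e q).
    by apply: measurable_funM => //; exact: measurable_bubble.
  by apply/funext => q; rewrite mulKf// gt_eqF.
- by move=> q _; rewrite lee_fin invr_ge0 exprn_ge0// ltW// sqdistD_gt0.
- by rewrite lee_fin ltW.
rewrite integral_potential_invSn// -EFinM; congr (_%:E); rewrite /bubble_mass.
have f0 : (2 * n)`!%:R != 0 :> R by rewrite pnatr_eq0 -lt0n fact_gt0.
by field; rewrite f0 gt_eqF.
Qed.

Lemma integrable_bubble e : 0 < e -> leb.-integrable setT (EFin \o bubble e).
Proof.
move=> e0; apply/integrableP; split.
  by apply/measurable_EFinP; exact: measurable_bubble.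
under eq_integral do rewrite /= ger0_norm ?bubble_ge0//.
by rewrite integral_bubble// ltry.
Qed.

(** If |q-a|^2 >= d then |q-a|^2 + 1 <= (1 + 1/d) (|q-a|^2 + e). Away from a the bubbles are thus
    O(e) times a fixed integrable function. *)
Lemma bubble_far (d : R) : 0 < d -> exists2 D, 0 <= D &
  forall e q, 0 < e -> d <= sqdist q a -> bubble e q <= D * e * bubble 1 q.
Proof.
move=> d0; exists ((1 + d^-1) ^+ (2 * n).+1) => [|e q e0 dq].
  by rewrite exprn_ge0// addr_ge0// invr_ge0 ltW.
have s0 : 0 < sqdist q a by exact: lt_le_trans dq.
rewrite /bubble mul1r [_ * e]mulrC -mulrA ler_wpM2l ?(ltW e0)//.
rewrite -!exprVn -exprMn lerXn2r ?nnegrE ?mulr_ge0 ?invr_ge0 ?addr_ge0 ?invr_ge0 ?(ltW d0) ?(ltW s0) ?(ltW e0)//.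
rewrite ler_pdivlMr ?ltr_wpDl ?(ltW s0)// mulrC ler_pdivrMr ?sqdistD_gt0//.
rewrite mulrDl mul1r mulrDr -addrA lerD2l.
have : 1 <= d^-1 * sqdist q a by rewrite mulrC ler_pdivlMr// mul1r.
have : 0 <= d^-1 * e by rewrite mulr_ge0 ?invr_ge0 ?(ltW d0) ?(ltW e0).
have := e0; lra.
Qed.

Lemma continuous_near_sqdist (phi : point -> R) (eta : R) : continuous phi -> 0 < eta ->
  exists2 d : R, 0 < d & forall q, sqdist q a < d -> `|phi q - phi a| <= eta.
Proof.
move=> cphi eta0; have /cvgrPdist_le/(_ _ eta0) := cphi a.
move=> /nbhs_ballP[r/= r0 H]; exists (r ^+ 2); first by rewrite exprn_gt0.
move=> q qa; rewrite distrC; apply: H; split=> // i j; rewrite /ball/= ord1.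
rewrite -(ltr_pXn2r (ltn0Sn 1))// ?nnegrE// ?(ltW r0)//.
rewrite real_normK ?num_real//; apply: le_lt_trans qa.
rewrite /sqdist (bigD1 j)//= -[leLHS]addr0 lerD//.
  by rewrite -[leLHS]sqrrN opprB.
by apply: sumr_ge0 => k _; exact: sqr_ge0.
Qed.

Lemma integrable_bubbleM (phi : point -> R) M e : continuous phi ->
  (forall q, `|phi q| <= M) -> 0 < e ->
  leb.-integrable setT (EFin \o (fun q => phi q * bubble e q)).
Proof.
move=> cphi phiM e0.
apply: (le_integrable measurableT _ _ (integrableZl measurableT M (integrable_bubble e0))).
  apply/measurable_EFinP; apply: measurable_funM; last exact: measurable_bubble.
  exact: continuous_rV_measurable.
move=> q _; rewrite /= lee_fin !normrM ler_wpM2r//.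
by rewrite (le_trans (phiM q))// ler_norm.
Qed.

(** Near a, phi differs from phi(a) by at most eta; elsewhere by at most 2 M, and [bubble_far]
    compares the bubble with the one for e = 1, which has the same mass. *)
Lemma bubble_approx (phi : point -> R) M (eta : R) : continuous phi ->
  (forall q, `|phi q| <= M) -> 0 < eta -> exists2 D : R, 0 <= D & forall e, 0 < e ->
  `|fine (\int[leb]_q (phi q * bubble e q)%:E) - phi a * bubble_mass| <=
    (eta + D * e) * bubble_mass.
Proof.
move=> cphi phiM eta0; have [d d0 H] := continuous_near_sqdist cphi eta0.
have [D D0 HD] := bubble_far d0.
have M0 : 0 <= M by exact: le_trans (phiM a).
exists (2 * M * D) => [|e e0]; first by rewrite !mulr_ge0.
have iphi := integrable_bubbleM cphi phiM e0.
have ib := integrable_bubble e0; have ib1 := integrable_bubble (@ltr01 R).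
have fphi : (\int[leb]_q (phi q * bubble e q)%:E \is a fin_num)%E.
  exact: integrable_fin_num iphi.
have cst_cont (c : R) : continuous (fun _ : point => c) by exact: cst_continuous.
have ic := integrable_bubbleM (cst_cont (phi a)) (fun=> phiM a) e0.
have cdiff : continuous (fun q => phi q - phi a).
  by apply: (continuous_add cphi); exact: cst_cont.
have diffM q : `|phi q - phi a| <= 2 * M.
  by rewrite mulr_natl mulr2n (le_trans (ler_normB _ _))// lerD.
have idiff := integrable_bubbleM cdiff diffM e0.
have E : ((fine (\int[leb]_q (phi q * bubble e q)%:E) - phi a * bubble_mass)%:E =
    \int[leb]_q ((phi q - phi a) * bubble e q)%:E)%E.
  rewrite EFinB fineK//.
  have <- : (\int[leb]_q (phi a * bubble e q)%:E = (phi a * bubble_mass)%:E)%E.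
    under eq_integral do rewrite EFinM.
    by rewrite (integralZl measurableT ib) integral_bubble.
  rewrite -(integralB_EFin measurableT iphi ic).
  by apply: eq_integral => q _; rewrite -EFinB mulrBl.
rewrite -lee_fin -abse_EFin E.
apply: le_trans (le_abse_integral _ measurableT (measurable_int _ idiff)) _.
have mb r : 0 < r -> measurable_fun setT (EFin \o bubble r).
  by move=> r0; apply/measurable_EFinP; exact: measurable_bubble.
have b0 r q : 0 < r -> (0 <= (bubble r q)%:E)%E by move=> r0; rewrite lee_fin bubble_ge0.
have MDe : 0 <= 2 * M * D * e by rewrite !mulr_ge0// ltW.
apply: (@le_trans _ _ (\int[leb]_q (eta%:E * (bubble e q)%:E +
    (2 * M * D * e)%:E * (bubble 1 q)%:E))%E).
  apply: ge0_le_integral => //.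
  - exact: measurableT_comp (measurable_int _ idiff).
  - by apply: emeasurable_funD; apply: measurable_funeM; exact: mb.
  - move=> q _; rewrite -!EFinM -EFinD /= lee_fin normrM (ger0_norm (bubble_ge0 q e0)).
    have [qd|qd] := ltP (sqdist q a) d.
      rewrite ler_wpDr ?ler_wpM2r ?bubble_ge0 ?H//.
      by rewrite mulr_ge0 ?bubble_ge0.
    have eb : 0 <= eta * bubble e q by apply: mulr_ge0; [exact: ltW|exact: bubble_ge0].
    rewrite ler_wpDl//.
    have -> : 2 * M * D * e * bubble 1 q = 2 * M * (D * e * bubble 1 q) by rewrite !mulrA.
    by rewrite ler_pM ?bubble_ge0// HD.
rewrite ge0_integralD//; last 4 first.
- by move=> q _; rewrite mule_ge0 ?b0// lee_fin ltW.
- by apply: measurable_funeM; exact: mb.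
- by move=> q _; rewrite mule_ge0 ?b0.
- by apply: measurable_funeM; exact: mb.
rewrite !ge0_integralZl ?lee_fin ?(ltW eta0)//; try exact: mb; try by move=> q _; exact: b0.
by rewrite (integral_bubble e0) (integral_bubble ltr01) -!EFinM -EFinD -mulrDl lexx.
Qed.

End approximate_identity.

Section dirac.
Variables (R : realType) (n m : nat) (a : 'rV[R]_(4 * n)).
Hypotheses (m0 : (0 < m)%N) (mn : (m <= n)%N).

Lemma CmnE : @Cmn R n m = 'C(n, m)%:R * (8 * @kappa R n m) ^+ m * bubble_mass R n.
Proof.
rewrite /Cmn /bubble_mass exprMn -(bin_fact mn) !natrM.
have f0 k : k`!%:R != 0 :> R by rewrite pnatr_eq0 -lt0n fact_gt0.
by move: (@kappa R n m ^+ m) => K; field; rewrite !f0.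
Qed.

Lemma hessian_op_Km_dirac : hessian_op_Km_eq_dirac m a (@Cmn R n m).
Proof.
move=> phi [Cphi Kphi _]; have cphi := Ck_continuous (Cphi 0).
have [M phiM] := continuous_compact_supp_bounded cphi Kphi (fun x => @supp_neq0 _ _ phi x).
rewrite integral_dirac//; last first.
  by apply/measurable_EFinP; exact: continuous_rV_measurable.
rewrite diracT mul1e -EFinM CmnE.
set C : R := 'C(n, m)%:R * _.
pose J e := fine (\int[lebesgue_rV R (4 * n)]_q (phi q * bubble a e q)%:E).
have JE : \forall e \near 0^'+, (C * J e)%:E =
    (\int[lebesgue_rV R (4 * n)]_q (phi q * hessian_op m (Km_eps m a e) q)%:E)%E.
  near=> e; have e0 : 0 < e by near: e; exact: nbhs_right_gt.
  have ib := integrable_bubbleM a cphi phiM e0.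
  rewrite EFinM fineK; last exact: integrable_fin_num ib.
  rewrite -(integralZl measurableT ib); apply: eq_integral => q _.
  by rewrite -EFinM hessian_op_Km_eps// mulrCA.
apply: (cvg_trans (near_eq_cvg JE)); apply: cvg_EFin.
  exact: nearW.
rewrite -[X in _ --> X]mulrA [bubble_mass _ _ * _]mulrC.
apply: cvgM; first exact: cvg_cst.
apply/cvgrPdist_le => eps eps0.
have B0 : 0 < bubble_mass R n by rewrite divr_gt0 ?exprn_gt0 ?pi_gt0// ltr0n fact_gt0.
(* Half of eps pays for the oscillation of phi near a, the other half for the tail. *)
pose eta := eps / (2 * bubble_mass R n).
have eta0 : 0 < eta by rewrite divr_gt0// mulr_gt0.
have [D D0 HD] := bubble_approx a cphi phiM eta0.
near=> e; have e0 : 0 < e by near: e; exact: nbhs_right_gt.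
have De : e <= eta / (D + 1).
  by near: e; apply: nbhs_right_le; rewrite divr_gt0// ltr_wpDl.
rewrite distrC (le_trans (HD e e0))//.
have : D * e <= eta.
  rewrite (le_trans (ler_wpM2l D0 De))// mulrCA ler_piMr ?(ltW eta0)//.
  by rewrite ler_pdivrMr ?mul1r ?lerDl// ltr_wpDl.
move=> De2; rewrite (@le_trans _ _ ((eta + eta) * bubble_mass R n))//.
  by rewrite ler_pM2r// lerD2l.
rewrite /eta le_eqVlt; apply/orP; left; apply/eqP; field.
by rewrite gt_eqF.
Unshelve. all: end_near. Qed.

End dirac.

Lemma prod_replace (I : finType) (A : comPzRingType) (f g : I -> A) j (y : A) :
  (forall i, i != j -> g i = f i) ->
  \prod_i g i * y = g j * (\prod_(i | i != j) f i * y).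
Proof. by move=> gf; rewrite (bigD1 j)//= -mulrA (eq_bigr f). Qed.

Section closure_Gamma.
Variable R : realType.

Lemma continuous_mx_entry (T : topologicalType) m n (i : 'I_m) (j : 'I_n) :
  continuous (fun M : 'M[T]_(m, n) => M i j).
Proof.
move=> M A /= MA; exists (fun i' j' => [set x | (i' == i) && (j' == j) -> A x]).
  move=> i' j' /=; case: (boolP ((i' == i) && (j' == j))) => [/andP[/eqP-> /eqP->]|_].
    by apply: filterS MA => x Ax _.
  exact: nearW.
by move=> B /(_ i j)/=; rewrite !eqxx; exact.
Qed.

Lemma continuous_quat_to_tuple : continuous (@quat_to_tuple R).
Proof. exact: initial_continuous. Qed.

Lemma continuous_quat_coords :
  [/\ continuous (@qre R), continuous (@qi R), continuous (@qj R) & continuous (@qk R)].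
Proof.
split=> q; have c := @continuous_quat_to_tuple q.
- exact: (cvg_comp _ _ (cvg_comp _ _ (cvg_comp _ _ c cvg_fst) cvg_fst) cvg_fst).
- exact: (cvg_comp _ _ (cvg_comp _ _ (cvg_comp _ _ c cvg_fst) cvg_fst) cvg_snd).
- exact: (cvg_comp _ _ (cvg_comp _ _ c cvg_fst) cvg_snd).
- exact: (cvg_comp _ _ c cvg_snd).
Qed.

Section mx_form_coordinates.
Variables (n : nat) (A : comAlgType R[i]) (o2 : 'I_(n + n) -> 'I_(n + n) -> A).
Variables (L : {scalar A}) (Y : A).
Local Notation ReL y := (complex.Re (L y)).

(** Real linearity in q over the basis 1, i, j, k reduces continuity to that of the four real
    coordinates, which define the topology of [quat]. *)
Lemma Re_entry_form l k q : ReL (entry_form o2 l k q * Y) =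
  qre q * ReL (entry_form o2 l k 1 * Y) + qi q * ReL (entry_form o2 l k iq * Y) +
  qj q * ReL (entry_form o2 l k jq * Y) + qk q * ReL (entry_form o2 l k kq * Y).
Proof.
have qE : q = qreal (qre q) * 1 + qreal (qi q) * iq + qreal (qj q) * jq + qreal (qk q) * kq.
  by case: q => a b c d; congr Quat => /=; ring.
have ReZ (r : R) x : ReL ((r%:C *: x) * Y) = r * ReL (x * Y).
  by rewrite -scalerAl linearZ/=; case: (L _) => b c /=; rewrite mul0r subr0.
have ReD x y : ReL ((x + y) * Y) = ReL (x * Y) + ReL (y * Y).
  by rewrite mulrDl !raddfD.
move: (qre q) (qi q) (qj q) (qk q) qE => b c d e ->.
rewrite 3!entry_formD 3!ReD 4!entry_formZ.
by rewrite 4!ReZ.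
Qed.

Lemma continuous_Re_mx_form : continuous (fun M : 'M[quat R]_n => ReL (mx_form o2 M * Y)).
Proof.
have -> : (fun M : 'M[quat R]_n => ReL (mx_form o2 M * Y)) =
    fun M => \sum_l \sum_k ReL (entry_form o2 l k (M l k) * Y).
  apply/funext => M; rewrite /mx_form mulr_suml !raddf_sum; apply: eq_bigr => l _.
  by rewrite mulr_suml !raddf_sum.
apply: continuous_big => [|l _]; first exact: add_continuous.
apply: continuous_big => [|k _]; first exact: add_continuous.
under eq_fun do rewrite Re_entry_form.
have cM : continuous (fun M : 'M[quat R]_n => M l k) by exact: continuous_mx_entry.
have cZ (g : quat R -> R) (r : R) : continuous g ->
    continuous (fun M : 'M[quat R]_n => g (M l k) * r).
  move=> cg M; have cgM : {for M, continuous (fun M : 'M[quat R]_n => g (M l k))}.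
    exact: (cvg_comp _ _ (cM M) (cg (M l k))).
  have := @continuousM _ _ (fun M : 'M[quat R]_n => g (M l k)) (fun=> r) M cgM (@cst_continuous _ _ r M).
  by rewrite /mul_fun.
have cD (f g : 'M[quat R]_n -> R) : continuous f -> continuous g ->
    continuous (fun M => f M + g M).
  by move=> cf cg M; exact: (@continuousD _ _ _ f g M (cf M) (cg M)).
have [cr ci cj ck] := continuous_quat_coords.
exact: (cD _ _ (cD _ _ (cD _ _ (cZ _ _ cr) (cZ _ _ ci))
  (cZ _ _ cj)) (cZ _ _ ck)).
Qed.

End mx_form_coordinates.

Variables (n m : nat).
Hypotheses (m0 : (0 < m)%N) (mn : (m <= n)%N).
Local Notation o2 := (@omega2 R n).

(** The mixed product is continuous in each matrix separately, so positivity on Gamma_m becomes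
    nonnegativity on the closure one factor at a time. *)
Lemma mixed_top_closure_ge0 (M : 'I_m.-1 -> 'M[quat R]_n) (M' : 'M[quat R]_n) :
  (forall i, closure (Gamma_cone m) (M i)) -> Gamma_cone m M' ->
  0 <= complex.Re (mixed_top (fun i => mx_form o2 (M i)) (mx_form o2 M')).
Proof.
move=> HM HM'.
(* Factors of index at least k lie in Gamma_m itself, the earlier ones in its closure. *)
suff H k (X : 'I_m.-1 -> 'M[quat R]_n) : (forall i, closure (Gamma_cone m) (X i)) ->
    (forall i : 'I_m.-1, (k <= i)%N -> Gamma_cone m (X i)) ->
    0 <= complex.Re (mixed_top (fun i => mx_form o2 (X i)) (mx_form o2 M')).
  by apply: (H m.-1) => // i; rewrite leqNgt ltn_ord.
elim: k X => [|k IH] X cX gX.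
  have := mixed_top_gt0 m0 mn (fun i => gX i (leq0n _)) HM'.
  by rewrite ltcE => /andP[_ /ltW].
have [km|km] := ltnP k m.-1; last first.
  by apply: IH => // i ki; have := ltn_ord i; rewrite ltnNge (leq_trans km ki).
pose j := Ordinal km.
pose Y := \prod_(i | i != j) mx_form o2 (X i) * (ebeta o2 ^+ (n - m) * mx_form o2 M').
pose X' Z i := if i == j then Z else X i.
have XX' Z i : i != j -> mx_form o2 (X' Z i) = mx_form o2 (X i).
  by rewrite /X' => /negbTE ->.
have E Z : mixed_top (fun i => mx_form o2 (X' Z i)) (mx_form o2 M') =
    top_form (mx_form o2 Z * Y).
  rewrite (_ : mx_form o2 Z = mx_form o2 (X' Z j)); last by rewrite /X' eqxx.
  exact: (congr1 (@top_form R n) (prod_replace _ (XX' Z))).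
have XE : X = X' (X j) by apply/funext => i; rewrite /X'; case: eqP => [->|].
rewrite XE E; have cl : closed [set Z | 0 <= complex.Re (top_form (mx_form o2 Z * Y))].
  apply: (@closed_comp _ _ (fun Z => complex.Re (top_form (mx_form o2 Z * Y))) [set r : R | 0 <= r]).
    by move=> Z _; exact: continuous_Re_mx_form.
  exact: closed_ge.
have /closure_id E' := cl.
suff : [set Z | 0 <= complex.Re (top_form (mx_form o2 Z * Y))] (X j) by [].
rewrite E'; apply: closure_subset (cX j) => Z gZ /=.
rewrite -E; apply: IH => i.
  by rewrite /X'; case: eqP => // _; exact: subset_closure.
rewrite /X'; case: eqP => [//|/eqP ij] ki; apply: gX.
by rewrite ltn_neqAle ki andbT; apply: contra ij => /eqP ki'; apply/eqP/val_inj.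
Qed.

End closure_Gamma.

(** * Nonnegativity of the integral of K_m *)

Section quaternionic_subharmonicity.
Variables (R : realType) (n m : nat) (a : 'rV[R]_(4 * n)).
Hypotheses (m0 : (0 < m)%N) (mn : (m <= n)%N).
Local Notation point := 'rV[R]_(4 * n).
Local Notation leb := (lebesgue_rV R (4 * n)).
Local Notation hess := (hessian_form (@hess_basis R n)).
Variable v : 'I_m.-1 -> point -> R.
Hypothesis Cv : forall i, Ck 4 setT (v i).

Let F x : eform R n := \prod_i hess (v i) x * ebeta (@omega2 R n) ^+ (n - m).

Lemma divfree_F : divfree (@hess_basis R n) F.
Proof.
apply: divfree_mul; last exact: divfree_cst.
apply: divfree_prod => i; apply: divfree_hessian; last exact: CkW (Cv i).
- exact: hess_basis_swapl.
- exact: hess_basis_swapr.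
Qed.

Lemma top_coef_mixed_form (w : point -> R) x : Ck 2 setT w ->
  top_coef (@mixed_form R n m v w x) = top_form (F x * hess w x).
Proof.
move=> cw; rewrite /mixed_form (baston_hessian_form x cw).
have -> : \big[ewedge/form1]_(i < m.-1) baston (v i) x =
    \big[ewedge/form1]_(i < m.-1) val (hess (v i) x).
  by apply: eq_bigr => i _; apply: baston_hessian_form; exact: CkW (Cv i).
by rewrite mixed_top_coef /mixed_top mulrA.
Qed.

Lemma top_form_mixed_top (w : point -> R) x : Ck 2 setT w ->
  top_form (F x * hess w x) =
  mixed_top (fun i => mx_form (@omega2 R n) (qhessian (v i) x)) (mx_form (@omega2 R n) (qhessian w x)).
Proof.
move=> cw; rewrite /F -mulrA /mixed_top (hessian_form_qhessian x cw).
congr (top_form (_ * _)); apply: eq_bigr => i _.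
by apply: hessian_form_qhessian; exact: CkW (Cv i).
Qed.

Lemma top_coef_mixed_form_real (w : point -> R) x : Ck 2 setT w ->
  complex.Im (top_coef (@mixed_form R n m v w x)) = 0.
Proof.
move=> cw; rewrite top_coef_mixed_form// top_form_mixed_top//.
have cv2 i : Ck 2 setT (v i) by exact: CkW (Cv i).
have := mixed_top_real m0 mn (fun i => qhessian_hyperhermitian x (cv2 i)) (qhessian_hyperhermitian x cw).
move: (mixed_top _ _) => z; rewrite realE !lecE/= => /orP[] /andP[/eqP zi _] //.
Qed.

Hypothesis sv : forall i x, closure (Gamma_cone m) (qhessian (v i) x).

Lemma integral_Km_eps_mixed_ge0 e (w : point -> R) : 0 < e ->
  test_function setT w -> (forall x, 0 <= w x) ->
  (0 <= \int[leb]_x (Km_eps m a e x * complex.Re (top_coef (@mixed_form R n m v w x)))%:E)%E.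
Proof.
move=> e0 [Cw Kw _] w0; have CK k := Ck_Km_eps m a e0 k.
have -> : (\int[leb]_x (Km_eps m a e x * complex.Re (top_coef (@mixed_form R n m v w x)))%:E =
    \int[leb]_x (Km_eps m a e x * complex.Re (top_form (F x * hess w x)))%:E)%E.
  by apply: eq_integral => x _; rewrite top_coef_mixed_form.
rewrite (hessian_green (@top_form R n) divfree_F (CK 2) (Cw 2) Kw).
apply: integral_ge0 => x _; rewrite lee_fin; apply: mulr_ge0 => //.
suff : 0 <= complex.Re (top_form (F x * hess (Km_eps m a e) x)) by [].
rewrite (top_form_mixed_top x (CK 2)).
by apply: mixed_top_closure_ge0 => //; exact: Gamma_cone_Km_eps.
Qed.

Lemma continuous_mixed (w : point -> R) : Ck 2 setT w ->
  continuous (fun x => complex.Re (top_coef (@mixed_form R n m v w x))).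
Proof.
move=> cw; have -> : (fun x => complex.Re (top_coef (@mixed_form R n m v w x))) =
    fun x => complex.Re (top_form (F x * hess w x)).
  by apply/funext => x; rewrite top_coef_mixed_form.
exact: (Ck_continuous (Ck_ReL_hessian (@top_form R n) divfree_F cw)).
Qed.

Lemma mixed_supp (w : point -> R) x : Ck 2 setT w -> ~ supp w x ->
  complex.Re (top_coef (@mixed_form R n m v w x)) = 0.
Proof.
move=> cw xw; rewrite top_coef_mixed_form// ReL_hessian big1// => p _.
rewrite big1// => q _; suff -> : partial p (partial q w) x = 0 by rewrite mul0r.
by apply/eqP/negPn/negP => /partial2_supp.
Qed.

(** Dominated convergence along e = 1/(k+1): |K_{m,e}| <= |K_m|, and the density is bounded and
    vanishes off the support of w, on which K_m is integrable. *)
Lemma integral_Km_mixed_ge0 (w : point -> R) :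
  test_function setT w -> (forall x, 0 <= w x) ->
  (0 <= \int[leb]_x (Km m a x * (complex.Re (top_coef (@mixed_form R n m v w x)))%:E))%E.
Proof.
move=> tw w0; have [Cw Kw _] := tw.
pose h x := complex.Re (top_coef (@mixed_form R n m v w x)).
have ch : continuous h by exact: continuous_mixed (Cw 2).
have h0 x : ~ supp w x -> h x = 0 by exact: mixed_supp (Cw 2).
have mh : measurable_fun setT h by exact: continuous_rV_measurable.
have [B hB] : exists B, forall x, `|h x| <= B.
  apply: (continuous_compact_supp_bounded ch Kw) => x hx.
  by apply: contrapT => /h0 hx0; rewrite hx0 eqxx in hx.
have mK : measurable (supp w) by apply: closed_rV_measurable; exact: closed_closure.
pose eps k : R := k.+1%:R^-1.
have eps0 k : 0 < eps k by rewrite invr_gt0 ltr0n.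
have restrict (f : point -> \bar R) :
    (\int[leb]_x (f x * (h x)%:E) = \int[leb]_(x in supp w) (f x * (h x)%:E))%E.
  rewrite [RHS]integral_mkcond; apply: eq_integral => x _; rewrite patchE.
  by case: ifPn => //; rewrite notin_setE => /h0 ->; rewrite mule0.
have iKm := L1loc_Km a m0 mn Kw (fun x _ => I).
pose g x := ((B + 1)%:E * `|Km m a x|)%E.
have B1 : 0 < B + 1.
  by rewrite ltr_wpDl// (le_trans _ (hB (0 : point))).
have ig : leb.-integrable (supp w) g.
  by apply: integrableZl => //; exact: integrable_abse.
have mKm := measurable_Km m a.
have [] := @dominated_convergence _ _ _ leb (supp w) mK
  (fun k x => (Km_eps m a (eps k) x * h x)%:E) (fun x => Km m a x * (h x)%:E)%E g _ _ _ ig.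
- move=> k; apply: measurable_funTS; apply/measurable_EFinP; apply: measurable_funM => //.
  by apply: continuous_rV_measurable; exact: continuous_Km_eps.
- by apply: measurable_funTS; apply: emeasurable_funM => //; exact/measurable_EFinP.
(* Integrability makes [Km] finite almost everywhere, which excludes x = a. *)
- apply: filterS (integrable_ae mK iKm) => x /[apply] Kx.
  have xa : x != a by apply/eqP => xa; move: Kx; rewrite /Km xa eqxx.
  rewrite KmE// -EFinM; apply: cvg_EFin; first exact: nearW.
  apply: cvgM; last exact: cvg_cst.
  have /cvg_at_rightP := @cvg_Km_eps R n m a x xa; apply; split => //.
  exact: cvg_harmonic.
- apply: nearW => x k _; rewrite /g.
  have Kle := Km_le_eps a m0 mn x (eps0 k).
  have K0 := Km_eps_le0 m a (eps k) x.
  rewrite -/(_ * _)%R EFinM abseM muleC lee_pmul//.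
    by rewrite lee_fin (le_trans (hB x))// lerDl.
  rewrite !lee0_abs ?leeN2//; last by rewrite (le_trans Kle).
- move=> _ _ lim; rewrite restrict; apply: (cvge_ge _ lim); apply: nearW => k /=.
  have := integral_Km_eps_mixed_ge0 (eps0 k) tw w0.
  by under eq_integral do rewrite EFinM; rewrite restrict; under eq_integral do rewrite -EFinM.
Qed.

End quaternionic_subharmonicity.

Theorem proposition8p1 (R : realType) (n m : nat) (a : 'rV[R]_(4 * n)) :
  (1 <= m)%N -> (m <= n)%N ->
  QSH m setT (Km m a) /\ hessian_op_Km_eq_dirac m a (@Cmn R n m).
Proof.
move=> m0 mn; split; last exact: hessian_op_Km_dirac.
split.
- by move=> x _; exact: Km_neq_pinfty.
- exact: usc_Km.
- exact: L1loc_Km.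
- move=> v w Cv tw w0; have [Cw _ _] := tw.
  have Cv4 i : Ck 4 setT (v i) by have [] := Cv i.
  have sv i x : closure (Gamma_cone m) (qhessian (v i) x).
    by have [_ [_]] := Cv i; exact.
  split; first exact: integral_Km_mixed_ge0.
  (* Mixed products of hyperhermitian matrices are real, so the density has no imaginary part. *)
  under eq_integral => x _ do rewrite (top_coef_mixed_form_real m0 mn Cv4 x (Cw 2)) mule0.
  by rewrite integral0.
Qed.
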